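(* Let $M$ be a connected smooth manifold of dimension $n\ge2$ with a smooth symmetric affine connection $\Gamma$ and a smooth everywhere non-degenerate operator field $\mathbf A$ of type $(1,1)$, and consider the system $$\frac{\partial y^i}{\partial t}=\sum_{j=1}^nA^i_j\Big(\frac{\partial^2y^j}{\partial x^2}+\sum_{r,s=1}^n\Gamma^j_{rs}\frac{\partial y^r}{\partial x}\frac{\partial y^s}{\partial x}\Big),\quad i=1,\dots,n.$$ Suppose that the system belongs to the $m$-th case of intermediate degeneration for some $1\le m\le n-1$, and that its algebra of point symmetries has the maximal dimension $\dim\mathcal G=n(n+1-m)+\frac{m(m-1)}2$. Then (near every point of $M$) there is a point transformation $\tilde y^i=\tilde y^i(y^1,\dots,y^n)$, i.e. a change of local coordinates on $M$, bringing the system to the form (tildes omitted) $$\frac{\partial y^i}{\partial t}=a\,\frac{\partial^2y^i}{\partial x^2}-2a\Big(\sum_{r=1}^mu_r\frac{\partial y^r}{\partial x}\Big)\frac{\partial y^i}{\partial x},\quad i=1,\dots,n,$$ where $a=\mathrm{const}$ and $u_r=u_r(y^1,\dots,y^m)$, i.e. the $u_r$ depend on $y^1,\dots,y^m$ only, are components of some covector field $\mathbf u$.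
   Context: The coefficients $A^i_j$, $\Gamma^j_{rs}=\Gamma^j_{sr}$ are functions of $y^1,\dots,y^n$ only; the $y^i$ are local coordinates on $M$, and under change of coordinates $A^i_j$ transform as a $(1,1)$ tensor and $\Gamma^j_{rs}$ as an affine connection. Point symmetries: a vector field $\boldsymbol\eta=\sum_i\eta^i(y)\,\partial/\partial y^i$ on $M$ whose local flow carries solutions to solutions ($x,t$ unchanged); this is expressed by the determining equations, which (for non-degenerate $\mathbf A$) read: $L_{\boldsymbol\eta}\mathbf A=0$ and $$\sum_k\frac{\partial\eta^i}{\partial y^k}\Gamma^k_{rs}=\frac{\partial^2\eta^i}{\partial y^r\partial y^s}+\sum_k\Big(\frac{\partial\Gamma^i_{rs}}{\partial y^k}\eta^k+\Gamma^i_{ks}\frac{\partial\eta^k}{\partial y^r}+\Gamma^i_{rk}\frac{\partial\eta^k}{\partial y^s}\Big)$$ (i.e. $\boldsymbol\eta$ is an infinitesimal affine transformation of $\Gamma$). $\mathcal G$ is the real Lie algebra of all point symmetries on $M$. Curvature: $R^i_{srk}=\frac{\partial\Gamma^i_{ks}}{\partial y^r}-\frac{\partial\Gamma^i_{rs}}{\partial y^k}+\sum_q(\Gamma^q_{ks}\Gamma^i_{rq}-\Gamma^q_{rs}\Gamma^i_{kq})$. Ricci tensor: $R_{ij}=\sum_kR^k_{ikj}$, with symmetric part $\hat R_{ij}=\frac12(R_{ij}+R_{ji})$. The system belongs to the $m$-th case of intermediate degeneration ($1\le m\le n-1$) if the rank of $(\hat R_{ij})$ equals $m$ everywhere on $M$.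 *)

(* Defs.v *)
From HB Require Import structures.
From mathcomp Require Import all_boot all_order all_algebra.
From mathcomp Require Import all_classical all_reals all_analysis.

Set Implicit Arguments.
Unset Strict Implicit.
Unset Printing Implicit Defensive.

Import Order.TTheory GRing.Theory Num.Theory.
Import numFieldNormedType.Exports.

Local Open Scope classical_set_scope.
Local Open Scope ring_scope.

Section Euclidean.
Context (R : realType) (n : nat).
Implicit Types (f : 'rV[R]_n -> R) (U : set 'rV[R]_n).

Definition partial (k : 'I_n) f : 'rV[R]_n -> R :=
  fun y => 'D_(delta_mx 0 k) f y.

Definition iter_partial (s : seq 'I_n) f : 'rV[R]_n -> R := foldr partial f s.

(* C^oo on U, for U open: all iterated partial derivatives exist and are
   continuous at the points of U.  The values of f outside U are irrelevant. *)
Definition smooth_on U f : Prop :=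
  forall (s : seq 'I_n) (y : 'rV[R]_n), U y ->
    {for y, continuous (iter_partial s f)} /\
    forall k : 'I_n, derivable (iter_partial s f) y (delta_mx 0 k).

End Euclidean.

(* A chart is a homeomorphism from the open set cdom of T onto the open set
   ccod of R^n; cfwd and cbwd are total functions whose values outside cdom and
   ccod carry no meaning. *)
Record chart (R : realType) (n : nat) (T : topologicalType) := Chart {
  cdom : set T;
  ccod : set 'rV[R]_n;
  cfwd : T -> 'rV[R]_n;
  cbwd : 'rV[R]_n -> T;
  cdom_open : open cdom;
  ccod_open : open ccod;
  cfwd_sub : forall x, cdom x -> ccod (cfwd x);
  cbwd_sub : forall y, ccod y -> cdom (cbwd y);
  cfwdK : forall x, cdom x -> cbwd (cfwd x) = x;
  cbwdK : forall y, ccod y -> cfwd (cbwd y) = y;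
  cfwd_cont : forall x, cdom x -> {for x, continuous cfwd};
  cbwd_cont : forall y, ccod y -> {for y, continuous cbwd}
}.

Section Transition.
Context (R : realType) (n : nat) (T : topologicalType).
Implicit Types (c d : chart R n T).

(* The points at which the change of coordinates from c to d is defined,
   described by their coordinates in c. *)
Definition overlap c d : set 'rV[R]_n := ccod c `&` cbwd c @^-1` cdom d.

Definition transition c d : 'rV[R]_n -> 'rV[R]_n := cfwd d \o cbwd c.

Definition tcoord c d (i : 'I_n) : 'rV[R]_n -> R :=
  fun y => transition c d y 0 i.

Definition jac c d (i j : 'I_n) : 'rV[R]_n -> R := partial j (tcoord c d i).

Definition compatible c d : Prop :=
  (forall i, smooth_on (overlap c d) (tcoord c d i)) /\
  (forall i, smooth_on (overlap d c) (tcoord d c i)).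

End Transition.

(* The atlas is maximal, so its members are exactly the local coordinate
   systems of the manifold. *)
Record smoothManifold (R : realType) (n : nat) := SmoothManifold {
  carrier :> topologicalType;
  atlas : set (chart R n carrier);
  carrier_hausdorff : hausdorff_space carrier;
  carrier_second_countable : @second_countable carrier;
  atlas_cover : forall p : carrier, exists2 c, atlas c & cdom c p;
  atlas_compatible : forall c d, atlas c -> atlas d -> compatible c d;
  atlas_maximal : forall c, (forall d, atlas d -> compatible c d) -> atlas c
}.

(* Tensor fields and connections are given by their components in each chart
   of the atlas, as functions of the coordinates, subject to the transformation
   law from one chart to another. *)
Section Fields.
Context (R : realType) (n : nat) (M : smoothManifold R n).
Local Notation chartM := (chart R n M).

Record operatorField := OperatorField {
  op :> chartM -> 'I_n -> 'I_n -> 'rV[R]_n -> R;   (* op c i j = A^i_j *)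
  op_smooth : forall c i j, atlas c -> smooth_on (ccod c) (op c i j);
  op_transform : forall c d, atlas c -> atlas d ->
    forall y, overlap c d y -> forall i j,
      \sum_k op d i k (transition c d y) * jac c d k j y =
      \sum_k jac c d i k y * op c k j y
}.

Definition nondegenerate_op (A : operatorField) : Prop :=
  forall c, atlas c -> forall y, ccod c y ->
    (\matrix_(i, j) A c i j y) \in unitmx.

Record symmetricConnection := SymmetricConnection {
  conn :> chartM -> 'I_n -> 'I_n -> 'I_n -> 'rV[R]_n -> R;
                                                 (* conn c j r s = Gamma^j_rs *)
  conn_smooth : forall c j r s, atlas c -> smooth_on (ccod c) (conn c j r s);
  conn_symmetric : forall c, atlas c -> forall y, ccod c y ->
    forall j r s, conn c j r s y = conn c j s r y;
  conn_transform : forall c d, atlas c -> atlas d ->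
    forall y, overlap c d y -> forall i r s,
      partial r (partial s (tcoord c d i)) y +
        \sum_p \sum_q conn d i p q (transition c d y)
                      * jac c d p r y * jac c d q s y =
      \sum_k jac c d i k y * conn c k r s y
}.

Definition vfield := chartM -> 'rV[R]_n -> 'rV[R]_n.

Definition vcoord (X : vfield) (c : chartM) (i : 'I_n) : 'rV[R]_n -> R :=
  fun y => X c y 0 i.

(* The last clause fixes the meaningless values, so that two vector fields are
   equal as functions exactly when they are equal as vector fields on M. *)
Definition smooth_vfield (X : vfield) : Prop :=
  [/\ forall c i, atlas c -> smooth_on (ccod c) (vcoord X c i),
      forall c d, atlas c -> atlas d -> forall y, overlap c d y -> forall i,
        vcoord X d i (transition c d y) =
        \sum_k jac c d i k y * vcoord X c k y
    & forall c y, ~ (atlas c /\ ccod c y) -> X c y = 0].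

Section System.
Variables (A : operatorField) (G : symmetricConnection).

(* In the chart c the system is y_t = F(y, y_x, y_xx), where
   F(y, p, q) = system_rhs c y p q. *)
Definition system_rhs (c : chartM) (y p q : 'rV[R]_n) : 'rV[R]_n :=
  \row_i \sum_j A c i j y *
    (q 0 j + \sum_r \sum_s G c j r s y * p 0 r * p 0 s).

Definition lie_derivative_op (X : vfield) (c : chartM) (i j : 'I_n)
    (y : 'rV[R]_n) : R :=
  \sum_k (vcoord X c k y * partial k (A c i j) y
          - partial k (vcoord X c i) y * A c k j y
          + A c i k y * partial j (vcoord X c k) y).

Definition affine_equation (X : vfield) (c : chartM) (i r s : 'I_n)
    (y : 'rV[R]_n) : Prop :=
  \sum_k partial k (vcoord X c i) y * G c k r s y =
  partial r (partial s (vcoord X c i)) y +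
  \sum_k (partial k (G c i r s) y * vcoord X c k y
          + G c i k s y * partial r (vcoord X c k) y
          + G c i r k y * partial s (vcoord X c k) y).

(* The determining equations of the point symmetries. *)
Definition point_symmetry : set vfield := fun X =>
  smooth_vfield X /\
  forall c, atlas c -> forall y, ccod c y ->
    (forall i j, lie_derivative_op X c i j y = 0) /\
    (forall i r s, affine_equation X c i r s y).

(* curvature c i s r k = R^i_srk *)
Definition curvature (c : chartM) (i s r k : 'I_n) (y : 'rV[R]_n) : R :=
  partial r (G c i k s) y - partial k (G c i r s) y +
  \sum_q (G c q k s y * G c i r q y - G c q r s y * G c i k q y).

Definition ricci (c : chartM) (i j : 'I_n) (y : 'rV[R]_n) : R :=
  \sum_k curvature c k i k j y.

Definition sym_ricci (c : chartM) (y : 'rV[R]_n) : 'M[R]_n :=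
  \matrix_(i, j) ((ricci c i j y + ricci c j i y) / 2).

Definition intermediate_degeneration (m : nat) : Prop :=
  (1 <= m <= n.-1)%N /\
  forall c, atlas c -> forall y, ccod c y -> \rank (sym_ricci c y) = m.

End System.
End Fields.

(* The subspace S of V, possibly of infinite-dimensional V, has a basis of N
   vectors. *)
Definition has_dim (R : realType) (V : lmodType R) (S : set V) (N : nat) :
    Prop :=
  exists e : 'I_N -> V,
    (forall k, S (e k)) /\
    forall v, S v -> exists! a : 'rV[R]_N, v = \sum_k a 0 k *: e k.

Definition first_coords (R : realType) (m n : nat) (hmn : (m <= n)%N)
    (y : 'rV[R]_n) : 'rV[R]_m :=
  \row_r y 0 (widen_ord hmn r).

(* Main.v *)
From HB Require Import structures.
Require Import Defs.
From mathcomp Require Import all_boot all_order all_algebra.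
From mathcomp Require Import all_classical all_reals all_analysis.
From mathcomp Require Import ring lra.

Set Implicit Arguments.
Unset Strict Implicit.
Unset Printing Implicit Defensive.

Import Order.TTheory GRing.Theory Num.Theory numFieldNormedType.Exports.

Local Open Scope classical_set_scope.
Local Open Scope ring_scope.

(** Let S be the symmetrized Ricci tensor, of constant rank m < n.  An
    infinitesimal affine transformation eta is determined by its 1-jet
    (eta, d eta) at one point, and the 1-jets allowed by L_eta S = 0 form a space
    of dimension n(n+1-m) + m(m-1)/2; so, in the case of maximal symmetry, every
    allowed jet is realized by a point symmetry.

    For w in ker S all the jets (0, w (x) xi) are allowed.  They commute with A,
    which is therefore scalar, and constant by transitivity.  They also force
    Ric(w, .) = Ric(., w) = 0, (nabla_l S) w = 0 and R(w, r) s = B_rs w.  Hence the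
    field eta with jet eta = w, nabla eta = 0 at p satisfies
    nabla eta = eta (x) alpha near p: the deviation from this equation obeys a
    homogeneous linear differential inequality (Gronwall), where the terms
    vanishing for eta in ker S are bounded by |eta S| because the rank of S is
    constant.  For the same reason the field with jet (0, w (x) e_l) is f_l eta,
    with nabla df_l = - (alpha (x) df_l + df_l (x) alpha).  In the coordinates
    f_1, ..., f_n one gets Gamma^i_rs = alpha_r delta^i_s + alpha_s delta^i_r, with
    a new covector field alpha vanishing at p.

    In such coordinates the fields with jets (w, 0) and (0, w (x) xi) at p,
    w in ker S, have vanishing second derivatives, and the equation that they
    satisfy reduces to L_eta alpha = 0.  This yields d_w alpha = 0 and
    alpha(w) = 0.  After a linear change of coordinates ker S(p) is spanned by the
    last n - m coordinate vectors, and u = - alpha. *)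

(** * Differential calculus on R^n *)

(** No existence theorem for differential equations is invoked. Every field comes from the dimension
    count of the symmetry algebra, the functions f_l are ratios of components of such fields, and
    the differential inequalities only show that what vanishes at p vanishes near p.

    Two obstacles shape the central estimate. The pointwise identities hold for vectors of ker S,
    while eta is known to lie in ker S only at p; so eta S itself joins the deviation as an unknown
    of the inequality. And alpha is not given in advance: it is read off from the row i0 of nabla
    eta, where the component eta^i0 does not vanish. That row of the deviation is then identically
    zero, and the same row of the differentiated equation bounds the one term that contains
    derivatives of alpha. The same device, applied to zeta - f eta, gives the second order equation
    of f = f_l.

    The passage from fields to alpha in the last part rests on the symmetry of third derivatives: it
    forces L_eta alpha to be constant, hence zero because it vanishes at p. *)

Section Calculus.
Context {R : realType}.

Section MeanValue.
Context {V : normedModType R}.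
Implicit Types (f : V -> R) (y v : V).

Lemma is_derive_line f y v (t : R) : derivable f (t *: v + y) v ->
  is_derive t 1 (fun s : R => f (s *: v + y)) ('D_v f (t *: v + y)).
Proof.
move=> df.
have E : (fun h : R => h^-1 *: (((fun s => f (s *: v + y)) \o shift t) (h *: 1)
     - f (t *: v + y))) =
  (fun h : R => h^-1 *: ((f \o shift (t *: v + y)) (h *: v) - f (t *: v + y))).
  by apply/funext => h /=; rewrite [h *: 1]mulr1 scalerDl addrA.
by apply: DeriveDef; rewrite /derivable /derive E.
Qed.

(** Derivability is asked only in the direction [v] and along the segment, because the proof of
    differentiability starts from partial derivatives alone. The sign of [a] is free, hence two
    cases with the ends of the segment exchanged. *)
Lemma mean_value_line f y v (a : R) :
    (forall t, `|t| <= `|a| -> derivable f (t *: v + y) v) ->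
  exists2 c, `|c| <= `|a| & f (a *: v + y) - f y = a * 'D_v f (c *: v + y).
Proof.
move=> df; have [a0|a0] := leP 0 a.
  have [|c|c] := @MVT_segment R (fun s : R => f (s *: v + y))
    (fun s => 'D_v f (s *: v + y)) 0 a a0.
  - move=> t; rewrite in_itv /= => /andP[t0 ta]; apply/is_derive_line/df.
    by rewrite !ger0_norm// ltW.
  - apply: derivable_within_continuous => t; rewrite in_itv /= => /andP[t0 ta].
    have /is_derive_line[] // : derivable f (t *: v + y) v.
    by apply: df; rewrite !ger0_norm.
  rewrite in_itv /= => /andP[c0 ca] E; exists c; first by rewrite !ger0_norm.
  by move: E; rewrite scale0r add0r subr0 mulrC.
have [|c|c] := @MVT_segment R (fun s : R => f (s *: v + y))
    (fun s => 'D_v f (s *: v + y)) a 0 (ltW a0).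
- move=> t; rewrite in_itv /= => /andP[ta t0]; apply/is_derive_line/df.
  by rewrite (ler0_norm (ltW t0)) (ler0_norm (ltW a0)) lerN2 ltW.
- apply: derivable_within_continuous => t; rewrite in_itv /= => /andP[t0 ta].
  have /is_derive_line[] // : derivable f (t *: v + y) v.
  by apply: df; rewrite (ler0_norm ta) (ler0_norm (ltW a0)) lerN2.
rewrite in_itv /= => /andP[c0 ca] E; exists c.
  by rewrite (ler0_norm ca) (ler0_norm (ltW a0)) lerN2.
by move: E; rewrite scale0r add0r sub0r mulrN => /eqP;
  rewrite -eqr_oppLR opprB => /eqP ->; rewrite mulrC.
Qed.

End MeanValue.

Lemma continuous_at_sum (T : topologicalType) (I : Type) (r : seq I)
    (P : pred I) (F : I -> T -> R) (x : T) :
  (forall i, P i -> continuous_at x (F i)) ->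
  continuous_at x (fun y => \sum_(i <- r | P i) F i y).
Proof.
move=> H; elim: r => [|i r IH].
  have -> : (fun y : T => \sum_(i <- [::] | P i) F i y) = (fun=> 0).
    by apply/funext => y; rewrite big_nil.
  exact: cst_continuous.
have -> : (fun y : T => \sum_(j <- i :: r | P j) F j y) =
  (fun y : T => if P i then F i y + \sum_(i <- r | P i) F i y
            else \sum_(i <- r | P i) F i y).
  by apply/funext => y; rewrite big_cons.
case Pi: (P i) => //; apply: continuousD; [exact: H|exact: IH].
Qed.

Section Ck.
Context {n : nat}.
Implicit Types (f g : 'rV[R]_n -> R) (U : set 'rV[R]_n) (y : 'rV[R]_n).
Local Notation e_ k := (delta_mx 0 k : 'rV[R]_n).

Lemma coord_le_norm y i : `|y 0 i| <= `|y|.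
Proof.
by rewrite {2}/Num.Def.normr /= mx_normrE; apply: (le_bigmax _ _ (0, i)).
Qed.

Lemma norm_le_coord y (r : R) : 0 <= r -> (forall i, `|y 0 i| <= r) -> `|y| <= r.
Proof.
move=> r0 H; rewrite /Num.Def.normr /= mx_normrE; apply: bigmax_le => //.
by move=> [i j] _ /=; rewrite ord1.
Qed.

(** The increment of [f] is split along a path of coordinate steps; the mean value theorem turns
    each step into a partial derivative at a nearby point, and continuity of the partial derivatives
    at [y] moves it to [y]. *)
Lemma C1_differentiable f U y : open U -> U y ->
    (forall z k, U z -> derivable f z (e_ k)) ->
    (forall k, {for y, continuous (partial k f)}) ->
  differentiable f y /\ forall v, 'd f y v = \sum_k v 0 k * partial k f y.
Proof.
move=> oU Uy df cf.
pose L (v : 'rV[R]_n) := \sum_k v 0 k * partial k f y.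
have Llin : linear L.
  move=> a u v; rewrite /L /GRing.scale /= mulr_sumr -big_split; apply: eq_bigr.
  by move=> k _; rewrite !mxE mulrDl mulrA.
pose LM := GRing.isLinear.Build _ _ _ _ L Llin.
pose LL : {linear 'rV[R]_n -> R} := HB.pack L LM.
have cL : continuous L.
  move=> x; apply: continuous_at_sum => k _; apply: (@continuousM _ _ (fun v : 'rV[R]_n => v 0 k) (fun=> partial k f y)).
    exact: coord_continuous.
  exact: cst_continuous.
suff H : f \o shift y = cst (f y) + LL +o_ (0 : 'rV[R]_n) id.
  have E := @diff_unique _ _ _ _ LL _ cL H.
  split; last by move=> v; rewrite E.
  by apply/diff_locallyP; split; rewrite E.
apply/eqaddoP => _/posnumP[e].
have [r r0 rU] : exists2 r : R, 0 < r & ball y r `<=` U.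
  have /nbhs_ballP[r /= r0 rU] : nbhs y U by apply: open_nbhs_nbhs; split.
  by exists r.
(* Each of the n steps may contribute this much; n + 1 instead of n keeps the denominator
   nonzero. *)
have e0 : 0 < e%:num / n.+1%:R by rewrite divr_gt0.
have fk k : \forall z \near y, `|partial k f y - partial k f z|
     <= e%:num / n.+1%:R.
  by have /cvgrPdist_le := cf k; apply.
have /nbhs_ballP[s /= s0 sk] : nbhs y (fun z => forall k,
    `|partial k f y - partial k f z| <= e%:num / n.+1%:R).
  exact: @filter_forall _ _ _ (nbhs y) _ fk.
apply/nbhs_ballP; exists (Order.min r s); first by rewrite /= lt_min r0 s0.
move=> h; rewrite -ball_normE /= sub0r normrN lt_min => /andP[hr hs].
(* The vertices of the path from 0 to [h]. In the maximum norm the path never leaves the ball of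
   radius |h|. *)
pose H k : 'rV[R]_n := \row_j (if (j < k)%N then h 0 j else 0).
have Hn k : `|H k| <= `|h|.
  apply: norm_le_coord => // i; rewrite mxE; case: ifP => _; last by rewrite normr0.
  exact: coord_le_norm.
have HS (k : 'I_n) : H k.+1 = h 0 k *: e_ k + H k.
  apply/rowP => j; rewrite !mxE eqxx /= ltnS leq_eqVlt.
  have [->|] := eqVneq (j : 'I_n) k; first by rewrite eqxx ltnn addr0 mulr1.
  by move=> jk; rewrite -[nat_of_ord j == k]/(j == k) (negbTE jk) mulr0 add0r.
have Hk (k : 'I_n) (c : R) : `|c| <= `|h 0 k| -> `|c *: e_ k + H k| <= `|h|.
  move=> ck; apply: norm_le_coord => // i; rewrite !mxE eqxx /=.
  have [->|_] := eqVneq i k.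
    by rewrite ltnn addr0 mulr1 (le_trans ck) // coord_le_norm.
  rewrite mulr0 add0r; case: ifP; rewrite ?normr0 // => _; exact: coord_le_norm.
have step (k : 'I_n) : `|f (H k.+1 + y) - f (H k + y) - h 0 k * partial k f y|
   <= `|h| * (e%:num / n.+1%:R).
  have [t tk|c ck E] := @mean_value_line _ f (H k + y) (e_ k) (h 0 k).
    apply/df/rU; rewrite -ball_normE /= addrA opprD addrCA subrr addr0 normrN.
    exact: le_lt_trans (Hk _ _ tk) hr.
  rewrite HS -[_ + H k + y]addrA E -mulrBr normrM ler_pM // ?coord_le_norm // distrC.
  apply: sk; rewrite -ball_normE /= addrA opprD addrCA subrr addr0 normrN.
  exact: le_lt_trans (Hk _ _ ck) hs.
have tel : f (h + y) - f y = \sum_(k < n) (f (H k.+1 + y) - f (H k + y)).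
  rewrite -(big_mkord xpredT (fun k => f (H k.+1 + y) - f (H k + y))).
  rewrite (telescope_sumr (fun k => f (H k + y))) //; congr (f (_ + _) - f _).
    by apply/rowP => j; rewrite mxE ltn_ord.
  by apply/rowP => j; rewrite !mxE ltn0 add0r.
rewrite [X in `|X|](_ : _ = \sum_(k < n) (f (H k.+1 + y) - f (H k + y)
     - h 0 k * partial k f y)); last first.
  transitivity (f (h + y) - (f y + L h)); first by [].
  by rewrite big_split -tel sumrN opprD addrA.
apply: le_trans (ler_norm_sum _ _ _) _.
apply: le_trans (ler_sum _ (fun k _ => step k)) _.
rewrite sumr_const card_ord -[leLHS]mulr_natr -mulrA [leRHS]mulrC ler_wpM2l //.
by rewrite -mulrA ler_piMr // ler_pdivrMl // mulr1 ler_nat.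
Qed.

(** A recursion on the order allows sums, products and inverses to be treated by induction on N;
    with lists of derivatives a Leibniz formula over sublists would be required. *)
Fixpoint ck N U f : Prop := match N with
  | 0 => forall y, U y -> {for y, continuous f}
  | N.+1 => (forall y, U y -> {for y, continuous f}) /\
     forall k, (forall y, U y -> derivable f y (e_ k)) /\ ck N U (partial k f)
  end.

(** [iter_partial] applies the head of the list last, whereas [ck] peels off the innermost
    derivative; this is why lists are decomposed from their end. *)
Lemma smooth_onP U f : smooth_on U f <-> forall N, ck N U f.
Proof.
split=> [sf N|cf].
  elim: N f sf => [|N IH] f sf /=; first by move=> y Uy; have [] := sf [::] y Uy.
  split; first by move=> y Uy; have [] := sf [::] y Uy.
  move=> k; split; first by move=> y Uy; have [_] := sf [::] y Uy; apply.
  apply: IH => s y Uy; have := sf (rcons s k) y Uy.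
  by rewrite /iter_partial foldr_rcons.
move=> s; elim/last_ind: s f cf => [|s k IH] f cf y Uy.
  have /= [c d] := cf 1%N; split; first exact: c.
  by move=> k; apply: (proj1 (d k)).
rewrite /iter_partial foldr_rcons; apply: IH => // N.
by have /= [_ /(_ k)[]] := cf N.+1.
Qed.

Lemma ckW N U f : ck N.+1 U f -> ck N U f.
Proof.
elim: N f => [|N IH] f; first by case.
by move=> [c H]; split=> // k; have [d /IH] := H k.
Qed.

Lemma ck_differentiable U f y : open U -> U y -> ck 1 U f -> differentiable f y.
Proof.
move=> oU Uy [c H]; apply: (proj1 (C1_differentiable oU Uy _ _)).
  by move=> z k Uz; apply: (proj1 (H k)).
by move=> k; apply: (proj2 (H k)).
Qed.

Lemma near_eq_continuous f g y : (\forall z \near y, f z = g z) ->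
  {for y, continuous f} -> {for y, continuous g}.
Proof.
move=> fg cf; change (g @ y --> g y); rewrite -(nbhs_singleton fg).
exact: cvg_trans (near_eq_cvg fg) cf.
Qed.

Lemma ck_eq N U f g : open U -> (forall y, U y -> f y = g y) ->
  ck N U f -> ck N U g.
Proof.
move=> oU; elim: N f g => [|N IH] f g fg.
  move=> H y Uy; apply: near_eq_continuous (H y Uy).
  by apply: filterS (open_nbhs_nbhs (conj oU Uy)) => z /fg ->.
have near_fg y : U y -> \forall z \near y, f z = g z.
  by move=> Uy; apply: filterS (open_nbhs_nbhs (conj oU Uy)) => z /fg ->.
move=> [c H]; split.
  by move=> y Uy; apply: near_eq_continuous (c y Uy); exact: near_fg.
move=> k; have [d Hk] := H k; split.
  by move=> y Uy; apply: near_eq_derivable (d y Uy); exact: near_fg.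
by apply: IH Hk => y Uy; apply: near_eq_derive; exact: near_fg.
Qed.

Lemma partial_eq U f g y k : open U -> U y -> (forall z, U z -> f z = g z) ->
  partial k f y = partial k g y.
Proof.
move=> oU Uy fg; apply: near_eq_derive.
by apply: filterS (open_nbhs_nbhs (conj oU Uy)) => z /fg ->.
Qed.

Lemma ck_cst N U (a : R) : ck N U (fun=> a).
Proof.
elim: N a => [|N IH] a /=; first by move=> y _; apply: cst_continuous.
split; first by move=> y _; apply: cst_continuous.
move=> k; split; first by move=> y _; apply: derivable_cst.
rewrite [partial _ _](_ : _ = fun=> 0) //.
by apply/funext => y; rewrite /partial derive_cst.
Qed.

Lemma ck_coord N U i : ck N U (fun y => y 0 i).
Proof.
have D y k : is_derive y (e_ k) (fun y => y 0 i) ((i == k)%:R : R).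
  apply: DeriveDef; first exact/diff_derivable/differentiable_coord.
  have /derive_mx : derivable (fun y : 'rV[R]_n => y) y (e_ k).
    exact: derivable_id.
  by rewrite derive_id => /matrixP /(_ 0 i); rewrite !mxE eqxx /= => ->.
case: N => [|N] /=; first by move=> y _; exact: coord_continuous.
split; first by move=> y _; exact: coord_continuous.
move=> k; split; first by move=> y _; have [] := D y k.
rewrite [partial _ _](_ : _ = fun=> (i == k)%:R); first exact: ck_cst.
by apply/funext => y; have [_ ] := D y k.
Qed.

Lemma ckD N U f g : open U -> ck N U f -> ck N U g -> ck N U (fun y => f y + g y).
Proof.
move=> oU; elim: N f g => [|N IH] f g.
  by move=> cf cg y Uy; apply: continuousD; [exact: cf|exact: cg].
move=> [cf Hf] [cg Hg]; split.
  by move=> y Uy; apply: continuousD; [exact: cf|exact: cg].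
move=> k; have [df Pf] := Hf k; have [dg Pg] := Hg k; split.
  by move=> y Uy; apply: derivableD; [exact: df|exact: dg].
apply: ck_eq (IH _ _ Pf Pg) => // y Uy.
by rewrite /partial deriveD //; [exact: df|exact: dg].
Qed.

Lemma ckM N U f g : open U -> ck N U f -> ck N U g -> ck N U (fun y => f y * g y).
Proof.
move=> oU; elim: N f g => [|N IH] f g.
  by move=> cf cg y Uy; apply: continuousM; [exact: cf|exact: cg].
move=> Hf0 Hg0; case: (Hf0) => [cf Hf]; case: (Hg0) => [cg Hg]; split.
  by move=> y Uy; apply: continuousM; [exact: cf|exact: cg].
move=> k; have [df Pf] := Hf k; have [dg Pg] := Hg k; split.
  by move=> y Uy; apply: derivableM; [exact: df|exact: dg].
apply: (@ck_eq _ _ (fun y => f y * partial k g y + g y * partial k f y)) => //.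
  by move=> y Uy; rewrite /partial deriveM //; [exact: df|exact: dg].
by apply: ckD => //; apply: IH => //; apply: ckW.
Qed.

Lemma ckV N U f : open U -> (forall y, U y -> f y != 0) -> ck N U f ->
  ck N U (fun y => (f y)^-1).
Proof.
move=> oU f0; elim: N => [|N IH].
  by move=> cf y Uy; apply: (continuousV (f0 y Uy)); exact: cf.
move=> Hf0; case: (Hf0) => [cf Hf]; split.
  by move=> y Uy; apply: (continuousV (f0 y Uy)); exact: cf.
move=> k; have [df Pf] := Hf k; split.
  by move=> y Uy; apply: derivableV; [exact: f0|exact: df].
apply: (@ck_eq _ _ (fun y => (-1) * ((f y)^-1 * (f y)^-1) * partial k f y)) => //.
  move=> y Uy; rewrite /partial deriveV //; last exact: df.
    by rewrite /GRing.scale /= mulN1r -expr2 exprVn.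
  exact: f0.
have IHf := IH (ckW Hf0).
by apply: ckM => //; apply: ckM => //; [exact: ck_cst|exact: ckM].
Qed.

End Ck.
End Calculus.

(* [smooth] and [pd] are [smooth_on] and [partial] shielded from conversion:
   unifying two distinct instances of the latter unfolds limits, at great cost. *)
Inductive smooth (R : realType) (n : nat) (U : set 'rV[R]_n) (f : 'rV[R]_n -> R)
  : Prop := Smooth of smooth_on U f.

HB.lock Definition pd (R : realType) (n : nat) := @partial R n.
Arguments pd {R n}.

Lemma pdE (R : realType) (n : nat) : @partial R n = @pd R n.
Proof. by rewrite unlock. Qed.

Section Smooth.
Context {R : realType} {n : nat}.
Implicit Types (f g : 'rV[R]_n -> R) (U W : set 'rV[R]_n) (y : 'rV[R]_n).
Local Notation e_ k := (delta_mx 0 k : 'rV[R]_n).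

Lemma smoothE U f : smooth_on U f <-> smooth U f.
Proof. by split=> [|[]]. Qed.

Lemma smoothP U f : smooth U f <-> forall N, ck N U f.
Proof.
by split=> [[/smooth_onP]|] // H; apply/smoothE/smooth_onP.
Qed.

Lemma partialE f y k : 'D_(e_ k) f y = pd k f y.
Proof. by rewrite -pdE. Qed.

Lemma smooth_derivable U f y k : smooth U f -> U y -> derivable f y (e_ k).
Proof. by move=> [sf] Uy; have [_] := sf [::] y Uy; apply. Qed.

Lemma smooth_continuous U f y : smooth U f -> U y -> {for y, continuous f}.
Proof. by move=> [sf] Uy; have [] := sf [::] y Uy. Qed.

Lemma smooth_pd U f k : smooth U f -> smooth U (pd k f).
Proof.
move=> [sf]; split; rewrite -pdE => s y Uy; have := sf (rcons s k) y Uy.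
by rewrite /iter_partial foldr_rcons.
Qed.

Lemma smooth_sub U W f : U `<=` W -> smooth W f -> smooth U f.
Proof. by move=> UW [sf]; split=> s y /UW; exact: sf. Qed.

Lemma smooth_eq U f g : open U -> (forall y, U y -> f y = g y) ->
  smooth U f -> smooth U g.
Proof.
by move=> oU fg /smoothP sf; apply/smoothP => N; apply: ck_eq (sf N).
Qed.

Lemma pd_eq U f g y k : open U -> U y -> (forall z, U z -> f z = g z) ->
  pd k f y = pd k g y.
Proof. by rewrite -pdE; exact: partial_eq. Qed.

Lemma smooth_cst U (a : R) : smooth U (fun=> a).
Proof. by apply/smoothP => N; exact: ck_cst. Qed.

Lemma smooth_coord U i : smooth U (fun y => y 0 i).
Proof. by apply/smoothP => N; exact: ck_coord. Qed.

Section OpenSet.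
Variable U : set 'rV[R]_n.
Hypothesis oU : open U.

Lemma smoothD f g : smooth U f -> smooth U g ->
  smooth U (fun y => f y + g y).
Proof.
by move=> /smoothP sf /smoothP sg; apply/smoothP => N; apply: ckD.
Qed.

Lemma smoothM f g : smooth U f -> smooth U g ->
  smooth U (fun y => f y * g y).
Proof.
by move=> /smoothP sf /smoothP sg; apply/smoothP => N; apply: ckM.
Qed.

Lemma smoothV f : (forall y, U y -> f y != 0) -> smooth U f ->
  smooth U (fun y => (f y)^-1).
Proof. by move=> f0 /smoothP sf; apply/smoothP => N; apply: ckV. Qed.

Lemma smoothN f : smooth U f -> smooth U (fun y => - f y).
Proof.
move=> sf; rewrite (_ : (fun y => - f y) = (fun y => (-1) * f y)).
  exact/smoothM/sf/smooth_cst.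
by apply/funext => y; rewrite mulN1r.
Qed.

Lemma smoothB f g : smooth U f -> smooth U g ->
  smooth U (fun y => f y - g y).
Proof. by move=> sf sg; apply: smoothD => //; exact: smoothN. Qed.

Lemma smooth_sum (I : Type) (r : seq I) (P : pred I) (F : I -> 'rV[R]_n -> R) :
  (forall i, P i -> smooth U (F i)) ->
  smooth U (fun y => \sum_(i <- r | P i) F i y).
Proof.
move=> H; elim: r => [|i r IH].
  rewrite (_ : (fun y => _) = fun=> 0); first exact: smooth_cst.
  by apply/funext => y; rewrite big_nil.
rewrite (_ : (fun y => _) = fun y => if P i then F i y + \sum_(i <- r | P i) F i y
            else \sum_(i <- r | P i) F i y).
  by case Pi: (P i) => //; apply: smoothD => //; exact: H.
by apply/funext => y; rewrite big_cons.
Qed.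

Lemma smooth_prod (I : Type) (r : seq I) (F : I -> 'rV[R]_n -> R) :
  (forall i, smooth U (F i)) -> smooth U (fun y => \prod_(i <- r) F i y).
Proof.
move=> H; elim: r => [|i r IH].
  rewrite (_ : (fun y => _) = fun=> 1); first exact: smooth_cst.
  by apply/funext => y; rewrite big_nil.
rewrite (_ : (fun y => _) = fun y => F i y * \prod_(i <- r) F i y).
  exact: smoothM.
by apply/funext => y; rewrite big_cons.
Qed.

Lemma smooth_det p (F : 'rV[R]_n -> 'M[R]_p) :
  (forall i j, smooth U (fun y => F y i j)) -> smooth U (fun y => \det (F y)).
Proof.
move=> sF; apply: smooth_sum => s _; apply: smoothM; first exact: smooth_cst.
by apply: smooth_prod => i; exact: sF.
Qed.

Lemma smooth_invmx p (F : 'rV[R]_n -> 'M[R]_p) i j :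
  (forall y, U y -> F y \in unitmx) ->
  (forall i j, smooth U (fun y => F y i j)) ->
  smooth U (fun y => invmx (F y) i j).
Proof.
move=> uF sF.
apply: (@smooth_eq _ (fun y => (\det (F y))^-1 * ((-1) ^+ (j + i)
    * \det (row' j (col' i (F y)))))) => // [y Uy|].
  by rewrite /invmx uF // !mxE.
apply: smoothM; first apply: smoothV.
- by move=> y /uF; rewrite unitmxE unitfE.
- exact: smooth_det.
apply: smoothM; first exact: smooth_cst.
apply: smooth_det => a b; rewrite (_ : (fun y => _) = fun y => F y (lift j a) (lift i b)) //.
by apply/funext => y; rewrite !mxE.
Qed.

Lemma smooth_differentiable f y : smooth U f -> U y -> differentiable f y.
Proof. by move=> /smoothP sf Uy; apply: (ck_differentiable oU Uy). Qed.

Lemma derive_pd f y v : smooth U f -> U y ->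
  'D_v f y = \sum_k v 0 k * pd k f y.
Proof.
rewrite -pdE => sf Uy; have [df dE] : differentiable f y /\
    forall v, 'd f y v = \sum_k v 0 k * partial k f y.
  apply: (C1_differentiable oU Uy); first by move=> z k; exact: smooth_derivable.
  by move=> k; rewrite pdE; apply: (smooth_continuous (smooth_pd k sf) Uy).
by rewrite deriveE.
Qed.

Lemma pdD f g y k : smooth U f -> smooth U g -> U y ->
  pd k (fun z => f z + g z) y = pd k f y + pd k g y.
Proof.
by move=> sf sg Uy; rewrite -!partialE -deriveD //;
  apply: smooth_derivable Uy.
Qed.

Lemma pdM f g y k : smooth U f -> smooth U g -> U y ->
  pd k (fun z => f z * g z) y = f y * pd k g y + pd k f y * g y.
Proof.
move=> sf sg Uy; rewrite [pd k f y * _]mulrC.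
by rewrite -!partialE -deriveM //; apply: smooth_derivable Uy.
Qed.

Lemma pd_cst (a : R) y k : pd k (fun=> a) y = 0.
Proof. by rewrite -partialE derive_cst. Qed.

Lemma pd_coord i y k : pd k (fun z : 'rV[R]_n => z 0 i) y = (i == k)%:R.
Proof.
have /derive_mx : derivable (fun y : 'rV[R]_n => y) y (e_ k).
  exact: derivable_id.
by rewrite -partialE derive_id => /matrixP /(_ 0 i); rewrite !mxE eqxx /= => ->.
Qed.

Lemma pdZ (a : R) f y k : smooth U f -> U y ->
  pd k (fun z => a * f z) y = a * pd k f y.
Proof.
by move=> sf Uy; rewrite pdM ?pd_cst ?mul0r ?addr0 //; exact: smooth_cst.
Qed.

Lemma pdN f y k : smooth U f -> U y ->
  pd k (fun z => - f z) y = - pd k f y.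
Proof.
move=> sf Uy; rewrite -[RHS]mulN1r -pdZ //.
by congr (pd k _ y); apply/funext => z; rewrite mulN1r.
Qed.

Lemma pdB f g y k : smooth U f -> smooth U g -> U y ->
  pd k (fun z => f z - g z) y = pd k f y - pd k g y.
Proof. by move=> sf sg Uy; rewrite pdD ?pdN //; exact: smoothN. Qed.

Lemma pd_sum (I : Type) (r : seq I) (P : pred I) (F : I -> 'rV[R]_n -> R) y k :
  (forall i, smooth U (F i)) -> U y ->
  pd k (fun z => \sum_(i <- r | P i) F i z) y
  = \sum_(i <- r | P i) pd k (F i) y.
Proof.
move=> sF Uy; elim: r => [|i r IH].
  rewrite (_ : (fun z => _) = fun=> 0) ?pd_cst ?big_nil //.
  by apply/funext => z; rewrite big_nil.
rewrite (_ : (fun z => _) = fun y => if P i then F i y + \sum_(i <- r | P i) F i y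
            else \sum_(i <- r | P i) F i y).
  rewrite big_cons; case Pi: (P i) => //; rewrite pdD ?IH //.
  by apply: smooth_sum => *; exact: sF.
by apply/funext => z; rewrite big_cons.
Qed.

Lemma ball_two_coords y r s (a b d : R) : `|b| + `|a| < d ->
  ball y d (b *: e_ s + (a *: e_ r + y)).
Proof.
have en k : `|e_ k| <= 1.
  apply: norm_le_coord => // i; rewrite mxE.
  by case: (_ && _); rewrite ?normr1 ?normr0.
move=> abd; rewrite -ball_normE /= addrA opprD addrCA subrr addr0 normrN.
apply: le_lt_trans abd; apply: le_trans (ler_normD _ _) _; rewrite !normrZ.
by apply: lerD; rewrite -[leRHS]mulr1 ler_wpM2l.
Qed.

(** The mean value theorem is used twice, for z |-> f(h e_s + z) - f(z) along e_r and then for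
    [pd r f] along e_s. The second difference itself is symmetric in [r] and [s], which is what
    [pd_comm] exploits. *)
Lemma second_difference f y r s (h d : R) : smooth U f -> ball y d `<=` U ->
    `|h| + `|h| < d ->
  exists c c', [/\ `|c| <= `|h|, `|c'| <= `|h| &
   f (h *: e_ s + (h *: e_ r + y)) - f (h *: e_ r + y) - (f (h *: e_ s + y) - f y)
   = h * (h * pd s (pd r f) (c' *: e_ s + (c *: e_ r + y)))].
Proof.
move=> sf yU hd.
have inU (a b : R) : `|a| <= `|h| -> `|b| <= `|h| -> U (b *: e_ s + (a *: e_ r + y)).
  by move=> ah bh; apply/yU/ball_two_coords/(le_lt_trans _ hd)/lerD.
have h0 : `|0 : R| <= `|h| by rewrite normr0.
have shift_der (a : R) z : U (a *: e_ s + z) ->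
    is_derive z (e_ r) (fun z => f (a *: e_ s + z)) (pd r f (a *: e_ s + z)).
  move=> Uz; have E : (fun t : R => t^-1 *: (((fun z => f (a *: e_ s + z)) \o shift z)
      (t *: e_ r) - f (a *: e_ s + z))) = (fun t : R => t^-1 *: ((f \o shift (a *: e_ s + z))
      (t *: e_ r) - f (a *: e_ s + z))).
    by apply/funext => t /=; rewrite addrCA.
  apply: DeriveDef; rewrite /derivable /derive E; last exact: partialE.
  exact: smooth_derivable Uz.
have shift_der0 z : U z -> is_derive z (e_ r) f (pd r f z).
  by move=> Uz; apply: DeriveDef; [exact: smooth_derivable Uz|exact: partialE].
have inU0 (a : R) : `|a| <= `|h| -> U (a *: e_ r + y).
  by move=> ah; have := inU a 0 ah h0; rewrite scale0r add0r.
have [c ch E1] := @mean_value_line R _ (fun z => f (h *: e_ s + z) - f z) y (e_ r) h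
  (fun t th => @ex_derive _ _ _ _ _ _ _ (is_deriveB (shift_der _ _ (inU _ _ th (lexx _)))
       (shift_der0 _ (inU0 _ th)))).
have [c' ch' E2] := @mean_value_line R _ (pd r f) (c *: e_ r + y) (e_ s) h
  (fun t th => smooth_derivable (smooth_pd r sf) (inU _ _ ch th)).
exists c, c'; split => //; rewrite E1; congr (_ * _).
rewrite -partialE -E2; apply: (@derive_val _ _ _ _ _ _ _ (is_deriveB
  (shift_der _ _ (inU _ _ ch (lexx _))) (shift_der0 _ (inU0 _ ch)))).
Qed.

(** Evaluating one second difference in both orders shows that the two mixed derivatives agree at
    two points arbitrarily close to [y]; continuity concludes. *)
Lemma pd_comm f y r s : smooth U f -> U y ->
  pd r (pd s f) y = pd s (pd r f) y.
Proof.
move=> sf Uy; apply/eqP; rewrite -subr_eq0 -normr_eq0 eq_le normr_ge0 andbT.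
apply/ler_addgt0Pr => e e0; rewrite add0r.
have e20 : 0 < e / 2 by rewrite divr_gt0.
have [d d0 dU] : exists2 d : R, 0 < d & ball y d `<=` U.
  have /nbhs_ballP[d /= d0 dU] : nbhs y U by apply: open_nbhs_nbhs; split.
  by exists d.
have near_pd a b : exists2 t : R, 0 < t & forall z, ball y t z ->
    `|pd a (pd b f) y - pd a (pd b f) z| <= e / 2.
  have /cvgrPdist_le /(_ _ e20) := smooth_continuous
    (smooth_pd a (smooth_pd b sf)) Uy.
  by move=> /nbhs_ballP[t /= t0 H]; exists t.
have [t1 t10 H1] := near_pd r s; have [t2 t20 H2] := near_pd s r.
pose m := Order.min d (Order.min t1 t2).
have m0 : 0 < m by rewrite !lt_min d0 t10.
(* The intermediate points are at distance at most 2h from [y], so 2h < m keeps them in all the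
   balls at once. *)
pose h := m / 3.
have h0 : 0 < h by rewrite divr_gt0.
have hm : `|h| + `|h| < m by rewrite ger0_norm ?ltW // /h; lra.
have hd : `|h| + `|h| < d.
  by apply: lt_le_trans hm _; rewrite ge_min lexx.
have [c [c' [ch ch' E1]]] := second_difference r s sf dU hd.
have [b [b' [bh bh' E2]]] := second_difference s r sf dU hd.
have inball (x x' : R) i j : `|x| <= `|h| -> `|x'| <= `|h| ->
    ball y m (x' *: e_ j + (x *: e_ i + y)).
  by move=> xh xh'; apply/ball_two_coords/(le_lt_trans _ hm)/lerD.
have mt1 z : ball y m z -> ball y t1 z.
  by apply: le_ball; rewrite !ge_min lexx orbT.
have mt2 z : ball y m z -> ball y t2 z.
  by apply: le_ball; rewrite !ge_min lexx !orbT.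
have EE : pd s (pd r f) (c' *: e_ s + (c *: e_ r + y)) =
          pd r (pd s f) (b' *: e_ r + (b *: e_ s + y)).
  have hn0 : h != 0 by rewrite gt_eqF.
  apply: (mulfI hn0); apply: (mulfI hn0); rewrite -E1 -E2.
  have -> : h *: e_ r + (h *: e_ s + y) = h *: e_ s + (h *: e_ r + y).
    exact: addrCA.
  set A := f (h *: e_ s + (h *: e_ r + y)); set B := f _; set C := f _.
  by move: A B C (f y) => ? ? ? ?; ring.
have B1 := H2 _ (mt2 _ (inball c c' r s ch ch')).
have B2 := H1 _ (mt1 _ (inball b b' s r bh bh')).
rewrite [e]splitr; apply: le_trans (lerD B2 B1).
by rewrite EE [X in _ <= _ + X]distrC ler_distD.
Qed.

End OpenSet.

Lemma ball_line (p q z : 'rV[R]_n) (r t : R) : ball p r q -> ball p r z ->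
  0 <= t <= 1 -> ball p r (t *: (z - q) + q).
Proof.
rewrite -ball_normE /= => hq hz /andP[t0 t1].
rewrite (_ : p - _ = (1 - t) *: (p - q) + t *: (p - z)); last first.
  apply/rowP => i; rewrite !mxE; ring.
apply: le_lt_trans (ler_normD _ _) _; rewrite !normrZ (ger0_norm t0) ger0_norm ?subr_ge0 //.
have [->|tn0] := eqVneq t 0; first by rewrite subr0 mul1r mul0r addr0.
have : t * `|p - z| < t * r by rewrite ltr_pM2l // lt_def tn0.
have : (1 - t) * `|p - q| <= (1 - t) * r by rewrite ler_wpM2l ?subr_ge0 // ltW.
by lra.
Qed.

Lemma mean_value_ball f (p q z : 'rV[R]_n) (r : R) :
    smooth (ball p r) f -> ball p r q -> ball p r z ->
  exists2 c, ball p r c & f z - f q = \sum_k (z - q) 0 k * pd k f c.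
Proof.
move=> sf pq pz.
have H (t : R) : 0 <= t <= 1 -> is_derive t 1 (fun s : R => f (s *: (z - q) + q))
    ('D_(z - q) f (t *: (z - q) + q)).
  move=> t01; apply/is_derive_line/diff_derivable.
  by apply: (smooth_differentiable _ sf); [exact: ball_open|exact: ball_line].
have [|t|t|t] := @MVT_segment R (fun s : R => f (s *: (z - q) + q))
    (fun s => 'D_(z - q) f (s *: (z - q) + q)) 0 1.
- exact: ler01.
- by rewrite in_itv /= => /andP[t0 t1]; apply: H; rewrite !ltW.
- apply: derivable_within_continuous => s; rewrite in_itv /= => s01.
  by have [] := H s s01.
rewrite in_itv /= scale1r scale0r add0r subrK subr0 mulr1 => t01 ->.
exists (t *: (z - q) + q); first exact: ball_line.
by apply: derive_pd sf _; [exact: ball_open|exact: ball_line].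
Qed.

End Smooth.

Section Chain.
Context {R : realType} {m n : nat}.
Implicit Types (g : 'rV[R]_n -> R) (F : 'rV[R]_m -> 'rV[R]_n).

Lemma row_differentiable (W : set 'rV[R]_m) F y : open W -> W y ->
  (forall i, smooth W (fun z => F z 0 i)) -> differentiable F y.
Proof.
move=> oW Wy sF.
have -> : F = fun z => \sum_i F z 0 i *: delta_mx 0 i.
  by apply/funext => z; rewrite -row_sum_delta.
have -> : (fun z => \sum_i F z 0 i *: (delta_mx 0 i : 'rV[R]_n)) =
    \sum_i (fun z => F z 0 i *: (delta_mx 0 i : 'rV[R]_n)).
  by apply/funext => z; rewrite fct_sumE.
apply: differentiable_sum => i; apply: differentiableZl.
exact: smooth_differentiable (sF i) Wy.
Qed.

Lemma pd_comp (U : set 'rV[R]_n) (W : set 'rV[R]_m) g F y k :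
    open U -> open W -> W y -> U (F y) ->
    (forall i, smooth W (fun z => F z 0 i)) -> smooth U g ->
  pd k (g \o F) y = \sum_i pd i g (F y) * pd k (fun z => F z 0 i) y.
Proof.
move=> oU oW Wy Uy sF sg.
have dF := row_differentiable oW Wy sF.
have dg : differentiable g (F y) by exact: smooth_differentiable sg Uy.
rewrite -partialE deriveE; last exact: differentiable_comp.
rewrite diff_comp //= -!deriveE // (derive_pd oU) //.
apply: eq_bigr => i _; rewrite mulrC derive_mx; last exact: diff_derivable.
by rewrite mxE partialE.
Qed.

(** The induction on the order runs over all [g] simultaneously, since the chain rule produces
    [pd i g \o F]. *)
Lemma smooth_comp (U : set 'rV[R]_n) (W : set 'rV[R]_m) g F :
    open U -> open W -> (forall y, W y -> U (F y)) ->
    (forall i, smooth W (fun z => F z 0 i)) -> smooth U g ->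
  smooth W (g \o F).
Proof.
move=> oU oW WU sF sg; apply/smoothP => N; elim: N g sg => [|N IH] g sg.
  move=> y Wy; apply: differentiable_continuous; apply: differentiable_comp.
    exact: row_differentiable oW Wy sF.
  exact: smooth_differentiable sg (WU _ Wy).
have D y : W y -> differentiable (g \o F) y.
  move=> Wy; apply: differentiable_comp.
    exact: row_differentiable oW Wy sF.
  exact: smooth_differentiable sg (WU _ Wy).
split; first by move=> y Wy; exact: differentiable_continuous (D y Wy).
move=> k; split; first by move=> y Wy; exact: diff_derivable (D y Wy).
rewrite pdE; apply: (@ck_eq _ _ _ _ (fun y => \sum_i (pd i g \o F) y * pd k (fun z => F z 0 i) y)) => //.
  by move=> y Wy; rewrite (pd_comp _ oU oW) //; exact: WU.
have S (I : Type) (r : seq I) (G : I -> 'rV[R]_m -> R) : (forall i, ck N W (G i)) ->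
    ck N W (fun y => \sum_(i <- r) G i y).
  move=> H; elim: r => [|i r IHr].
    rewrite (_ : (fun y => _) = fun=> 0); first exact: ck_cst.
    by apply/funext => y; rewrite big_nil.
  rewrite (_ : (fun y => _) = fun y => G i y + \sum_(i <- r) G i y).
    exact: ckD.
  by apply/funext => y; rewrite big_cons.
apply: S => i; apply: ckM => //; first exact/IH/smooth_pd.
by apply: (proj1 (smoothP _ _)); exact: smooth_pd.
Qed.

End Chain.

(** * Homogeneous differential inequalities and unique continuation *)

Section Gronwall.
Context {R : realType} {n : nat} {J : finType}.
Implicit Types (p q y z : 'rV[R]_n) (Q : J -> 'rV[R]_n -> R).

Definition sumnorm Q y : R := \sum_j `|Q j y|.

Lemma sumnorm_ge0 Q y : 0 <= sumnorm Q y.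
Proof. exact: sumr_ge0. Qed.

(** Along the segment from [q] to [z] the sum of squares phi satisfies phi' <= K phi, so phi
    exp(-Kt) does not increase from its initial value 0. Squares replace absolute values because phi
    must be differentiable. *)
Lemma gronwall_ball p (r C : R) Q : 0 <= C ->
    (forall j, smooth (ball p r) (Q j)) ->
    (forall y, ball p r y -> forall k j, `|pd k (Q j) y| <= C * sumnorm Q y) ->
  forall q z, ball p r q -> ball p r z -> (forall j, Q j q = 0) ->
  forall j, Q j z = 0.
Proof.
move=> C0 sQ HQ q z pq pz Qq0.
pose v := z - q; pose gam (t : R) := t *: v + q.
have gamB t : 0 <= t <= 1 -> ball p r (gam t) by move=> ?; apply: ball_line.
pose phi t := \sum_j (Q j (gam t)) ^+ 2.
pose dphi t := \sum_j (2 * Q j (gam t) * 'D_v (Q j) (gam t)).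
have dphiP (t : R) : 0 <= t <= 1 -> is_derive t 1 phi (dphi t).
  move=> t01; rewrite /phi (_ : (fun t => _) = \sum_j (fun t => Q j (gam t) ^+ 2)); last first.
    by apply/funext => s; rewrite fct_sumE.
  have DQ j : is_derive t 1 (fun t => Q j (gam t) ^+ 2) (2 * Q j (gam t) * 'D_v (Q j) (gam t)).
    have D : is_derive t 1 (fun t => Q j (gam t)) ('D_v (Q j) (gam t)).
      apply/is_derive_line/diff_derivable/(smooth_differentiable _ (sQ j)).
        exact: ball_open.
      exact: gamB.
    exact: (is_deriveX 2 D).
  rewrite /dphi; elim: (index_enum J) => [|j s IH].
    by rewrite !big_nil; exact: is_derive_cst.
  by rewrite !big_cons; exact: is_deriveD.
(* The factor 2 comes from differentiating squares, n |v| C from bounding a derivative along [v] by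
   n partial derivatives, and #|J| from the Cauchy-Schwarz bound of the squared [sumnorm] by phi. *)
pose K : R := 2 * #|J|%:R * (n%:R * `|v| * C).
have K0 : 0 <= K by rewrite /K !mulr_ge0.
have phi0 t : 0 <= phi t by apply: sumr_ge0 => j _; exact: sqr_ge0.
have dphi_le (t : R) : 0 <= t <= 1 -> dphi t <= K * phi t.
  move=> t01; have Bt := gamB t t01; set y := gam t in Bt *.
  have DQ j : `|'D_v (Q j) y| <= n%:R * `|v| * C * sumnorm Q y.
    rewrite (derive_pd (@ball_open _ _ _ _) _ (sQ j)) //.
    apply: le_trans (ler_norm_sum _ _ _) _.
    have H (k : 'I_n) : `|v 0 k * pd k (Q j) y| <= `|v| * (C * sumnorm Q y).
      by rewrite normrM ler_pM // ?coord_le_norm // HQ.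
    apply: le_trans (ler_sum _ (fun k _ => H k)) _.
    by rewrite sumr_const card_ord -[leLHS]mulr_natl !mulrA.
  have S2 : (sumnorm Q y) ^+ 2 <= #|J|%:R * phi t.
    have -> : (sumnorm Q y) ^+ 2 = \sum_i \sum_j `|Q i y| * `|Q j y|.
      by rewrite expr2 /sumnorm big_distrlr.
    have H i j : `|Q i y| * `|Q j y| <= ((Q i y) ^+ 2 + (Q j y) ^+ 2) / 2.
      rewrite -[Q i y ^+ 2]real_normK ?num_real // -[Q j y ^+ 2]real_normK ?num_real //.
      have := sqr_ge0 (`|Q i y| - `|Q j y|).
      by move: (`|Q i y|) (`|Q j y|) => a b; rewrite sqrrB; lra.
    apply: le_trans (ler_sum _ (fun i _ => ler_sum _ (fun j _ => H i j))) _.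
    rewrite (eq_bigr (fun i => (#|J|%:R * Q i y ^+ 2 + phi t) / 2)); last first.
      move=> i _; rewrite -mulr_suml big_split /= sumr_const.
      by rewrite -[_ *+ #|J|]mulr_natl.
    rewrite -mulr_suml big_split /= sumr_const -[_ *+ _]mulr_natl -mulr_sumr.
    by rewrite -/(phi t); lra.
  apply: le_trans (_ : 2 * (sumnorm Q y * (n%:R * `|v| * C * sumnorm Q y)) <= _).
    rewrite /dphi /sumnorm mulr_suml mulr_sumr; apply: ler_sum => j _.
    rewrite -mulrA ler_pM2l //; apply: le_trans (ler_norm _) _.
    by rewrite normrM ler_wpM2l.
  rewrite (_ : 2 * _ = 2 * (n%:R * `|v| * C) * sumnorm Q y ^+ 2); last by ring.
  apply: le_trans (ler_wpM2l _ S2) _; first by rewrite !mulr_ge0.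
  by rewrite /K; lra.
pose psi t := phi t * expR (- (K * t)).
pose dpsi t := (dphi t - K * phi t) * expR (- (K * t)).
have dpsiP (t : R) : 0 <= t <= 1 -> is_derive t 1 psi (dpsi t).
  move=> t01.
  have De : is_derive t 1 (fun s : R => expR (- (K * s))) (- K * expR (- (K * t))).
    have Dl : is_derive t 1 (fun s : R => - (K * s)) (- K).
      have := @is_deriveZ R R R id (- K) t 1 1 (is_derive_id _ _).
      rewrite [_ *: 1]mulr1.
      have -> : (- K) \*: id = (fun s : R => - (K * s)) => //.
      by apply/funext => s; rewrite /= [_ *: _]mulNr.
    have := @is_derive1_comp R expR (fun s => - (K * s)) t _ _ (is_derive_expR _) Dl.
    by rewrite mulrC.
  have H := is_deriveM (dphiP t t01) De.
  have E : phi t *: (- K * expR (- (K * t))) + expR (- (K * t)) *: dphi t = dpsi t.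
    by rewrite /dpsi /GRing.scale /=; ring.
  by rewrite -E; exact: H.
have [|t|t|c] := @MVT_segment R psi dpsi 0 1.
- exact: ler01.
- by rewrite in_itv /= => /andP[t0 t1]; apply: dpsiP; rewrite !ltW.
- apply: derivable_within_continuous => s; rewrite in_itv /= => s01.
  by have [] := dpsiP s s01.
rewrite in_itv /= subr0 mulr1 => c01 E.
have psi0 : psi 0 = 0.
  rewrite /psi /phi big1 ?mul0r // => j _.
  by rewrite /gam scale0r add0r Qq0 expr0n.
have psi1 : psi 1 <= 0.
  move: E; rewrite psi0 subr0 => ->; rewrite /dpsi.
  by rewrite mulr_le0_ge0 ?expR_ge0 // subr_le0 dphi_le.
have phi1 : phi 1 = 0.
  apply/eqP; rewrite eq_le phi0 andbT.
  by move: psi1; rewrite /psi pmulr_lle0 // expR_gt0.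
move=> j; have /psumr_eq0P/(_ j isT)/eqP : \sum_j Q j (gam 1) ^+ 2 = 0 by [].
rewrite sqrf_eq0 /gam scale1r subrK => H; apply/eqP/H.
by move=> i _; exact: sqr_ge0.
Qed.

End Gronwall.

Section Dominated.
Context {R : realType} {n : nat} {J : finType}.
Variables (p : 'rV[R]_n) (Q : J -> 'rV[R]_n -> R).
Implicit Types f g : 'rV[R]_n -> R.

(** A local O(|Q|) near [p]. The class is closed under combinations with coefficients continuous at
    [p], so a differential inequality is proved by exhibiting each derivative as such a
    combination. *)
Definition dominated g : Prop :=
  exists C : R, 0 <= C /\ \forall y \near p, `|g y| <= C * sumnorm Q y.

Lemma dominated_self j : dominated (Q j).
Proof.
exists 1; split => //; apply: (@filterE _ (nbhs p)) => y; rewrite mul1r /sumnorm (bigD1 j) //=.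
by rewrite lerDl sumr_ge0.
Qed.

Lemma dominated0 : dominated (fun=> 0).
Proof. by exists 0; split => //; apply: (@filterE _ (nbhs p)) => y; rewrite normr0 mul0r. Qed.

Lemma dominatedD f g : dominated f -> dominated g -> dominated (fun y => f y + g y).
Proof.
move=> [C [C0 Cf]] [D [D0 Dg]]; exists (C + D); split; first exact: addr_ge0.
near=> y; apply: le_trans (ler_normD _ _) _; rewrite mulrDl lerD //.
  by near: y.
by near: y.
Unshelve. all: by end_near. Qed.

Lemma dominatedM f g : {for p, continuous f} -> dominated g ->
  dominated (fun y => f y * g y).
Proof.
move=> cf [C [C0 Cg]]; exists ((`|f p| + 1) * C).
split; first by rewrite mulr_ge0 // addr_ge0.
have /cvgrPdist_le /(_ 1 ltr01) nf := cf.
near=> y; rewrite normrM -mulrA ler_pM //; last by near: y.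
have : `|f p - f y| <= 1 by near: y.
by have := ler_distD (f p) (f y) 0; rewrite !subr0 [X in X + _]distrC; lra.
Unshelve. all: by end_near. Qed.

Lemma dominatedN g : dominated g -> dominated (fun y => - g y).
Proof.
move=> [C [C0 Cg]]; exists C; split => //.
by apply: filterS Cg => y; rewrite normrN.
Qed.

Lemma dominatedB f g : dominated f -> dominated g -> dominated (fun y => f y - g y).
Proof. by move=> df dg; apply: dominatedD df (dominatedN dg). Qed.

Lemma dominated_sum (I : Type) (r : seq I) (F : I -> 'rV[R]_n -> R) :
  (forall i, dominated (F i)) -> dominated (fun y => \sum_(i <- r) F i y).
Proof.
move=> H; elim: r => [|i r IH].
  rewrite (_ : (fun y => _) = fun=> 0); first exact: dominated0.
  by apply/funext => y; rewrite big_nil.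
rewrite (_ : (fun y => _) = fun y => F i y + \sum_(i <- r) F i y).
  exact: dominatedD (H i) IH.
by apply/funext => y; rewrite big_cons.
Qed.

Lemma dominated_near f g : (\forall y \near p, f y = g y) -> dominated f -> dominated g.
Proof.
move=> fg [C [C0 Cf]]; exists C; split => //.
by apply: filterS2 fg Cf => y ->.
Qed.

(** The radius is fixed before the point [q] where [Q] vanishes is chosen, and [q] need not be the
    centre. The closedness argument for vanishing symmetries depends on this. *)
Lemma gronwall_near (U : set 'rV[R]_n) : open U -> U p ->
    (forall j, smooth U (Q j)) -> (forall k j, dominated (pd k (Q j))) ->
  exists2 r : R, 0 < r & ball p r `<=` U /\ forall q z, ball p r q -> ball p r z ->
    (forall j, Q j q = 0) -> forall j, Q j z = 0.
Proof.
move=> oU Up sQ dQ.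
have [C C0 HC] : exists2 C : R, 0 <= C &
    \forall y \near p, forall kj, `|pd kj.1 (Q kj.2) y| <= C * sumnorm Q y.
  have /choice[c Hc] : forall kj : 'I_n * J, exists C : R, 0 <= C /\
    \forall y \near p, `|pd kj.1 (Q kj.2) y| <= C * sumnorm Q y by move=> kj; exact: dQ.
  (* Finitely many nonnegative constants: their sum bounds each of them. *)
  exists (\sum_kj c kj); first by apply: sumr_ge0 => kj _; have [] := Hc kj.
  apply: (@filter_forall _ _ _ (nbhs p) _) => kj.
  have [c0] := Hc kj; apply: filterS => y /le_trans; apply.
  rewrite ler_wpM2r ?sumnorm_ge0 // (bigD1 kj) //= lerDl.
  by apply: sumr_ge0 => i _; have [] := Hc i.
have : \forall y \near p, U y /\ forall kj, `|pd kj.1 (Q kj.2) y| <= C * sumnorm Q y.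
  by apply: filterI HC; apply: open_nbhs_nbhs.
move=> /nbhs_ballP[r /= r0 rU]; exists r => //.
have rU' : ball p r `<=` U by move=> y /rU[].
split=> //; apply: (gronwall_ball C0).
  by move=> j; exact: smooth_sub (sQ j).
by move=> y /rU[_ H] k j; exact: (H (k, j)).
Qed.

End Dominated.

(** * Linear forms that vanish on the kernel of a matrix of constant rank *)

Section ConstantRank.
Context {R : realType}.

Lemma entry_le_norm m n (A : 'M[R]_(m, n)) i j : `|A i j| <= `|A|.
Proof.
by rewrite {2}/Num.Def.normr /= mx_normrE; apply: (le_bigmax _ _ (i, j)).
Qed.

Lemma norm_le_entry m n (A : 'M[R]_(m, n)) (r : R) : 0 <= r ->
  (forall i j, `|A i j| <= r) -> `|A| <= r.
Proof.
move=> r0 H; rewrite /Num.Def.normr /= mx_normrE; by apply: bigmax_le => // -[i j] _; exact: H.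
Qed.

Lemma norm_mulmx m n k (A : 'M[R]_(m, n)) (B : 'M[R]_(n, k)) :
  `|A *m B| <= n%:R * `|A| * `|B|.
Proof.
apply: norm_le_entry; first by rewrite !mulr_ge0.
move=> i j; rewrite mxE; apply: le_trans (ler_norm_sum _ _ _) _.
have H (l : 'I_n) : `|A i l * B l j| <= `|A| * `|B|.
  by rewrite normrM ler_pM // entry_le_norm.
apply: le_trans (ler_sum _ (fun l _ => H l)) _.
by rewrite sumr_const card_ord -[leLHS]mulr_natl mulrA.
Qed.

(* Since the rank is constant, near p the vectors [v] may be corrected modulo the
   kernel of [S y] into the fixed complement [row space of pid_mx m], on which
   [S y] is uniformly injective. *)
Lemma constant_rank_bound (T : topologicalType) (p : T) n m (S : T -> 'M[R]_n)
    (l : T -> 'rV[R]_n) (P : set T) : nbhs p P ->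
    (forall i j, {for p, continuous (fun y => S y i j)}) ->
    (forall j, {for p, continuous (fun y => l y 0 j)}) ->
    (forall y, P y -> \rank (S y) = m) ->
    (forall y, P y -> forall w : 'rV[R]_n, w *m S y = 0 -> w *m (l y)^T = 0) ->
  exists C : R, 0 <= C /\ \forall y \near p, forall v : 'rV[R]_n,
    `|(v *m (l y)^T) 0 0| <= C * `|v *m S y|.
Proof.
move=> nP cS cl rS kS.
have rSp : \rank (S p) = m by exact: rS (nbhs_singleton nP).
pose L := col_ebase (S p); pose V := row_ebase (S p).
have uL : L \in unitmx by exact: col_ebase_unit.
have uV : V \in unitmx by exact: row_ebase_unit.
(* Bases fixed once for all at [p] turn [S p] into [pid_mx m], so that [S' y] is a small
   perturbation of a projection. *)
pose S' y := invmx L *m S y *m invmx V.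
have SE y : S y = L *m S' y *m V.
  by rewrite /S' !mulmxA mulmxV // mul1mx mulmxKV.
have wS k (w : 'M[R]_(k, n)) y : w *m L *m S' y = w *m S y *m invmx V.
  by rewrite /S' !mulmxA mulmxK.
have S'p : S' p = pid_mx m.
  rewrite /S' -{1}[S p]mulmx_ebase -/L -/V rSp mulmxA mulKmx //.
  by rewrite mulmxK.
(* The factor n is the one of [norm_mulmx]. With 1/2, a vector x fixed by [pid_mx m] moves by at
   most |x|/2, whence |x| <= 2 |x S'(y)|. *)
have nE : \forall y \near p, n%:R * `|S' p - S' y| <= 1 / 2.
  pose k : R := n%:R * (n%:R * (n%:R * `|invmx L|) * `|invmx V|) + 1.
  have k0 : 0 < k by rewrite ltr_wpDl // !mulr_ge0.
  have k20 : 0 < (2 * k)^-1 by rewrite invr_gt0 mulr_gt0.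
  have : \forall y \near p, forall ij, `|S p ij.1 ij.2 - S y ij.1 ij.2| <= (2 * k)^-1.
    apply: (@filter_forall _ _ _ (nbhs p) _) => ij.
    by have /cvgrPdist_le := cS ij.1 ij.2; apply.
  apply: filterS => y H.
  have Hn : `|S p - S y| <= (2 * k)^-1.
    apply: norm_le_entry; first exact: ltW.
    by move=> i j; have := H (i, j); rewrite !mxE.
  have -> : S' p - S' y = invmx L *m (S p - S y) *m invmx V.
    by rewrite mulmxBr mulmxBl.
  apply: le_trans (ler_wpM2l _ (norm_mulmx _ _)) _ => //.
  have := norm_mulmx (invmx L) (S p - S y) => H1.
  apply: (@le_trans _ _ (n%:R * (n%:R * (n%:R * `|invmx L| * `|S p - S y|) * `|invmx V|))).
    by rewrite ler_wpM2l // ler_wpM2r // ler_wpM2l.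
  apply: (@le_trans _ _ (k * `|S p - S y|)).
    have -> : n%:R * (n%:R * (n%:R * `|invmx L| * `|S p - S y|) * `|invmx V|) =
      (n%:R * (n%:R * (n%:R * `|invmx L|) * `|invmx V|)) * `|S p - S y| by ring.
    by rewrite ler_wpM2r // /k lerDl.
  apply: le_trans (ler_wpM2l (ltW k0) Hn) _.
  by rewrite invfM mulrCA divff ?mulr1 ?gt_eqF // div1r.
have nl : \forall y \near p, forall j, `|l y 0 j| <= `|l p| + 1.
  apply: (@filter_forall _ _ _ (nbhs p) _) => j.
  have /cvgrPdist_le /(_ 1 ltr01) := cl j; apply: filterS => y H.
  have := ler_distD (l p 0 j) (l y 0 j) 0; rewrite !subr0 [X in X + _]distrC.
  by have := entry_le_norm (l p) 0 j; lra.
pose C : R := n%:R * (2 * (n%:R * `|invmx V|) * (n%:R * `|invmx L|)) * (`|l p| + 1).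
have C0 : 0 <= C by rewrite /C !mulr_ge0 // addr_ge0.
exists C; split=> //.
near=> y => v.
have Ey : n%:R * `|S' p - S' y| <= 1 / 2 by near: y.
have ly : forall j, `|l y 0 j| <= `|l p| + 1 by near: y.
have Py : P y by near: y.
have est (x : 'rV[R]_n) : x *m pid_mx m = x -> `|x| <= 2 * `|x *m S' y|.
  move=> xm; have -> : x *m S' y = x - x *m (S' p - S' y).
    by rewrite mulmxBr S'p xm opprB addrC subrK.
  have := norm_mulmx x (S' p - S' y).
  have := ler_normD (x - x *m (S' p - S' y)) (x *m (S' p - S' y)).
  rewrite subrK; have := ler_wpM2r (normr_ge0 x) Ey.
  rewrite (mulrAC n%:R); lra.
have mn : (m <= n)%N by rewrite -rSp rank_leq_row.
have rS' : \rank (S' y) = m.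
  by rewrite /S' mxrankMfree ?row_free_unit ?unitmx_inv // eqmxMfull ?row_full_unit
     ?unitmx_inv // rS.
(* The restriction of [S' y] to the fixed complement. It is injective there, so its rank is m, the
   rank of [S' y]; the row spaces coincide and every value of [S' y] is attained on the
   complement. *)
pose M := (pid_mx m : 'M[R]_n) *m S' y.
have rM : \rank M = m.
  apply/eqP; rewrite eqn_leq -{1}rS' mxrankM_maxr /=.
  have /mxrankS : (kermx M <= kermx (pid_mx m : 'M[R]_n))%MS.
    apply/rV_subP => x /sub_kermxP xM; apply/sub_kermxP.
    apply/eqP; rewrite -normr_le0; apply: le_trans (est _ _) _.
      by rewrite -mulmxA pid_mx_id.
    by rewrite -mulmxA xM normr0 mulr0.
  by rewrite !mxrank_ker rank_pid_mx // leq_sub2lE // -{1}rS' mxrankM_maxr || rewrite leq_sub2lE.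
have /submxP[X SX] : (S' y <= M)%MS.
  have := mxrank_leqif_sup (submxMl (pid_mx m : 'M[R]_n) (S' y)).
  by rewrite -/M => -[_ <-]; rewrite rM rS'.
pose x := v *m L; pose x' := x *m X *m (pid_mx m : 'M[R]_n).
have xS : x' *m S' y = x *m S' y by rewrite {2}SX /x' /M !mulmxA.
have x'm : x' *m pid_mx m = x' by rewrite /x' -mulmxA pid_mx_id.
(* The correction has the same image under [S y] as [v], so the difference lies in the kernel, where
   the form [l y] vanishes. *)
have vl : v *m (l y)^T = x' *m invmx L *m (l y)^T.
  apply/eqP; rewrite -subr_eq0 -mulmxBl; apply/eqP/(kS y Py).
  apply: (can_inj (mulmxK (_ : invmx V \in unitmx))); first by rewrite unitmx_inv.
  by rewrite -wS mulmxBl mulmxBl mulmxKV // xS subrr !mul0mx.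
rewrite vl.
have B1 : `|x'| <= 2 * (n%:R * `|v *m S y| * `|invmx V|).
  apply: le_trans (est _ x'm) _; rewrite xS ler_wpM2l //.
  rewrite wS.
  exact: norm_mulmx.
have B2 := norm_mulmx x' (invmx L).
have B3 := norm_mulmx (x' *m invmx L) (l y)^T.
apply: le_trans (entry_le_norm _ _ _) _; apply: le_trans B3 _.
have lyn : `|(l y)^T| <= `|l p| + 1.
  apply: norm_le_entry; first by rewrite addr_ge0.
  by move=> i j; rewrite mxE ord1.
apply: (@le_trans _ _ (n%:R * (n%:R * (2 * (n%:R * `|v *m S y| * `|invmx V|)) * `|invmx L|)
   * (`|l p| + 1))).
  apply: ler_pM => //.
  rewrite ler_wpM2l //; apply: le_trans B2 _.
  by rewrite ler_wpM2r // ler_wpM2l.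
by rewrite /C le_eqVlt; apply/orP; left; apply/eqP; ring.
Unshelve. all: by end_near. Qed.

End ConstantRank.

(** Completeness of row vectors, for the fixed point theorem behind the inverse function theorem. *)
HB.instance Definition _ (R : realType) m n :=
  Uniform_isComplete.Build 'M[R]_(m, n) (@cauchy_cvg _).

(** * Inverse function theorem *)

Section InverseFunction.
Context {R : realType} {n : nat}.
Implicit Types (F G : 'rV[R]_n -> 'rV[R]_n) (U V W : set 'rV[R]_n).

(* Vectors are rows, so this is the transpose of the usual Jacobian matrix:
   [dF(v) = v *m jacobian_mx F y]. *)
Definition jacobian_mx F (y : 'rV[R]_n) : 'M[R]_n :=
  \matrix_(k, i) pd k (fun z => F z 0 i) y.

Definition smooth_map U F := forall i, smooth U (fun z => F z 0 i).

Lemma smooth_map_differentiable U F y : open U -> smooth_map U F -> U y ->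
  differentiable F y /\ forall v, 'd F y v = v *m jacobian_mx F y.
Proof.
move=> oU sF Uy; have dF := row_differentiable oU Uy sF; split => // v.
rewrite -deriveE // derive_mx; last exact: diff_derivable.
apply/rowP => i; rewrite !mxE (derive_pd oU v (sF i) Uy).
by apply: eq_bigr => k _; rewrite mxE.
Qed.

Lemma smooth_map_mulmx U (K : 'M[R]_n) : open U -> smooth_map U (fun z => z *m K).
Proof.
move=> oU i; rewrite (_ : (fun z => _) = fun z : 'rV[R]_n => \sum_j z 0 j * K j i).
  apply: smooth_sum => // j _; apply: smoothM => //.
    exact: smooth_coord.
  exact: smooth_cst.
by apply/funext => z; rewrite mxE.
Qed.

Lemma lipschitz_ball (p : 'rV[R]_n) (r c : R) H : smooth_map (ball p r) H -> 0 <= c ->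
    (forall y, ball p r y -> forall i k, `|pd k (fun z => H z 0 i) y| <= c) ->
  forall y z, ball p r y -> ball p r z -> `|H z - H y| <= n%:R * c * `|z - y|.
Proof.
move=> sH c0 Hc y z py pz; apply: norm_le_coord; first by rewrite !mulr_ge0.
move=> i; rewrite !mxE.
have [x px ->] := mean_value_ball (sH i) py pz.
apply: le_trans (ler_norm_sum _ _ _) _.
have B (k : 'I_n) : `|(z - y) 0 k * pd k (fun z => H z 0 i) x| <= `|z - y| * c.
  by rewrite normrM ler_pM // ?coord_le_norm // Hc.
apply: le_trans (ler_sum _ (fun k _ => B k)) _.
by rewrite sumr_const card_ord -[leLHS]mulr_natl mulrA mulrAC.
Qed.

(** The expansion of [F] at [G z], taken for the increment G(z + h) - G(z), is inverted by the
    Jacobian matrix; the Lipschitz bound turns an error small against this increment into one small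
    against h. *)
Lemma smooth_inverse V W F G (C : R) : open V -> open W -> smooth_map V F ->
    (forall z, W z -> V (G z) /\ F (G z) = z) ->
    (forall z z', W z -> W z' -> `|G z - G z'| <= C * `|z - z'|) ->
    (forall y, V y -> jacobian_mx F y \in unitmx) ->
  smooth_map W G.
Proof.
move=> oV oW sF GW LG uJ.
have dG z : W z -> differentiable G z /\
    forall v, 'd G z v = v *m invmx (jacobian_mx F (G z)).
  move=> Wz; have [VG FG] := GW z Wz.
  set K := invmx (jacobian_mx F (G z)).
  pose KL := mulmxr K : {linear 'rV[R]_n -> 'rV[R]_n}.
  have [dF dFE] := smooth_map_differentiable oV sF VG.
  have cK : continuous KL.
    move=> v; apply: differentiable_continuous.
    exact: (row_differentiable openT I (smooth_map_mulmx K openT)).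
  suff H : G \o shift z = cst (G z) + KL +o_ (0 : 'rV[R]_n) id.
    have E := @diff_unique _ _ _ G KL z cK H.
    split; last by move=> v; rewrite E.
    by apply/diff_locallyP; split; rewrite E.
  apply/eqaddoP => _/posnumP[e].
  pose c : R := n%:R * `|K| * `|C| + 1.
  have c0 : 0 < c by rewrite ltr_wpDl // !mulr_ge0.
  have ec0 : 0 < e%:num / c by rewrite divr_gt0.
  have := diff_locally dF; move/eqaddoP => /(_ _ ec0) /nbhs_ballP[r /= r0 Hr].
  have /nbhs_ballP[s /= s0 sW] : nbhs z W by apply: open_nbhs_nbhs; split.
  have C1 : 0 < `|C| + 1 by rewrite ltr_wpDl.
  apply/nbhs_ballP; exists (Order.min s (r / (`|C| + 1))).
    by rewrite /= lt_min s0 divr_gt0.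
  move=> h; rewrite -ball_normE /= sub0r normrN lt_min => /andP[hs hr].
  have Wh : W (h + z).
    by apply: sW; rewrite -ball_normE /= opprD addrCA subrr addr0 normrN.
  have [VGh FGh] := GW _ Wh.
  pose w := G (h + z) - G z.
  have wC : `|w| <= `|C| * `|h|.
    apply: le_trans (LG _ _ Wh Wz) _; rewrite addrK.
    by rewrite ler_wpM2r // ler_norm.
  have wr : ball 0 r w.
    rewrite -ball_normE /= sub0r normrN; apply: le_lt_trans wC _.
    apply: (@le_lt_trans _ _ ((`|C| + 1) * `|h|)).
      by rewrite ler_wpM2r // lerDl.
    by rewrite mulrC -ltr_pdivlMr.
  have := Hr w wr.
  rewrite [X in `|X|](_ : _ = h - w *m jacobian_mx F (G z)); last first.
    transitivity (F (w + G z) - (F (G z) + 'd F (G z) w)); first by [].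
    by rewrite dFE FG /w subrK FGh opprD addrA addrK.
  move=> B.
  rewrite [X in `|X|](_ : _ = - ((h - w *m jacobian_mx F (G z)) *m K)); last first.
    transitivity (G (h + z) - (G z + h *m K)); first by [].
    by rewrite mulmxBl /K mulmxK ?uJ // opprB opprD addrA.
  rewrite normrN; apply: le_trans (norm_mulmx _ _) _.
  apply: (@le_trans _ _ (n%:R * (e%:num / c * (`|C| * `|h|)) * `|K|)).
    rewrite ler_wpM2r // ler_wpM2l //; apply: le_trans B _.
    by rewrite ler_wpM2l // ltW.
  rewrite (_ : _ * `|K| = e%:num * `|h| * ((n%:R * `|K| * `|C|) / c)); last by ring.
  rewrite -[leRHS]mulr1 ler_wpM2l ?mulr_ge0 //.
  by rewrite ler_pdivrMr // mul1r lerDl.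
(* Stated for all [g], because a partial derivative of g o G is again a smooth function composed
   with [G]: a combination of the derivatives of [g] with coefficients from the inverse Jacobian
   matrix. *)
suff H N g : smooth V g -> ck N W (g \o G).
  move=> i; apply/smoothP => N.
  by have := H N (fun y => y 0 i) (smooth_coord _ _).
elim: N g => [|N IH] g sg.
  move=> z Wz; apply: differentiable_continuous; apply: differentiable_comp.
    exact: (dG z Wz).1.
  exact: smooth_differentiable sg (GW z Wz).1.
have D z : W z -> differentiable (g \o G) z.
  move=> Wz; apply: differentiable_comp; first exact: (dG z Wz).1.
  exact: smooth_differentiable sg (GW z Wz).1.
split; first by move=> z Wz; exact: differentiable_continuous (D z Wz).
move=> k; split; first by move=> z Wz; exact: diff_derivable (D z Wz).
apply: (@ck_eq _ _ _ _ ((fun y => \sum_i invmx (jacobian_mx F y) k i * pd i g y) \o G)) => //.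
  move=> z Wz; have [VG FG] := GW z Wz.
  have dg : differentiable g (G z) by exact: smooth_differentiable sg VG.
  rewrite pdE -partialE deriveE; last exact: D.
  rewrite diff_comp //=; last exact: (dG z Wz).1.
  rewrite (dG z Wz).2 -deriveE // (derive_pd oV _ sg VG).
  apply: eq_bigr => i _; congr (_ * _); rewrite mxE (bigD1 k) //= !mxE !eqxx mul1r.
  by rewrite big1 ?addr0 // => j jk; rewrite mxE (negbTE jk) mul0r.
apply: IH; apply: smooth_sum => // i _; apply: smoothM => //.
  apply: smooth_invmx => // a b.
  rewrite (_ : (fun y => _) = pd a (fun z => F z 0 b)); first exact: smooth_pd.
  by apply/funext => y; rewrite mxE.
exact: smooth_pd.
Qed.

(** Since the Jacobian matrix at [p] is the identity, F - id is a contraction near [p], which gives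
    injectivity, local surjectivity and invertible Jacobians. The normalization holds for the
    coordinates f_l, whose differentials at [p] are the basis covectors. *)
Lemma inverse_function U (p : 'rV[R]_n) F : open U -> U p -> smooth_map U F ->
    jacobian_mx F p = 1%:M ->
  exists V W G, [/\ [/\ open V, V p, V `<=` U & forall y, V y -> jacobian_mx F y \in unitmx],
    open W, smooth_map W G,
    forall y, V y -> W (F y) /\ G (F y) = y &
    forall z, W z -> V (G z) /\ F (G z) = z].
Proof.
move=> oU Up sF Jp.
pose H (y : 'rV[R]_n) := F y - y.
have sH : smooth_map U H.
  move=> i; apply: (smooth_eq (f := fun y => F y 0 i - y 0 i)) => //.
    by move=> y _; rewrite !mxE.
  exact: smoothB (sF i) (smooth_coord _ _).
(* A bound [c] on the entries of the derivative gives the Lipschitz constant n c, which this choice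
   makes at most 1/2. *)
pose c : R := (2 * n.+1%:R)^-1.
have c0 : 0 < c by rewrite invr_gt0 mulr_gt0.
have nc : n%:R * c <= 1 / 2.
  by rewrite /c ler_pdivrMr ?mulr_gt0 // div1r mulKf ?pnatr_eq0 // ler_nat.
have [r r0 [rU Hr]] : exists2 r : R, 0 < r & ball p r `<=` U /\
    forall y, ball p r y -> forall i k, `|pd k (fun z => H z 0 i) y| <= c.
  have : \forall y \near p, U y /\ forall ik, `|pd ik.2 (fun z => H z 0 ik.1) y| <= c.
    apply: filterI; first exact: open_nbhs_nbhs.
    apply: (@filter_forall _ _ _ (nbhs p) _) => -[i k] /=.
    have /cvgrPdist_le /(_ c c0) := smooth_continuous (smooth_pd k (sH i)) Up.
    apply: filterS => y; rewrite (_ : pd k (fun z => H z 0 i) p = 0); last first.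
      rewrite (pd_eq (g := fun y => F y 0 i - y 0 i) k oU Up); last first.
        by move=> z _; rewrite !mxE.
      rewrite (pdB oU k (sF i) (smooth_coord _ _) Up) pd_coord.
      by have /matrixP /(_ k i) := Jp; rewrite !mxE => ->; rewrite eq_sym subrr.
    by rewrite sub0r normrN.
  move=> /nbhs_ballP[r /= r0 rU]; exists r => //; split; first by move=> y /rU[].
  by move=> y /rU[_ /= Hy] i k; exact: (Hy (i, k)).
have sHr : smooth_map (ball p r) H by move=> i; exact: smooth_sub (sH i).
have LH y z : ball p r y -> ball p r z -> `|H z - H y| <= 1 / 2 * `|z - y|.
  move=> py pz; apply: le_trans (lipschitz_ball sHr (ltW c0) Hr py pz) _.
  by rewrite ler_wpM2r.
have FE y : F y = y + H y by rewrite /H addrC subrK.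
have expand y z : ball p r y -> ball p r z -> `|z - y| <= 2 * `|F z - F y|.
  move=> py pz; have := LH _ _ py pz; rewrite !FE.
  have := ler_normD (z + H z - (y + H y)) (- (H z - H y)).
  rewrite normrN (_ : z + H z - (y + H y) - (H z - H y) = z - y); first by lra.
  by apply/rowP => i; rewrite !mxE; ring.
pose r' := r / 2; have r'0 : 0 < r' by rewrite divr_gt0.
have r'r : r' < r by rewrite /r'; lra.
have pp : ball p r p by exact: ballxx.
(* A solution of F y = z is a fixed point of y |-> z - H y. This map sends the closed ball of radius
   r' into the open one: the displacement of [z] costs less than r'/2 and the contraction at most
   r'/2. *)
have surj z : `|z - F p| < r' / 2 -> exists y, `|p - y| < r' /\ F y = z.
  move=> zs.
  pose B := closed_ball_ Num.Def.normr p r'.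
  have Br y : B y -> ball p r y.
    by move=> By; rewrite -ball_normE /=; exact: le_lt_trans By r'r.
  have strict y : B y -> `|p - (z - H y)| < r'.
    move=> By; have py := Br y By.
    have := LH _ _ pp py; have : `|y - p| <= r' by rewrite distrC.
    have := ler_normD (F p - z) (H y - H p).
    rewrite (_ : F p - z + (H y - H p) = p - (z - H y)).
      by move: zs; rewrite distrC; lra.
    by rewrite FE; apply/rowP => i; rewrite !mxE; ring.
  have homo : {homo (fun y => z - H y) : y / B y >-> B y}.
    by move=> y By; exact/ltW/strict.
  have [||| y By yE] := @banach_fixed_point R 'rV[R]_n B (mkfun_fun homo).
  - exists (1 / 2)%:nng; split; first by rewrite /=; lra.
    move=> [y y'] [/= By By']; rewrite /= (_ : _ - _ = H y' - H y).
      by rewrite [in leRHS]distrC; exact: LH (Br _ By) (Br _ By').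
    by rewrite opprB addrC addrA subrK.
  - exact: closed_closed_ball_.
  - by exists p; rewrite /B /closed_ball_ /= subrr normr0 ltW.
  exists y; have yE' : y = z - H y by exact: yE.
  by split; [rewrite yE'; exact: strict|rewrite FE {1}yE' subrK].
pose W := ball (F p) (r' / 2).
have WE z : W z <-> `|z - F p| < r' / 2 by rewrite /W -ball_normE /= distrC.
have /choice[G HG] : forall z, exists y, W z -> `|p - y| < r' /\ F y = z.
  move=> z; have [Wz|nWz] := pselect (W z); last by exists z.
  by have [y Hy] := surj z ((WE z).1 Wz); exists y.
pose V := ball p r' `&` F @^-1` W.
have Vr y : V y -> ball p r y.
  by move=> [] ; rewrite -!ball_normE /= => py _; exact: lt_trans r'r.
have GW z : W z -> V (G z) /\ F (G z) = z.
  move=> Wz; have [py FG] := HG z Wz; split => //; split.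
    by rewrite -ball_normE.
  by rewrite /= FG.
have oV : open V.
  rewrite openE => y [py FWy]; rewrite /interior; apply: filterI.
    by apply: open_nbhs_nbhs; split => //; exact: ball_open.
  have [dF _] := smooth_map_differentiable oU sF (rU y (Vr y (conj py FWy))).
  apply: (differentiable_continuous dF).
  by apply: open_nbhs_nbhs; split => //; exact: ball_open.
(* A vector v killed by the Jacobian of [F] equals -v times the Jacobian of [H], so |v| <= |v|/2. *)
have uJ y : V y -> jacobian_mx F y \in unitmx.
  move=> Vy; have py := Vr y Vy.
  rewrite -row_free_unit -kermx_eq0; apply/eqP/row_matrixP => i.
  rewrite row0; apply/eqP; rewrite -normr_le0.
  set v := row i _; have vJ : v *m jacobian_mx F y = 0.
    by rewrite -row_mul mulmx_ker row0.
  have -> : v = - (v *m jacobian_mx H y).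
    have -> : jacobian_mx H y = jacobian_mx F y - 1%:M.
      apply/matrixP => k j; rewrite !mxE.
      rewrite (pd_eq (g := fun y => F y 0 j - y 0 j) k oU (rU _ py)); last first.
        by move=> z _; rewrite !mxE.
      by rewrite (pdB oU k (sF j) (smooth_coord _ _) (rU _ py)) pd_coord eq_sym.
    by rewrite mulmxBr vJ mulmx1 sub0r opprK.
  rewrite normrN.
  have jH : `|jacobian_mx H y| <= c.
    by apply: norm_le_entry => [|k j]; [exact: ltW|rewrite mxE; exact: Hr].
  have B1 : `|v *m jacobian_mx H y| <= 1 / 2 * `|v|.
    apply: le_trans (norm_mulmx _ _) _; rewrite mulrAC ler_wpM2r //.
    by apply: le_trans nc; rewrite ler_wpM2l.
  have vE : `|v| = `|v *m jacobian_mx H y|.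
    have -> : jacobian_mx H y = jacobian_mx F y - 1%:M.
      apply/matrixP => k j; rewrite !mxE.
      rewrite (pd_eq (g := fun y => F y 0 j - y 0 j) k oU (rU _ py)); last first.
        by move=> z _; rewrite !mxE.
      by rewrite (pdB oU k (sF j) (smooth_coord _ _) (rU _ py)) pd_coord eq_sym.
    by rewrite mulmxBr vJ mulmx1 sub0r normrN.
  by move: B1; rewrite vE; have := normr_ge0 (v *m jacobian_mx H y); lra.
exists V, W, G; split.
- split => //.
    split; first exact: ballxx.
    by apply: ballxx; rewrite divr_gt0.
  by move=> y /Vr/rU.
- exact: ball_open.
- apply: (@smooth_inverse V W F G 2) => //.
  + exact: ball_open.
  + by move=> i; apply: smooth_sub (sF i) => y /Vr/rU.
  + move=> z z' Wz Wz'; have [VG {2}<-] := GW z Wz; have [VG' {2}<-] := GW z' Wz'.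
    by apply: expand; exact: Vr.
- move=> y Vy; have [_ FWy] := Vy; split=> //.
  have [VG FG] := GW _ FWy.
  apply/eqP; rewrite -subr_eq0 -normr_le0.
  by have := expand _ _ (Vr y Vy) (Vr _ VG); rewrite FG subrr normr0 mulr0.
- exact: GW.
Qed.

End InverseFunction.

(** * Changes of charts *)

Section Charts.
Context {R : realType} {n : nat}.

Lemma overlap_open (T : topologicalType) (c d : chart R n T) : open (overlap c d).
Proof.
rewrite openE => y [cy dy]; rewrite /interior; apply: filterI.
  by apply: open_nbhs_nbhs; split => //; exact: ccod_open.
apply: (cbwd_cont cy); apply: open_nbhs_nbhs; split => //; exact: cdom_open.
Qed.

Context {M : smoothManifold R n}.
Implicit Types (c d : chart R n M).

Lemma transition_smooth c d : atlas c -> atlas d ->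
  smooth_map (overlap c d) (transition c d).
Proof.
by move=> ac ad i; apply/smoothE; have [H _] := atlas_compatible ac ad; exact: H.
Qed.

(** By maximality of the atlas only compatibility has to be checked, and the transition maps of the
    new chart are those of [c] composed with [G] or [F]. *)
Lemma diffeo_chart c (V W : set 'rV[R]_n) (F G : 'rV[R]_n -> 'rV[R]_n) :
    atlas c -> open V -> V `<=` ccod c -> open W ->
    smooth_map V F -> smooth_map W G ->
    (forall y, V y -> W (F y) /\ G (F y) = y) ->
    (forall z, W z -> V (G z) /\ F (G z) = z) ->
  exists c', [/\ atlas c', ccod c' = W,
    (forall x, cdom c' x <-> cdom c x /\ V (cfwd c x)),
    cfwd c' = F \o cfwd c & cbwd c' = cbwd c \o G].
Proof.
move=> ac oV Vc oW sF sG GF FG.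
have o1 : open (cdom c `&` cfwd c @^-1` V).
  rewrite openE => x [cx Vx]; rewrite /interior; apply: filterI.
    by apply: open_nbhs_nbhs; split => //; exact: cdom_open.
  by apply: (cfwd_cont cx); apply: open_nbhs_nbhs.
have cF y : V y -> {for y, continuous F}.
  move=> Vy; apply: differentiable_continuous; exact: row_differentiable oV Vy sF.
have cG y : W y -> {for y, continuous G}.
  move=> Wy; apply: differentiable_continuous; exact: row_differentiable oW Wy sG.
have [d dE] : exists d : chart R n M,
    [/\ cdom d = cdom c `&` cfwd c @^-1` V, ccod d = W, cfwd d = F \o cfwd c &
        cbwd d = cbwd c \o G].
  unshelve eexists (@Chart R n M (cdom c `&` cfwd c @^-1` V) W (F \o cfwd c)
    (cbwd c \o G) o1 oW _ _ _ _ _ _); last by split.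
  - by move=> x [cx Vx]; have [] := GF _ Vx.
  - move=> z Wz; have [VG _] := FG z Wz; split; first exact/cbwd_sub/Vc.
    by rewrite /= cbwdK //; exact: Vc.
  - by move=> x [cx Vx] /=; rewrite (GF _ Vx).2 cfwdK.
  - by move=> z Wz /=; have [VG E] := FG z Wz; rewrite cbwdK ?E //; exact: Vc.
  - by move=> x [cx Vx]; apply: continuous_comp; [exact: cfwd_cont|exact: cF].
  - move=> z Wz; apply: continuous_comp; first exact: cG.
    by apply: cbwd_cont; apply: Vc; have [] := FG z Wz.
case: dE => Ed1 Ed2 Ed3 Ed4; exists d; split => //; last first.
  by move=> x; rewrite Ed1.
apply: atlas_maximal => e ae; split=> i; apply/smoothE.
  apply: (@smooth_eq _ _ _ ((fun y => transition c e y 0 i) \o G)).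
  - exact: overlap_open.
  - by move=> z _; rewrite /tcoord /transition /= Ed4.
  apply: (@smooth_comp _ _ _ (overlap c e)).
  - exact: overlap_open.
  - exact: overlap_open.
  - move=> z []; rewrite Ed2 Ed4 /= => Wz ez; split=> //.
    by apply: Vc; have [] := FG z Wz.
  - move=> j; apply: smooth_sub (sG j) => z []; by rewrite Ed2.
  exact: transition_smooth.
apply: (@smooth_eq _ _ _ ((fun y => F y 0 i) \o transition e c)).
- exact: overlap_open.
- by move=> z _; rewrite /tcoord /transition /= Ed3.
apply: (@smooth_comp _ _ _ V) => //.
- exact: overlap_open.
- by move=> z []; rewrite Ed1 => _ [].
move=> j; apply: smooth_sub (transition_smooth ae ac j) => z [ez].
by rewrite Ed1 => -[cz _]; split.
Qed.

(** The assumed second order equation is the transformation law of the connection in which the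
    pulled back new coefficients have been replaced by alpha (x) dF + dF (x) alpha. Cancelling the
    invertible Jacobian in both lower indices leaves the coefficients;
    [al y *m (invmx (jacobian_mx F y))^T] is alpha in the new coordinates. *)
Lemma projective_connection_transform (Gam : symmetricConnection M) c c'
    (V : set 'rV[R]_n) F (al : 'rV[R]_n -> 'rV[R]_n) y :
    atlas c -> atlas c' -> open V -> V y -> V `<=` overlap c c' ->
    (forall z, V z -> transition c c' z = F z) ->
    smooth_map V F -> jacobian_mx F y \in unitmx ->
    (forall i r s, pd r (pd s (fun z => F z 0 i)) y =
       \sum_k pd k (fun z => F z 0 i) y * Gam c k r s y
       - (al y 0 r * pd s (fun z => F z 0 i) y + al y 0 s * pd r (fun z => F z 0 i) y)) ->
  forall i p q, Gam c' i p q (F y) =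
    (al y *m (invmx (jacobian_mx F y))^T) 0 p * (i == q)%:R +
    (al y *m (invmx (jacobian_mx F y))^T) 0 q * (i == p)%:R.
Proof.
move=> ac ac' oV Vy Vo tF sF uJ HF i p q.
set Jm := jacobian_mx F y; pose X := \matrix_(a, b) Gam c' i a b (F y).
pose a' := al y *m (invmx Jm)^T; pose E : 'rV[R]_n := delta_mx 0 i.
have JE : Jm *m a'^T = (al y)^T.
  by rewrite /a' trmx_mul trmxK mulmxA mulmxV // mul1mx.
suff XE : X = a'^T *m E + E^T *m a'.
  rewrite -/a'; clearbody a'; move/matrixP/(_ p q): XE.
  rewrite !mxE !big_ord1 !mxE !eqxx /= => ->.
  by rewrite addrC [_ * a' 0 q]mulrC ![i == _]eq_sym addrC.
clearbody a'.
have pF k j z : V z -> partial k (tcoord c c' j) z = pd k (fun z => F z 0 j) z.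
  by move=> Vz; rewrite pdE; apply: (pd_eq k oV Vz) => w Vw; rewrite /tcoord tF.
have pF2 r s j : partial r (partial s (tcoord c c' j)) y = pd r (pd s (fun z => F z 0 j)) y.
  by rewrite pdE; apply: (pd_eq r oV Vy) => w Vw; rewrite -(pF s j w Vw) pdE.
(* For a fixed upper index [i] the coefficients form a bilinear form [X] in the lower indices, and
   pulling it back is a congruence by [Jm]. *)
have JXJ : Jm *m X *m Jm^T = Jm *m (a'^T *m E + E^T *m a') *m Jm^T.
  have aJ : a' *m Jm^T = al y by rewrite -[RHS]trmxK -JE trmx_mul trmxK.
  have -> : Jm *m (a'^T *m E + E^T *m a') *m Jm^T =
      (al y)^T *m (E *m Jm^T) + (Jm *m E^T) *m al y.
    by rewrite mulmxDr mulmxDl !mulmxA JE -!mulmxA aJ.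
  apply/matrixP => r s.
  have H := conn_transform Gam ac ac' (Vo y Vy) i r s.
  have E1 : \sum_k jac c c' i k y * Gam c k r s y =
      \sum_k pd k (fun z => F z 0 i) y * Gam c k r s y.
    by apply: eq_bigr => k _; rewrite /jac pF.
  rewrite pF2 HF E1 tF // in H.
  have {E1}H : \sum_k \sum_l Gam c' i k l (F y) * Jm r k * Jm s l =
     al y 0 r * Jm s i + al y 0 s * Jm r i.
    rewrite !mxE; apply: (addrI (\sum_k pd k (fun z => F z 0 i) y * Gam c k r s y
       - (al y 0 r * pd s (fun z => F z 0 i) y
          + al y 0 s * pd r (fun z => F z 0 i) y))).
    rewrite subrK -[RHS]H; congr (_ + _).
    by apply: eq_bigr => k _; apply: eq_bigr => l _; rewrite /jac !pF // !mxE.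
  have -> : (Jm *m X *m Jm^T) r s = al y 0 r * Jm s i + al y 0 s * Jm r i.
    rewrite -H exchange_big mxE; apply: eq_bigr => l _; rewrite mxE mulr_suml.
    rewrite mxE; apply: eq_bigr => k _.
    by rewrite [X k l]mxE [Jm r k * _]mulrC; congr (_ * _); rewrite mxE.
  rewrite [RHS]mxE [X in _ = X + _]mxE [X in _ = _ + X]mxE !big_ord1 [(al y)^T r 0]mxE.
  have -> : (E *m Jm^T) 0 s = Jm s i by rewrite -rowE !mxE.
  have -> : (Jm *m E^T) r 0 = Jm r i by rewrite trmx_delta -colE mxE.
  by rewrite [_ * al y 0 s]mulrC.
have uJT : Jm^T \in unitmx by rewrite unitmx_tr.
by apply: (can_inj (mulKmx uJ)); apply: (can_inj (mulmxK uJT)).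
Qed.

End Charts.

(** * Affine fields and curvature *)

Section MatrixDerivative.
Context {R : realType} {n : nat}.
Variable U : set 'rV[R]_n.
Hypothesis oU : open U.
Implicit Types (y : 'rV[R]_n).

Definition mpd a b (k : 'I_n) (F : 'rV[R]_n -> 'M[R]_(a, b)) y : 'M[R]_(a, b) :=
  \matrix_(i, j) pd k (fun z => F z i j) y.

Definition msmooth a b (F : 'rV[R]_n -> 'M[R]_(a, b)) :=
  forall i j, smooth U (fun z => F z i j).

Lemma msmooth_pd a b k (F : 'rV[R]_n -> 'M[R]_(a, b)) : msmooth F -> msmooth (mpd k F).
Proof.
move=> sF i j; rewrite (_ : (fun z => _) = pd k (fun z => F z i j)).
  exact: smooth_pd.
by apply/funext => z; rewrite mxE.
Qed.

Lemma msmoothD a b (F G : 'rV[R]_n -> 'M[R]_(a, b)) : msmooth F -> msmooth G ->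
  msmooth (fun y => F y + G y).
Proof.
move=> sF sG i j; rewrite (_ : (fun z => _) = fun z => F z i j + G z i j).
  exact: smoothD.
by apply/funext => z; rewrite mxE.
Qed.

Lemma msmoothN a b (F : 'rV[R]_n -> 'M[R]_(a, b)) : msmooth F ->
  msmooth (fun y => - F y).
Proof.
move=> sF i j; rewrite (_ : (fun z => _) = fun z => - F z i j).
  exact: smoothN.
by apply/funext => z; rewrite mxE.
Qed.

Lemma msmoothB a b (F G : 'rV[R]_n -> 'M[R]_(a, b)) : msmooth F -> msmooth G ->
  msmooth (fun y => F y - G y).
Proof. by move=> sF sG; exact: msmoothD sF (msmoothN sG). Qed.

Lemma msmoothM a b c (F : 'rV[R]_n -> 'M[R]_(a, b)) (G : 'rV[R]_n -> 'M[R]_(b, c)) :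
  msmooth F -> msmooth G -> msmooth (fun y => F y *m G y).
Proof.
move=> sF sG i j; rewrite (_ : (fun z => _) = fun z => \sum_k F z i k * G z k j).
  by apply: smooth_sum => // k _; apply: (smoothM oU).
by apply/funext => z; rewrite mxE.
Qed.

Lemma msmoothZ a b (f : 'rV[R]_n -> R) (G : 'rV[R]_n -> 'M[R]_(a, b)) :
  smooth U f -> msmooth G -> msmooth (fun y => f y *: G y).
Proof.
move=> sf sG i j; rewrite (_ : (fun z => _) = fun z => f z * G z i j).
  exact: (smoothM oU).
by apply/funext => z; rewrite mxE.
Qed.

Lemma msmooth_sum a b (I : Type) (r : seq I) (F : I -> 'rV[R]_n -> 'M[R]_(a, b)) :
  (forall i, msmooth (F i)) -> msmooth (fun y => \sum_(i <- r) F i y).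
Proof.
move=> sF i j; rewrite (_ : (fun z => _) = fun z => \sum_(k <- r) F k z i j).
  by apply: smooth_sum => // k _; exact: sF.
by apply/funext => z; rewrite summxE.
Qed.

Lemma msmooth_tr a b (F : 'rV[R]_n -> 'M[R]_(a, b)) : msmooth F ->
  msmooth (fun y => (F y)^T).
Proof.
move=> sF i j; rewrite (_ : (fun z => _) = fun z => F z j i) //.
by apply/funext => z; rewrite mxE.
Qed.

Lemma mpdD a b k (F G : 'rV[R]_n -> 'M[R]_(a, b)) y : msmooth F -> msmooth G -> U y ->
  mpd k (fun z => F z + G z) y = mpd k F y + mpd k G y.
Proof.
move=> sF sG Uy; apply/matrixP => i j; rewrite !mxE -(pdD k (sF i j) (sG i j) Uy).
by congr (pd k _ y); apply/funext => z; rewrite mxE.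
Qed.

Lemma mpdN a b k (F : 'rV[R]_n -> 'M[R]_(a, b)) y : msmooth F -> U y ->
  mpd k (fun z => - F z) y = - mpd k F y.
Proof.
move=> sF Uy; apply/matrixP => i j; rewrite !mxE -(pdN k (sF i j) Uy).
by congr (pd k _ y); apply/funext => z; rewrite mxE.
Qed.

Lemma mpdB a b k (F G : 'rV[R]_n -> 'M[R]_(a, b)) y : msmooth F -> msmooth G -> U y ->
  mpd k (fun z => F z - G z) y = mpd k F y - mpd k G y.
Proof. by move=> sF sG Uy; rewrite mpdD ?mpdN //; exact: msmoothN. Qed.

Lemma mpdM a b c k (F : 'rV[R]_n -> 'M[R]_(a, b)) (G : 'rV[R]_n -> 'M[R]_(b, c)) y :
  msmooth F -> msmooth G -> U y ->
  mpd k (fun z => F z *m G z) y = F y *m mpd k G y + mpd k F y *m G y.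
Proof.
move=> sF sG Uy; apply/matrixP => i j; rewrite !mxE -big_split.
rewrite (_ : (fun z => _) = fun z => \sum_l F z i l * G z l j); last first.
  by apply/funext => z; rewrite mxE.
rewrite (pd_sum oU) //; last by move=> l; apply: (smoothM oU).
apply: eq_bigr => l _; rewrite (pdM k (sF i l) (sG l j) Uy).
by rewrite !mxE.
Qed.

Lemma mpdZ a b k (f : 'rV[R]_n -> R) (G : 'rV[R]_n -> 'M[R]_(a, b)) y :
  smooth U f -> msmooth G -> U y ->
  mpd k (fun z => f z *: G z) y = pd k f y *: G y + f y *: mpd k G y.
Proof.
move=> sf sG Uy; apply/matrixP => i j; rewrite !mxE addrC.
rewrite -(pdM k sf (sG i j) Uy).
by congr (pd k _ y); apply/funext => z; rewrite mxE.
Qed.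

Lemma mpd_sum a b (I : Type) (r : seq I) k (F : I -> 'rV[R]_n -> 'M[R]_(a, b)) y :
  (forall i, msmooth (F i)) -> U y ->
  mpd k (fun z => \sum_(i <- r) F i z) y = \sum_(i <- r) mpd k (F i) y.
Proof.
move=> sF Uy; apply/matrixP => i j; rewrite !mxE summxE.
rewrite (_ : (fun z => _) = fun z => \sum_(l <- r) F l z i j); last first.
  by apply/funext => z; rewrite summxE.
rewrite (pd_sum oU) //; last by move=> l; exact: sF.
by apply: eq_bigr => l _; rewrite mxE.
Qed.

Lemma mpd_tr a b k (F : 'rV[R]_n -> 'M[R]_(a, b)) y :
  mpd k (fun z => (F z)^T) y = (mpd k F y)^T.
Proof.
apply/matrixP => i j; rewrite !mxE; congr (pd k _ y).
by apply/funext => z; rewrite mxE.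
Qed.

Lemma mpd_comm a b k l (F : 'rV[R]_n -> 'M[R]_(a, b)) y : msmooth F -> U y ->
  mpd k (mpd l F) y = mpd l (mpd k F) y.
Proof.
move=> sF Uy; apply/matrixP => i j; rewrite !mxE.
rewrite (_ : (fun z => _) = pd l (fun z => F z i j)); last first.
  by apply/funext => z; rewrite mxE.
rewrite (_ : (fun z => mpd k F z i j) = pd k (fun z => F z i j)); last first.
  by apply/funext => z; rewrite mxE.
exact: pd_comm (sF i j) Uy.
Qed.

Lemma mpd_eq a b k (F G : 'rV[R]_n -> 'M[R]_(a, b)) y : U y ->
  (forall z, U z -> F z = G z) -> mpd k F y = mpd k G y.
Proof.
move=> Uy FG; apply/matrixP => i j; rewrite !mxE.
by apply: (pd_eq k oU Uy) => z Uz; rewrite FG.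
Qed.

Lemma mpd_cst a b k (A : 'M[R]_(a, b)) y : mpd k (fun=> A) y = 0.
Proof. by apply/matrixP => i j; rewrite !mxE pd_cst. Qed.

End MatrixDerivative.

Section Affine.
Context {R : realType} {n : nat}.
Variable U : set 'rV[R]_n.
Hypothesis oU : open U.
Variable Gam : 'I_n -> 'I_n -> 'I_n -> 'rV[R]_n -> R.
Hypothesis sGam : forall i r s, smooth U (Gam i r s).
Implicit Types (y : 'rV[R]_n) (eta : 'rV[R]_n -> 'rV[R]_n).

Definition chris (r : 'I_n) y : 'M[R]_n := \matrix_(i, s) Gam i r s y.

(* [crv t r y i s] is [R^i_str]. *)
Definition crv (t r : 'I_n) y : 'M[R]_n :=
  mpd t (chris r) y - mpd r (chris t) y + (chris t y *m chris r y - chris r y *m chris t y).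

Definition ric y : 'M[R]_n := \matrix_(i, j) \sum_k crv k j y k i.

(** The transpose of the convention of [jacobian_mx]: rows carry the upper index, as in [chris], so
    that both multiply as endomorphisms of columns. *)
Definition Dmx eta y : 'M[R]_n := \matrix_(i, s) pd s (fun z => eta z 0 i) y.

(** The second determining equation solved for the second derivatives: the 1-jet of the field then
    obeys a closed linear first order system. *)
Definition affine_field eta : Prop := smooth_map U eta /\
  forall y, U y -> forall r, mpd r (Dmx eta) y =
    Dmx eta y *m chris r y - chris r y *m Dmx eta y
    - \sum_k eta y 0 k *: mpd k (chris r) y - \sum_k Dmx eta y k r *: chris k y.

Lemma msmooth_chris r : msmooth U (chris r).
Proof.
move=> i j; rewrite (_ : (fun z => _) = Gam i r j) //.
by apply/funext => z; rewrite mxE.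
Qed.

Lemma msmooth_crv t r : msmooth U (crv t r).
Proof.
apply: msmoothD => //.
  by apply: msmoothB => //; apply: msmooth_pd; exact: msmooth_chris.
by apply: msmoothB => //; apply: msmoothM => //; exact: msmooth_chris.
Qed.

Lemma msmooth_ric : msmooth U ric.
Proof.
move=> i j; rewrite (_ : (fun z => _) = fun z => \sum_k crv k j z k i).
  by apply: smooth_sum => // k _; exact: msmooth_crv.
by apply/funext => z; rewrite mxE.
Qed.

Lemma msmooth_Dmx eta : smooth_map U eta -> msmooth U (Dmx eta).
Proof.
move=> se i j; rewrite (_ : (fun z => _) = pd j (fun z => eta z 0 i)).
  exact: smooth_pd.
by apply/funext => z; rewrite mxE.
Qed.

Lemma pd_Dmx_sym eta y k r t : smooth_map U eta -> U y ->
  pd t (fun z => Dmx eta z k r) y = pd r (fun z => Dmx eta z k t) y.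
Proof.
move=> se Uy; rewrite (_ : (fun z => _) = pd r (fun z => eta z 0 k)); last first.
  by apply/funext => z; rewrite mxE.
rewrite (_ : (fun z => Dmx eta z k t) = pd t (fun z => eta z 0 k)); last first.
  by apply/funext => z; rewrite mxE.
exact: pd_comm (se k) Uy.
Qed.

Lemma addmxE a b (A B : 'M[R]_(a, b)) i j : (A + B) i j = A i j + B i j.
Proof. by rewrite mxE. Qed.

Lemma oppmxE a b (A : 'M[R]_(a, b)) i j : (- A) i j = - A i j.
Proof. by rewrite mxE. Qed.

(** The noncommutative algebra of [lie_curvature], with [P] the derivative of the field, [Gt] a
    connection matrix, [Dtr] its derivatives, [Xt] and [Yt] the two sums of the affine equation;
    [Ct1] to [Zrt] come from differentiating these sums, and [W] is the contribution of the second
    derivatives of the field, equal on both sides. *)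
Lemma commutator_expansion (P Gt Gr Dtr Drt Xt Xr Yt Yr Ct1 Ct2 Cr1 Cr2 Ztr Zrt W :
    'M[R]_n) :
  (P *m Dtr + (P *m Gt - Gt *m P - Xt - Yt) *m Gr)
    - (Gr *m (P *m Gt - Gt *m P - Xt - Yt) + Dtr *m P) - (Ct1 + Ztr) - (W + Cr1) =
  (P *m Drt + (P *m Gr - Gr *m P - Xr - Yr) *m Gt)
    - (Gt *m (P *m Gr - Gr *m P - Xr - Yr) + Drt *m P) - (Cr2 + Zrt) - (W + Ct2) ->
  P *m (Dtr - Drt + (Gt *m Gr - Gr *m Gt)) - (Dtr - Drt + (Gt *m Gr - Gr *m Gt)) *m P =
  (Ztr - Zrt + (Gt *m Xr + Xt *m Gr - (Gr *m Xt + Xr *m Gt))) +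
  (Ct1 - Ct2 + (Yt *m Gr - Gr *m Yt)) + (Cr1 - Cr2 + (Gt *m Yr - Yr *m Gt)).
Proof.
rewrite !(mulmxDr, mulmxDl, mulmxN, mulNmx) !mulmxA => H.
apply/matrixP => i j; move/matrixP: H => /(_ i j).
rewrite !(addmxE, oppmxE); lra.
Qed.

(** This is L_eta R = 0, the integrability condition obtained by equating the two mixed derivatives
    of [Dmx eta] computed from the affine equation. *)
Lemma lie_curvature eta : affine_field eta -> forall y, U y -> forall t r,
  Dmx eta y *m crv t r y - crv t r y *m Dmx eta y =
  \sum_k eta y 0 k *: mpd k (crv t r) y + \sum_k Dmx eta y k t *: crv k r y
  + \sum_k Dmx eta y k r *: crv t k y.
Proof.
move=> [se aff] y Uy t r.
have sG := msmooth_chris; have sP := msmooth_Dmx se.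
have sPe k r0 : smooth U (fun z => Dmx eta z k r0) by exact: sP.
have D (a b : 'I_n) : mpd a (mpd b (Dmx eta)) y =
  (Dmx eta y *m mpd a (chris b) y + mpd a (Dmx eta) y *m chris b y)
  - (chris b y *m mpd a (Dmx eta) y + mpd a (chris b) y *m Dmx eta y)
  - (\sum_k Dmx eta y k a *: mpd k (chris b) y
     + \sum_k eta y 0 k *: mpd k (mpd a (chris b)) y)
  - (\sum_k pd a (fun z => Dmx eta z k b) y *: chris k y
     + \sum_k Dmx eta y k b *: mpd a (chris k) y).
  rewrite (mpd_eq oU a Uy (fun z Uz => aff z Uz b)).
  have s1 : msmooth U (fun z => Dmx eta z *m chris b z) by exact: msmoothM.
  have s2 : msmooth U (fun z => chris b z *m Dmx eta z) by exact: msmoothM.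
  have s3 k : msmooth U (fun z => eta z 0 k *: mpd k (chris b) z).
    by apply: msmoothZ => //; exact: msmooth_pd.
  have s4 k : msmooth U (fun z => Dmx eta z k b *: chris k z) by exact: msmoothZ.
  have s34 : msmooth U (fun z => \sum_k eta z 0 k *: mpd k (chris b) z).
    exact: msmooth_sum.
  have s44 : msmooth U (fun z => \sum_k Dmx eta z k b *: chris k z).
    exact: msmooth_sum.
  have s12 := msmoothB oU s1 s2; have s123 := msmoothB oU s12 s34.
  rewrite (mpdB oU a s123 s44 Uy) (mpdB oU a s12 s34 Uy) (mpdB oU a s1 s2 Uy).
  rewrite (mpdM oU) // (mpdM oU) // (mpd_sum oU) // (mpd_sum oU) //.
  congr (_ - _ - _ - _).
    rewrite -big_split /=; apply: eq_bigr => k _.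
    rewrite (mpdZ a (se k) (msmooth_pd k (sG b)) Uy).
    rewrite [X in _ + _ *: X](mpd_comm oU) //; congr (_ *: _ + _).
    by rewrite mxE.
  rewrite -big_split /=; apply: eq_bigr => k _.
  exact: mpdZ (sPe k b) (sG k) Uy.
have := mpd_comm oU t r sP Uy; rewrite !D => H.
have Wsym : \sum_k pd r (fun z => Dmx eta z k t) y *: chris k y =
  \sum_k pd t (fun z => Dmx eta z k r) y *: chris k y.
  by apply: eq_bigr => k _; rewrite (pd_Dmx_sym k r t se Uy).
rewrite Wsym !aff // in H.
have := commutator_expansion H; rewrite -/(crv t r y) => ->.
have dcrv k : mpd k (crv t r) y = mpd k (mpd t (chris r)) y - mpd k (mpd r (chris t)) y
   + (chris t y *m mpd k (chris r) y + mpd k (chris t) y *m chris r y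
      - (chris r y *m mpd k (chris t) y + mpd k (chris r) y *m chris t y)).
  have d1 := msmooth_pd t (sG r); have d2 := msmooth_pd r (sG t).
  have m1 := msmoothM oU (sG t) (sG r); have m2 := msmoothM oU (sG r) (sG t).
  rewrite (mpdD k (msmoothB oU d1 d2) (msmoothB oU m1 m2) Uy).
  by rewrite (mpdB oU k d1 d2 Uy) (mpdB oU k m1 m2 Uy) !(mpdM oU).
have mulL (A : 'M[R]_n) (f : 'I_n -> R) (B : 'I_n -> 'M[R]_n) :
    A *m (\sum_k f k *: B k) = \sum_k f k *: (A *m B k).
  by rewrite mulmx_sumr; apply: eq_bigr => k _; rewrite scalemxAr.
have mulR (A : 'M[R]_n) (f : 'I_n -> R) (B : 'I_n -> 'M[R]_n) :
    (\sum_k f k *: B k) *m A = \sum_k f k *: (B k *m A).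
  by rewrite mulmx_suml; apply: eq_bigr => k _; rewrite scalemxAl.
rewrite !mulL !mulR; congr (_ + _ + _).
- rewrite -!big_split -!sumrB -!big_split /=; apply: eq_bigr => k _.
  by rewrite dcrv !(scalerDr, scalerN).
- rewrite -!sumrB -!big_split /=; apply: eq_bigr => k _.
  by rewrite /crv !(scalerDr, scalerN).
- rewrite -!sumrB -!big_split /=; apply: eq_bigr => k _.
  by rewrite /crv !(scalerDr, scalerN).
Qed.

(** A trace of [lie_curvature]: the terms acting on the two contracted indices cancel. *)
Lemma lie_ricci eta : affine_field eta -> forall y, U y ->
  \sum_k eta y 0 k *: mpd k ric y + (Dmx eta y)^T *m ric y + ric y *m Dmx eta y = 0.
Proof.
move=> aff y Uy; apply/matrixP => i j; rewrite [RHS]mxE.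
pose P := Dmx eta y.
have E k := congr1 (fun A : 'M[R]_n => A k i) (lie_curvature aff Uy k j).
have {E} : \sum_k (P *m crv k j y) k i - \sum_k (crv k j y *m P) k i =
  \sum_k \sum_l eta y 0 l * mpd l (crv k j) y k i +
  \sum_k \sum_l P l k * crv l j y k i + \sum_k \sum_l P l j * crv k l y k i.
  rewrite -sumrB -!big_split /=; apply: eq_bigr => k _.
  have := E k; rewrite !(addmxE, oppmxE) => ->; rewrite !summxE.
  by congr (_ + _ + _); apply: eq_bigr => l _; rewrite mxE.
have -> : \sum_k (P *m crv k j y) k i = \sum_k \sum_l P l k * crv l j y k i.
  rewrite exchange_big; apply: eq_bigr => k _; rewrite mxE.
  by apply: eq_bigr.
have -> : \sum_k (crv k j y *m P) k i = \sum_l P l i * ric y l j.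
  rewrite (eq_bigr (fun k => \sum_l crv k j y k l * P l i)); last first.
    by move=> k _; rewrite mxE.
  rewrite exchange_big; apply: eq_bigr => l _.
  by rewrite -mulr_suml mulrC [ric y l j]mxE.
have -> : \sum_k \sum_l P l j * crv k l y k i = \sum_l ric y i l * P l j.
  rewrite exchange_big; apply: eq_bigr => l _.
  by rewrite -mulr_sumr mulrC [ric y i l]mxE.
have -> : \sum_k \sum_l eta y 0 l * mpd l (crv k j) y k i =
    \sum_l eta y 0 l * mpd l ric y i j.
  rewrite exchange_big; apply: eq_bigr => l _; rewrite -mulr_sumr; congr (_ * _).
  rewrite [RHS]mxE (_ : (fun z => _) = fun z => \sum_k crv k j z k i); last first.
    by apply/funext => z; rewrite mxE.
  rewrite (pd_sum oU) //; last by move=> k; exact: msmooth_crv.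
  by apply: eq_bigr => k _; rewrite mxE.
move=> H; rewrite !addmxE summxE [(_ *m ric y) i j]mxE [(ric y *m _) i j]mxE.
have -> : \sum_k (P^T) i k * ric y k j = \sum_l P l i * ric y l j.
  by apply: eq_bigr => l _; rewrite mxE.
have -> : \sum_k (eta y 0 k *: mpd k ric y) i j = \sum_l eta y 0 l * mpd l ric y i j.
  by apply: eq_bigr => l _; rewrite mxE.
by move: H; rewrite -/P; lra.
Qed.

End Affine.

(** * Consequences at a point of the isotropy jets (0, w (x) xi) *)

Section Isotropy.
Context {R : realType} {n : nat}.
Hypothesis hn : (2 <= n)%N.
Implicit Types (w xi : 'rV[R]_n).

Lemma exists_neq (j : 'I_n) : exists i : 'I_n, i != j.
Proof.
have h0 : (0 < n)%N by exact: leq_trans hn.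
have [j0|j0] := eqVneq (j : nat) 0%N.
  by exists (Ordinal hn); rewrite -val_eqE /= j0.
by exists (Ordinal h0); rewrite -val_eqE /= eq_sym.
Qed.

Lemma outer_mxE a b (u : 'cV[R]_a) (v : 'rV[R]_b) i j : (u *m v) i j = u i 0 * v 0 j.
Proof. by rewrite mxE big_ord1. Qed.

(** For xi = e_l the two terms occupy row l and column l; since n >= 2 they can be separated at an
    entry off the diagonal. *)
Lemma rank_one_form_kernel (B : 'M[R]_n) w :
  (forall xi, xi^T *m (w *m B) + (B *m w^T) *m xi = 0) ->
  w *m B = 0 /\ w *m B^T = 0.
Proof.
move=> H.
have H' l i j : (l == i)%:R * (w *m B) 0 j + (w *m B^T) 0 i * (l == j)%:R = 0.
  have -> : w *m B^T = (B *m w^T)^T by rewrite trmx_mul trmxK.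
  have /matrixP /(_ i j) := H (delta_mx 0 l).
  rewrite mxE !outer_mxE [RHS]mxE => <-; move: (w *m B) (B *m w^T) => u v.
  by rewrite !mxE eqxx /= ![_ == l]eq_sym.
split; apply/rowP => j; rewrite [RHS]mxE; have [i ij] := exists_neq j.
  by have := H' i i j; rewrite eqxx (negbTE ij) mul1r mulr0 addr0.
by have := H' i j i; rewrite eqxx (negbTE ij) mul0r mulr1 add0r.
Qed.

(** Reading the identity in a row where [w] has a nonzero entry shows that every basis covector is
    an eigenvector of [A], with one common eigenvalue. *)
Lemma rank_one_commute (A : 'M[R]_n) w : w != 0 ->
  (forall xi, A *m (w^T *m xi) = (w^T *m xi) *m A) -> exists a, A = a%:M.
Proof.
move=> w0 H; have [i wi] : exists i, w 0 i != 0.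
  apply/existsP; apply: contraNT w0 => /existsPn H0.
  by apply/eqP/rowP => i; rewrite mxE; apply/eqP; have := H0 i; rewrite negbK.
exists ((A *m w^T) i 0 / w 0 i); apply/matrixP => l j.
have E : (A *m w^T) i 0 * (j == l)%:R = w 0 i * A l j.
  have /matrixP /(_ i j) := H (delta_mx 0 l).
  rewrite mulmxA outer_mxE [delta_mx _ _ _ _]mxE eqxx /= => ->.
  by rewrite -mulmxA outer_mxE -rowE mxE [row _ _ _ _]mxE.
move: ((A *m w^T) i 0) E => u E; apply: (mulfI wi); rewrite -E mxE [j == l]eq_sym.
by case: (l == j); rewrite /= ?mulr1 ?mulr1n ?mulr0n ?mulr0 // mulrC divfK.
Qed.

Section Pointwise.
Variable U : set 'rV[R]_n.
Hypothesis oU : open U.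
Variable Gam : 'I_n -> 'I_n -> 'I_n -> 'rV[R]_n -> R.
Hypothesis sGam : forall i r s, smooth U (Gam i r s).
Hypothesis symGam : forall y, U y -> forall i r s, Gam i r s y = Gam i s r y.

Lemma crv_skew t r y : crv Gam t r y = - crv Gam r t y.
Proof. by rewrite /crv opprD !opprB. Qed.

Lemma bianchi y (i s r k : 'I_n) : U y ->
  crv Gam s r y i k + crv Gam r k y i s + crv Gam k s y i r = 0.
Proof.
move=> Uy; have E a b : (fun z => chris Gam a z i b) = Gam i a b.
  by apply/funext => z; rewrite mxE.
have pdS a b c : pd a (Gam i b c) y = pd a (Gam i c b) y.
  by apply: (pd_eq a oU Uy) => z Uz; exact: symGam.
have prodS a b c : (chris Gam a y *m chris Gam b y) i c =
    (chris Gam a y *m chris Gam c y) i b.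
  by rewrite !mxE; apply: eq_bigr => q _; rewrite !mxE (symGam Uy q b c).
rewrite /crv !(addmxE, oppmxE) ![mpd _ _ _ _ _]mxE !E.
rewrite (pdS s r k) (pdS r s k) (pdS k r s) (prodS s r k) (prodS r s k) (prodS k r s).
ring.
Qed.

Variables (q : 'rV[R]_n) (w : 'rV[R]_n).
Hypothesis Uq : U q.
Hypothesis iso : forall xi, exists zeta, [/\ affine_field U Gam zeta, zeta q = 0 &
  Dmx zeta q = w^T *m xi].

(** At a zero of the field the equation L Ric = 0 loses its derivative term and becomes algebraic in
    the endomorphism w (x) xi. *)
Lemma ric_kernel : w *m ric Gam q = 0 /\ w *m (ric Gam q)^T = 0.
Proof.
apply: rank_one_form_kernel => xi; have [zeta [aff z0 Dz]] := iso xi.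
have := lie_ricci oU sGam aff Uq; rewrite Dz z0 big1 => [|k _]; last first.
  by rewrite mxE scale0r.
by rewrite add0r trmx_mul trmxK !mulmxA.
Qed.

Section Tensor.
Variable S : 'rV[R]_n -> 'M[R]_n.
Hypothesis sS : msmooth U S.
Hypothesis lieS : forall zeta, affine_field U Gam zeta -> forall y, U y ->
  \sum_k zeta y 0 k *: mpd k S y + (Dmx zeta y)^T *m S y + S y *m Dmx zeta y = 0.

Definition covd (l : 'I_n) y : 'M[R]_n :=
  mpd l S y - (chris Gam l y)^T *m S y - S y *m chris Gam l y.

(** Affine fields preserve the covariant derivative of an invariant tensor; at a zero of the field
    this is an algebraic identity. It is obtained by differentiating L S = 0 and eliminating the
    second derivatives of [zeta] through the affine equation. *)
Lemma lie_covd zeta : affine_field U Gam zeta -> zeta q = 0 -> forall l,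
  \sum_k Dmx zeta q k l *: covd k q + (Dmx zeta q)^T *m covd l q
    + covd l q *m Dmx zeta q = 0.
Proof.
move=> aff z0 l; have [sz affE] := aff.
have sP := msmooth_Dmx sz; have sPT := msmooth_tr sP.
have sG := msmooth_chris sGam.
pose F1 y := \sum_k zeta y 0 k *: mpd k S y.
pose F2 y := (Dmx zeta y)^T *m S y; pose F3 y := S y *m Dmx zeta y.
have s1 : msmooth U F1.
  by apply: msmooth_sum => // k; apply: msmoothZ => //; exact: msmooth_pd.
have s2 : msmooth U F2 by exact: msmoothM.
have s3 : msmooth U F3 by exact: msmoothM.
have : mpd l (fun y => F1 y + F2 y + F3 y) q = 0.
  rewrite (mpd_eq oU l Uq (G := fun=> 0)); first exact: mpd_cst.
  by move=> y Uy; exact: lieS.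
rewrite (mpdD l (msmoothD oU s1 s2) s3 Uq) (mpdD l s1 s2 Uq).
rewrite (mpdM oU l sPT sS Uq) (mpdM oU l sS sP Uq) mpd_tr (affE q Uq l).
have -> : mpd l F1 q = \sum_k Dmx zeta q k l *: mpd k S q.
  rewrite (mpd_sum oU) //; last first.
    by move=> k; apply: msmoothZ => //; exact: msmooth_pd.
  apply: eq_bigr => k _; rewrite (mpdZ l (sz k) (msmooth_pd k sS) Uq) z0.
  by rewrite [(0 : 'rV_n) 0 k]mxE scale0r addr0 [Dmx zeta q k l]mxE.
have L0 : (Dmx zeta q)^T *m S q = - (S q *m Dmx zeta q).
  have := lieS aff Uq; rewrite z0 big1 => [|k _]; last by rewrite mxE scale0r.
  by rewrite add0r => /eqP; rewrite addr_eq0 => /eqP.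
have L1 : (chris Gam l q)^T *m ((Dmx zeta q)^T *m S q) =
  - ((chris Gam l q)^T *m S q *m Dmx zeta q) by rewrite L0 mulmxN mulmxA.
have L2 : (Dmx zeta q)^T *m (S q *m chris Gam l q) = - (S q *m Dmx zeta q *m chris Gam l q).
  by rewrite mulmxA L0 mulNmx.
rewrite z0 [X in _ - X - \sum_k _ *: chris Gam k q](big1 _ _) => [|k _]; last first.
  by rewrite mxE scale0r.
rewrite subr0 => H; rewrite -[RHS]H /covd.
have trZ (a : R) (A : 'M[R]_n) : (a *: A)^T = a *: A^T.
  by apply/matrixP => i j; rewrite !mxE.
have T1 : \sum_k Dmx zeta q k l *: (mpd k S q - (chris Gam k q)^T *m S q
      - S q *m chris Gam k q) = \sum_k Dmx zeta q k l *: mpd k S q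
   - (\sum_k Dmx zeta q k l *: chris Gam k q)^T *m S q
   - S q *m (\sum_k Dmx zeta q k l *: chris Gam k q).
  rewrite raddf_sum /= mulmx_suml mulmx_sumr -!sumrB; apply: eq_bigr => k _.
  by rewrite trZ !scalerBr scalemxAl scalemxAr.
rewrite T1; move: L1 L2; set P := Dmx zeta q; set Ga := chris Gam l q.
set C := \sum_k P k l *: chris Gam k q.
rewrite !linearB /= !trmx_mul.
rewrite !(mulmxDr, mulmxDl, mulmxN, mulNmx) -!mulmxA => L1 L2.
apply/matrixP => i j; move/matrixP/(_ i j): L1; move/matrixP/(_ i j): L2.
rewrite !(addmxE, oppmxE); lra.
Qed.

Hypothesis symS : forall y, U y -> (S y)^T = S y.

(** With the endomorphism w (x) e_t, invariance of the covariant derivative yields the second claim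
    from an index t other than l; taking t = l then leaves the first claim, which says that the jet
    with value [w] and zero covariant derivative is allowed. *)
Lemma covd_kernel : \sum_k w 0 k *: covd k q = 0 /\ forall l, w *m covd l q = 0.
Proof.
have sym l : (covd l q)^T = covd l q.
  rewrite /covd !linearB /= !trmx_mul trmxK symS // -mpd_tr.
  rewrite (mpd_eq oU l Uq (G := S)); last by move=> z Uz; exact: symS.
  by rewrite addrAC.
have H t l : (l == t)%:R *: (\sum_k w 0 k *: covd k q) +
   ((delta_mx 0 t : 'rV[R]_n)^T *m (w *m covd l q) +
    (w *m covd l q)^T *m (delta_mx 0 t : 'rV[R]_n)) = 0.
  have [zeta [aff z0 Dz]] := iso (delta_mx 0 t).
  have E := lie_covd aff z0 l; rewrite Dz trmx_mul trmxK -mulmxA in E.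
  rewrite [(w *m covd l q)^T]trmx_mul sym -[covd l q *m _ *m _]mulmxA addrA.
  rewrite -[RHS]E; congr (_ + _ + _).
  rewrite scaler_sumr; apply: eq_bigr => k _.
  by rewrite scalerA outer_mxE [w^T k 0]mxE [delta_mx _ _ _ _]mxE eqxx /= mulrC.
have b0 l : w *m covd l q = 0.
  have [t tl] := exists_neq l; have := H t l.
  rewrite eq_sym (negbTE tl) scale0r add0r => /matrixP E.
  have E' i j : (t == i)%:R * (w *m covd l q) 0 j + (w *m covd l q) 0 i * (t == j)%:R = 0.
    have := E i j; rewrite mxE [X in X + _]mxE [X in _ + X]mxE !big_ord1 [RHS]mxE.
    by rewrite ![delta_mx _ _ _ _]mxE [_^T i 0]mxE [_^T i 0]mxE ![delta_mx _ _ _ _]mxE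
       eqxx /= ![_ == t]eq_sym.
  apply/rowP => j; rewrite [RHS]mxE; have := E' t j; rewrite eqxx mul1r.
  have [->|tj] := eqVneq t j; last by rewrite mulr0 addr0.
  by rewrite mulr1; lra.
split=> //; have [t _] := exists_neq (Ordinal hn); have := H t t.
by rewrite eqxx scale1r b0 mulmx0 trmx0 mul0mx !addr0.
Qed.

End Tensor.

Variable oth : 'I_n -> 'I_n.
Hypothesis othP : forall r, oth r != r.

(* Up to a linear combination with its transpose, this is the Ricci tensor
   divided by n - 1: the projective Schouten tensor. *)
Definition schouten (r s : 'I_n) (y : 'rV[R]_n) : R :=
  if r == s then crv Gam (oth r) r y (oth r) r
  else (2 * crv Gam s r y s s + crv Gam r s y r r) / 3.

(** Invariance of the curvature under w (x) e_l, read at suitable indices, gives the case r = s at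
    once; for r != s the Bianchi identity adds two linear equations for the two contractions with
    [w]. *)
Lemma crv_kernel r s i :
  \sum_k w 0 k * crv Gam k r q i s = schouten r s q * w 0 i.
Proof.
have H (l t r0 i0 s0 : 'I_n) : w 0 i0 * crv Gam t r0 q l s0 -
    (\sum_k w 0 k * crv Gam t r0 q i0 k) * (l == s0)%:R =
    (l == t)%:R * (\sum_k w 0 k * crv Gam k r0 q i0 s0) +
    (l == r0)%:R * (\sum_k w 0 k * crv Gam t k q i0 s0).
  have [zeta [aff z0 Dz]] := iso (delta_mx 0 l).
  have E := congr1 (fun A : 'M[R]_n => A i0 s0) (lie_curvature oU sGam aff Uq t r0).
  have Z : \sum_k zeta q 0 k *: mpd k (crv Gam t r0) q = 0.
    by rewrite big1 // => k _; rewrite z0 mxE scale0r.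
  rewrite Z add0r Dz !(addmxE, oppmxE) !summxE in E.
  have E1 : (w^T *m (delta_mx 0 l : 'rV[R]_n) *m crv Gam t r0 q) i0 s0 =
      w 0 i0 * crv Gam t r0 q l s0.
    by rewrite -mulmxA outer_mxE -rowE [w^T i0 0]mxE [row _ _ _ _]mxE.
  have E2 : (crv Gam t r0 q *m (w^T *m (delta_mx 0 l : 'rV[R]_n))) i0 s0 =
      (\sum_k w 0 k * crv Gam t r0 q i0 k) * (l == s0)%:R.
    rewrite mulmxA outer_mxE [delta_mx _ _ _ _]mxE eqxx /= eq_sym.
    congr (_ * _); rewrite mxE; apply: eq_bigr => k _.
    by rewrite [w^T k 0]mxE mulrC.
  have E3 (t0 : 'I_n) (B : 'I_n -> 'M[R]_n) : \sum_k ((w^T *m (delta_mx 0 l : 'rV[R]_n)) k t0 *: B k) i0 s0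
     = (l == t0)%:R * \sum_k w 0 k * B k i0 s0.
    rewrite mulr_sumr; apply: eq_bigr => k _; rewrite mxE outer_mxE [w^T k 0]mxE.
    by rewrite [delta_mx _ _ _ _]mxE eqxx /= eq_sym; ring.
  by move: E; rewrite E1 E2 !E3.
(* The Bianchi identity moves [w] from the last slot of the curvature to the first. *)
have B a b : \sum_k w 0 k * crv Gam a b q i k =
    (\sum_k w 0 k * crv Gam k b q i a) - \sum_k w 0 k * crv Gam k a q i b.
  rewrite -sumrB; apply: eq_bigr => k _; rewrite -mulrBr; congr (_ * _).
  have := bianchi i a b k Uq; rewrite (crv_skew b k) oppmxE; lra.
(* With X and Y the contractions for (r, s) and (s, r), these are 2X - Y and 2Y - X; solving for X
   produces the coefficients 2/3 and 1/3 of [schouten]. *)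
have Hneq a b : a != b -> 2 * (\sum_k w 0 k * crv Gam k b q i a)
     - \sum_k w 0 k * crv Gam k a q i b = w 0 i * crv Gam a b q a a.
  move=> ab; have := H a a b i a; rewrite eqxx (negbTE ab) B mulr1 mul1r mul0r addr0.
  by lra.
rewrite /schouten; have [<-|rs] := eqVneq r s.
  have := H (oth r) (oth r) r i r.
  by rewrite eqxx (negbTE (othP r)) mulr0 subr0 mul1r mul0r addr0 => <-; rewrite mulrC.
have sr : s != r by rewrite eq_sym.
have := Hneq _ _ sr; have := Hneq _ _ rs; lra.
Qed.

End Pointwise.
End Isotropy.

(** * A symmetry eta with nabla eta = eta (x) alpha *)

Section ParallelDirection.
Context {R : realType} {n : nat}.

Lemma mul_colE a b (v : 'rV[R]_a) (A : 'M[R]_(a, b)) j :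
  (v *m col j A) 0 0 = (v *m A) 0 j.
Proof. by rewrite !mxE; apply: eq_bigr => k _; rewrite mxE. Qed.

Hypothesis hn : (2 <= n)%N.
Variable U : set 'rV[R]_n.
Hypothesis oU : open U.
Variable Gam : 'I_n -> 'I_n -> 'I_n -> 'rV[R]_n -> R.
Hypothesis sGam : forall i r s, smooth U (Gam i r s).
Hypothesis symGam : forall y, U y -> forall i r s, Gam i r s y = Gam i s r y.
Implicit Types (y : 'rV[R]_n) (eta : 'rV[R]_n -> 'rV[R]_n).

Definition nabla eta y : 'M[R]_n := Dmx eta y + \sum_k eta y 0 k *: chris Gam k y.

Lemma msmooth_nabla eta : smooth_map U eta -> msmooth U (nabla eta).
Proof.
move=> se; apply: msmoothD => //; first exact: msmooth_Dmx.
by apply: msmooth_sum => // k; apply: msmoothZ => //; exact: msmooth_chris.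
Qed.

Lemma chris_sym y i r s : U y -> chris Gam r y i s = chris Gam s y i r.
Proof. by move=> Uy; rewrite !mxE symGam. Qed.

(** The tensorial form of the affine equation, nabla_r nabla eta = - R(eta, e_r), written with
    partial derivatives. *)
Lemma mpd_nabla eta y r : affine_field U Gam eta -> U y ->
  mpd r (nabla eta) y = nabla eta y *m chris Gam r y - chris Gam r y *m nabla eta y
    - \sum_k eta y 0 k *: crv Gam k r y.
Proof.
move=> [se aff] Uy; have sG := msmooth_chris sGam.
have s1 k : msmooth U (fun z => eta z 0 k *: chris Gam k z) by exact: msmoothZ.
rewrite (mpdD r (msmooth_Dmx se) (msmooth_sum oU _ s1) Uy) (mpd_sum oU) // aff //.
have -> : \sum_k mpd r (fun z => eta z 0 k *: chris Gam k z) y =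
    \sum_k (Dmx eta y k r *: chris Gam k y + eta y 0 k *: mpd r (chris Gam k) y).
  apply: eq_bigr => k _; have -> : Dmx eta y k r = pd r (fun z => eta z 0 k) y.
    by rewrite mxE.
  exact: (mpdZ r (se k) (sG k) Uy).
rewrite big_split /= /nabla; set C := \sum_k eta y 0 k *: chris Gam k y.
have -> : \sum_k eta y 0 k *: crv Gam k r y =
   \sum_k eta y 0 k *: mpd k (chris Gam r) y - \sum_k eta y 0 k *: mpd r (chris Gam k) y
   + (C *m chris Gam r y - chris Gam r y *m C).
  rewrite /C mulmx_suml mulmx_sumr -!sumrB -big_split /=; apply: eq_bigr => k _.
  by rewrite /crv !(scalerDr, scalerN) scalemxAl scalemxAr.
rewrite !(mulmxDr, mulmxDl); apply/matrixP => i j; rewrite !(addmxE, oppmxE); lra.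
Qed.

Variables (m : nat) (S : 'rV[R]_n -> 'M[R]_n).
Hypothesis sS : msmooth U S.
Hypothesis symS : forall y, U y -> (S y)^T = S y.
Hypothesis rankS : forall y, U y -> \rank (S y) = m.
Hypothesis lieS : forall zeta, affine_field U Gam zeta -> forall y, U y ->
  \sum_k zeta y 0 k *: mpd k S y + (Dmx zeta y)^T *m S y + S y *m Dmx zeta y = 0.
Hypothesis jets : forall q, U q -> forall (v : 'rV[R]_n) (P : 'M[R]_n),
  \sum_k v 0 k *: mpd k S q + P^T *m S q + S q *m P = 0 ->
  exists zeta, [/\ affine_field U Gam zeta, zeta q = v & Dmx zeta q = P].

Lemma isotropy_jets q w : U q -> w *m S q = 0 -> forall xi : 'rV[R]_n,
  exists zeta, [/\ affine_field U Gam zeta, zeta q = 0 & Dmx zeta q = w^T *m xi].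
Proof.
move=> Uq wS xi; apply: jets => //.
rewrite big1 => [|k _]; last by rewrite mxE scale0r.
have Sw : S q *m w^T = 0 by rewrite -[S q]symS // -trmx_mul wS trmx0.
by rewrite trmx_mul trmxK -mulmxA wS mulmx0 mulmxA Sw mul0mx !addr0.
Qed.

Lemma smooth_mxcont y (F : 'rV[R]_n -> 'M[R]_n) i j : msmooth U F -> U y ->
  {for y, continuous (fun z => F z i j)}.
Proof. by move=> sF Uy; exact: smooth_continuous (sF i j) Uy. Qed.

Lemma kernel_bound p (l : 'rV[R]_n -> 'rV[R]_n) : U p -> smooth_map U l ->
    (forall y, U y -> forall w : 'rV[R]_n, w *m S y = 0 -> w *m (l y)^T = 0) ->
  exists C : R, 0 <= C /\ \forall y \near p, forall v : 'rV[R]_n,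
    `|(v *m (l y)^T) 0 0| <= C * `|v *m S y|.
Proof.
move=> Up sl kl; apply: (@constant_rank_bound _ _ _ n m S l U) => //.
- exact: open_nbhs_nbhs.
- by move=> i j; exact: smooth_mxcont.
- by move=> j; exact: smooth_continuous (sl j) Up.
Qed.

(** The unknowns are eta S and Z = nabla eta - eta (x) alpha, both zero at [p]. Their derivatives
    are combinations of themselves, up to linear forms in eta that vanish on ker S and are therefore
    bounded by |eta S|. *)
Lemma parallel_direction p (w : 'rV[R]_n) : U p -> w != 0 -> w *m S p = 0 ->
  exists eta al i0 (r : R), [/\ 0 < r, ball p r `<=` U,
    affine_field U Gam eta /\ eta p = w,
    smooth_map (ball p r) al /\ al p = 0 &
    forall y, ball p r y -> eta y 0 i0 != 0 /\ nabla eta y = (eta y)^T *m al y].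
Proof.
move=> Up w0 wS.
have /choice[oth othP] : forall r : 'I_n, exists t, t != r by exact: exists_neq.
have [eta [aff etap Dp]] : exists eta, [/\ affine_field U Gam eta, eta p = w &
    Dmx eta p = - \sum_k w 0 k *: chris Gam k p].
  apply: jets => //.
  have [H _] := covd_kernel hn oU sGam Up (isotropy_jets Up wS) sS lieS symS.
  rewrite -[RHS]H linearN /= raddf_sum /= mulNmx mulmxN mulmx_suml mulmx_sumr -!sumrB.
  apply: eq_bigr => k _; rewrite /covd !scalerBr; congr (_ - _ - _).
    by rewrite scalemxAl; congr (_ *m _); apply/matrixP => i j; rewrite !mxE.
  by rewrite scalemxAr.
have [se _] := aff.
have [i0 wi0] : exists i, w 0 i != 0.
  apply/existsP; apply: contraNT w0 => /existsPn H0.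
  by apply/eqP/rowP => i; rewrite mxE; apply/eqP; have := H0 i; rewrite negbK.
have [r1 r10 [r1U r1e]] : exists2 r1 : R, 0 < r1 & ball p r1 `<=` U /\
    forall y, ball p r1 y -> eta y 0 i0 != 0.
  have : \forall y \near p, U y /\ eta y 0 i0 != 0.
    apply: filterI; first exact: open_nbhs_nbhs.
    have /cvgrPdist_lt := smooth_continuous (se i0) Up.
    rewrite etap => /(_ `|w 0 i0|); rewrite normr_gt0 => /(_ wi0).
    apply: filterS => y; apply: contraTneq => ->.
    by rewrite subr0 ltxx.
  by move=> /nbhs_ballP[r1 /= r10 H]; exists r1 => //; split => y /H[].
pose B := ball p r1; have oB : open B by exact: ball_open.
have Bp : B p by exact: ballxx.
have sN : msmooth B (nabla eta).
  by move=> i j; apply: smooth_sub r1U _; exact: msmooth_nabla.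
have seB i : smooth B (fun y => eta y 0 i) by exact: smooth_sub r1U _.
have sVB : smooth B (fun y => (eta y 0 i0)^-1) by exact: smoothV.
(* The only possible choice if the equation is to hold in row [i0]; it makes this row of [Z] vanish
   identically, not just at [p]. *)
pose al y : 'rV[R]_n := \row_s (nabla eta y i0 s / eta y 0 i0).
have sal : smooth_map B al.
  move=> s; apply: (smooth_eq (f := fun y => nabla eta y i0 s / eta y 0 i0)) => //.
    by move=> y _; rewrite [RHS]mxE.
  exact: (smoothM oB (sN i0 s) sVB).
have N0 : nabla eta p = 0.
  by rewrite /nabla Dp etap addNr.
have alp : al p = 0 by apply/rowP => s; rewrite [LHS]mxE N0 !mxE mul0r.
pose Z y : 'M[R]_n := nabla eta y - (eta y)^T *m al y.
have sE : msmooth B (fun y => (eta y)^T).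
  by apply: msmooth_tr => i j; rewrite ord1; exact: seB.
have sA : msmooth B al by move=> i j; rewrite ord1; exact: sal.
have sZ : msmooth B Z by apply: msmoothB => //; exact: msmoothM.
pose Q (a : 'I_n + 'I_n * 'I_n) y := match a with
  | inl j => (eta y *m S y) 0 j | inr (i, s) => Z y i s end.
have sSB : msmooth B S by move=> i j; exact: smooth_sub r1U _.
have sEr : msmooth B eta by move=> i j; rewrite ord1; exact: seB.
have ssig : msmooth B (fun y => eta y *m S y) by exact: msmoothM.
have sQ a : smooth B (Q a).
  by case: a => [j|[i s]] /=; [exact: ssig|exact: sZ].
have cont f : smooth B f -> {for p, continuous f}.
  by move=> sf; exact: smooth_continuous sf Bp.
have dQ a : dominated p Q (Q a) by exact: dominated_self.
have dsig j : dominated p Q (fun y => (eta y *m S y) 0 j) := dQ (inl j).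
have dZ i s : dominated p Q (fun y => Z y i s) := dQ (inr (i, s)).
(* Pointwise identities on ker S(y) become estimates for eta, although eta is not yet known to stay
   in the kernel. *)
have dker (l : 'rV[R]_n -> 'rV[R]_n) : smooth_map U l ->
    (forall y, U y -> forall w : 'rV[R]_n, w *m S y = 0 -> w *m (l y)^T = 0) ->
    dominated p Q (fun y => (eta y *m (l y)^T) 0 0).
  move=> sl kl; have [C [C0 HC]] := kernel_bound Up sl kl.
  exists C; split => //; apply: filterS HC => y /(_ (eta y)) /le_trans; apply.
  rewrite ler_wpM2l //; apply: norm_le_coord; first exact: sumnorm_ge0.
  move=> j; rewrite /sumnorm (bigD1 (inl j)) //= lerDl.
  by apply: sumr_ge0.
have sGB r : msmooth B (chris Gam r).
  by move=> i j; apply: smooth_sub r1U _; exact: msmooth_chris.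
have nearB : \forall y \near p, B y by apply: open_nbhs_nbhs.
have DE y i r : U y -> Dmx eta y i r = nabla eta y i r - (chris Gam r y *m (eta y)^T) i 0.
  move=> Uy; rewrite /nabla addmxE summxE [(_ *m (eta y)^T) i 0]mxE.
  rewrite [X in _ + X - _](eq_bigr (fun k => chris Gam r y i k * (eta y)^T k 0)) ?addrK //.
  by move=> k _; rewrite [LHS]mxE (chris_sym i k r Uy) mulrC [(eta y)^T k 0]mxE.
have NE y i s : nabla eta y i s = Z y i s + eta y 0 i * al y 0 s.
  rewrite /Z; move: (nabla eta y) (al y) => A b.
  by rewrite [in RHS]addmxE oppmxE outer_mxE [(eta y)^T i 0]mxE subrK.
have dS r j : dominated p Q (fun y => (eta y *m covd Gam S r y) 0 j).
  have := dker (fun y => (col j (covd Gam S r y))^T).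
  have -> : (fun y => (eta y *m ((col j (covd Gam S r y))^T)^T) 0 0) =
    (fun y => (eta y *m covd Gam S r y) 0 j).
    by apply/funext => y; rewrite trmxK mul_colE.
  apply.
    move=> k; rewrite (_ : (fun z => _) = fun z => covd Gam S r z k j); last first.
      by apply/funext => z; rewrite !mxE.
    apply: msmoothB => //; last by apply: msmoothM => //; exact: msmooth_chris.
    apply: msmoothB => //; first exact: msmooth_pd.
    by apply: msmoothM => //; apply: msmooth_tr; exact: msmooth_chris.
  move=> y Uy v vS; rewrite trmxK.
  have [_ H] := covd_kernel hn oU sGam Uy (isotropy_jets Uy vS) sS lieS symS.
  by apply/matrixP => a b; rewrite !ord1 mul_colE H !mxE.
have dR r s i : dominated p Q (fun y => \sum_k eta y 0 k * crv Gam k r y i s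
    - schouten Gam oth r s y * eta y 0 i).
  pose l y : 'rV[R]_n := \row_k (crv Gam k r y i s - schouten Gam oth r s y * (k == i)%:R).
  have lE y (v : 'rV[R]_n) : (v *m (l y)^T) 0 0 =
      \sum_k v 0 k * crv Gam k r y i s - schouten Gam oth r s y * v 0 i.
    rewrite mxE (eq_bigr (fun k => v 0 k * crv Gam k r y i s -
       v 0 k * (schouten Gam oth r s y * (k == i)%:R))); last first.
      by move=> k _; rewrite !mxE mulrBr.
    rewrite sumrB; congr (_ - _); rewrite (bigD1 i) //= eqxx mulr1 mulrC big1 ?addr0 //.
    by move=> k ki; rewrite (negbTE ki) mulr0 mulr0.
  have := dker l; rewrite (_ : (fun y => _) = (fun y => \sum_k eta y 0 k *
    crv Gam k r y i s - schouten Gam oth r s y * eta y 0 i)); last first.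
    by apply/funext => y; rewrite lE.
  apply.
    move=> k; rewrite (_ : (fun z => _) = fun y => crv Gam k r y i s -
        schouten Gam oth r s y * (k == i)%:R); last first.
      by apply/funext => z; rewrite mxE.
    have sC a b c d : smooth U (fun y => crv Gam a b y c d) by exact: msmooth_crv.
    apply: smoothB => //; apply: smoothM => //; last exact: smooth_cst.
    rewrite /schouten; case: (r == s) => //.
    apply: smoothM => //; last exact: smooth_cst.
    apply: smoothD => //; apply: smoothM => //; exact: smooth_cst.
  move=> y Uy v vS; apply/matrixP => a b; rewrite !ord1 lE mxE.
  by rewrite (crv_kernel oU sGam symGam Uy (isotropy_jets Uy vS) othP) subrr.
(* The derivative of [Z] is [lin] plus eta times [kap]: [lin] collects what is visibly dominated by
   the unknowns, [kap] everything proportional to eta, including the uncontrolled derivatives of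
   alpha. *)
pose lin r i s y := (Z y *m chris Gam r y) i s - (chris Gam r y *m Z y) i s
  - Z y i r * al y 0 s - (\sum_k eta y 0 k * crv Gam k r y i s
    - schouten Gam oth r s y * eta y 0 i).
pose kap r s y := (al y *m chris Gam r y) 0 s - al y 0 r * al y 0 s
  - pd r (fun z => al z 0 s) y - schouten Gam oth r s y.
have dlin r i s : dominated p Q (lin r i s).
  apply: dominatedB (dR r s i); apply: dominatedB.
    apply: dominatedB.
      apply: (@dominated_near _ _ _ _ _ (fun y => \sum_k chris Gam r y k s * Z y i k)).
        by apply: (filterE (F := nbhs p)) => y; rewrite mxE; apply: eq_bigr => k _; rewrite mulrC.
      by apply: dominated_sum => k; apply: dominatedM => //; apply: cont; exact: sGB.
    apply: (@dominated_near _ _ _ _ _ (fun y => \sum_k chris Gam r y i k * Z y k s)).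
      by apply: (filterE (F := nbhs p)) => y; rewrite mxE.
    by apply: dominated_sum => k; apply: dominatedM => //; apply: cont; exact: sGB.
  apply: (@dominated_near _ _ _ _ _ (fun y => al y 0 s * Z y i r)).
    by apply: (filterE (F := nbhs p)) => y; rewrite mulrC.
  by apply: dominatedM => //; apply: cont; exact: sal.
have pdZE y r i s : B y -> pd r (fun z => Z z i s) y = lin r i s y + eta y 0 i * kap r s y.
  move=> By; have Uy := r1U _ By.
  have E1 : pd r (fun z => Z z i s) y = mpd r (nabla eta) y i s
      - (eta y 0 i * pd r (fun z => al z 0 s) y + Dmx eta y i r * al y 0 s).
    have -> : pd r (fun z => Z z i s) y = mpd r Z y i s by rewrite mxE.
    rewrite (mpdB oB r sN (msmoothM oB sE sA) By) (mpdM oB r sE sA By).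
    have -> : pd r (fun z => al z 0 s) y = mpd r al y 0 s by rewrite mxE.
    have -> : Dmx eta y i r = mpd r (fun y => (eta y)^T) y i 0.
      by rewrite mpd_tr !mxE.
    move: (mpd r (nabla eta) y) (mpd r al y) (mpd r _ y) (al y) (eta y) => a b c d e.
    by rewrite addmxE oppmxE addmxE !outer_mxE [e^T i 0]mxE.
  have E2 : mpd r (nabla eta) y i s = (nabla eta y *m chris Gam r y) i s
      - (chris Gam r y *m nabla eta y) i s - \sum_k eta y 0 k * crv Gam k r y i s.
    rewrite (mpd_nabla r aff Uy); have <- : (\sum_k eta y 0 k *: crv Gam k r y) i s =
      \sum_k eta y 0 k * crv Gam k r y i s.
      by rewrite summxE; apply: eq_bigr => k _; rewrite [LHS]mxE.
    move: (nabla eta y *m _) (_ *m nabla eta y) (\sum_k _) => a b c.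
    by rewrite addmxE oppmxE addmxE oppmxE.
  have NZ : nabla eta y = Z y + (eta y)^T *m al y by rewrite /Z subrK.
  have E3 : (nabla eta y *m chris Gam r y) i s =
      (Z y *m chris Gam r y) i s + eta y 0 i * (al y *m chris Gam r y) 0 s.
    rewrite NZ; move: (Z y) (chris Gam r y) (eta y) (al y) => a b c d.
    by rewrite mulmxDl addmxE -[c^T *m d *m b]mulmxA outer_mxE [c^T i 0]mxE.
  have E4 : (chris Gam r y *m nabla eta y) i s =
      (chris Gam r y *m Z y) i s + (chris Gam r y *m (eta y)^T) i 0 * al y 0 s.
    rewrite NZ; move: (Z y) (chris Gam r y) (eta y) (al y) => a b c d.
    by rewrite mulmxDr addmxE [b *m (c^T *m d)]mulmxA outer_mxE.
  rewrite E1 E2 E3 E4 (DE y i r Uy) NE /lin /kap; ring.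
have Z0 y s : B y -> Z y i0 s = 0.
  move=> By; have := NE y i0 s; have -> : al y 0 s = nabla eta y i0 s / eta y 0 i0 by rewrite mxE.
  by rewrite [X in _ + X]mulrC divfK ?r1e // => /eqP; rewrite -subr_eq subrr => /eqP.
(* In row [i0] the left side of [pdZE] is zero, so [kap] equals - [lin] divided by the nonvanishing
   component of eta. *)
have dkap r s : dominated p Q (kap r s).
  apply: (@dominated_near _ _ _ _ _ (fun y => - (eta y 0 i0)^-1 * lin r i0 s y)).
    apply: filterS nearB => y By.
    have := pdZE y r i0 s By; rewrite (pd_eq (g := fun=> 0) r oB By) ?pd_cst; last first.
      by move=> z Bz; exact: Z0.
    move/esym/eqP; rewrite addr_eq0 => /eqP ->.
    by rewrite mulrN mulNr opprK mulKf ?r1e.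
  by apply: dominatedM => //; apply: cont; exact: smoothN.
have dpd r a : dominated p Q (pd r (Q a)).
  case: a => [j|[i s]].
    (* Leibniz rule for eta S: the derivative of eta is replaced by Z + eta (x) alpha minus a
       connection term, that of [S] by [covd] plus connection terms; two of the latter terms
       cancel. *)
    apply: (@dominated_near _ _ _ _ _ (fun y => \sum_i S y i j * Z y i r
       + al y 0 r * (eta y *m S y) 0 j + (eta y *m covd Gam S r y) 0 j
       + \sum_k chris Gam r y k j * (eta y *m S y) 0 k)).
      apply: filterS nearB => y By; have Uy := r1U _ By.
      have -> : pd r (Q (inl j)) y = mpd r (fun y => eta y *m S y) y 0 j by rewrite mxE.
      rewrite (mpdM oB r sEr sSB By).
      have -> : mpd r eta y = \row_i Z y i r + al y 0 r *: eta y - eta y *m (chris Gam r y)^T.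
        apply/rowP => i; rewrite !addmxE oppmxE.
        have -> : mpd r eta y 0 i = Dmx eta y i r by rewrite !mxE.
        rewrite DE // NE; congr (_ + _ - _); first by rewrite [RHS]mxE.
          by rewrite [RHS]mxE mulrC.
        by rewrite -[eta y in RHS]trmxK -trmx_mul [RHS]mxE.
      have -> : mpd r S y = covd Gam S r y + (chris Gam r y)^T *m S y + S y *m chris Gam r y.
        by rewrite /covd -addrA [X in _ = _ + X]addrC addrA !subrK.
      rewrite !(mulmxDl, mulmxDr, mulNmx) !mulmxA -scalemxAl !addmxE oppmxE.
      have -> : \sum_i S y i j * Z y i r = ((\row_i Z y i r) *m S y) 0 j.
        by rewrite [RHS]mxE; apply: eq_bigr => i _; rewrite [(\row_i0 _) _ _]mxE mulrC.
      have -> : \sum_k chris Gam r y k j * (eta y *m S y) 0 k =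
          (eta y *m S y *m chris Gam r y) 0 j.
        by rewrite [RHS]mxE; apply: eq_bigr => i _; rewrite mulrC.
      have -> : (al y 0 r *: (eta y *m S y)) 0 j = al y 0 r * (eta y *m S y) 0 j.
        by rewrite [LHS]mxE.
      ring.
    apply: dominatedD; last first.
      by apply: dominated_sum => k; apply: dominatedM => //; apply: cont; exact: sGB.
    apply: dominatedD => //; apply: dominatedD.
      by apply: dominated_sum => k; apply: dominatedM => //; apply: cont; exact: sSB.
    by apply: dominatedM => //; apply: cont; exact: sal.
  apply: (@dominated_near _ _ _ _ _ (fun y => lin r i s y + eta y 0 i * kap r s y)).
    by apply: filterS nearB => y By; rewrite -pdZE.
  by apply: dominatedD => //; apply: dominatedM => //; apply: cont; exact: seB.
have [r r0 [rB H]] := gronwall_near oB Bp sQ dpd.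
exists eta, al, i0, r; split => //.
- by move=> y /rB/r1U.
- by split => // i; exact: smooth_sub (sal i).
move=> y ry; split; first exact/r1e/rB.
apply/matrixP => i s; rewrite NE outer_mxE [(eta y)^T i 0]mxE.
have pr : ball p r p by exact: ballxx.
have -> : Z y i s = 0.
  apply: (H p y pr ry _ (inr (i, s))) => -[j|[a b]] /=.
    by rewrite etap wS mxE.
  by rewrite /Z N0 alp mulmx0 subrr mxE.
by rewrite add0r.
Qed.

End ParallelDirection.

(** * Ratios of affine fields and their second order equation *)

Section AffineRatio.
Context {R : realType} {n : nat}.
Variable Gam : 'I_n -> 'I_n -> 'I_n -> 'rV[R]_n -> R.
Implicit Types (y : 'rV[R]_n) (eta zeta : 'rV[R]_n -> 'rV[R]_n).

Lemma affine_field_sub (W U : set 'rV[R]_n) eta : W `<=` U ->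
  affine_field U Gam eta -> affine_field W Gam eta.
Proof.
move=> WU [se aff]; split; first by move=> i; exact: smooth_sub (se i).
by move=> y /WU; exact: aff.
Qed.

Lemma scalmxE a b (k : R) (A : 'M[R]_(a, b)) i j : (k *: A) i j = k * A i j.
Proof. by rewrite mxE. Qed.

(** The right side of the affine equation as a linear function of a formal 1-jet, so that it can
    also be applied to pairs that are not the jet of a field, such as (0, eta (x) df). *)
Definition afflin (r : 'I_n) y (v : 'rV[R]_n) (P : 'M[R]_n) : 'M[R]_n :=
  P *m chris Gam r y - chris Gam r y *m P
  - \sum_k v 0 k *: mpd k (chris Gam r) y - \sum_k P k r *: chris Gam k y.

Lemma afflinD r y v w P Q :
  afflin r y (v + w) (P + Q) = afflin r y v P + afflin r y w Q.
Proof.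
rewrite /afflin mulmxDl mulmxDr.
have -> : \sum_k (v + w) 0 k *: mpd k (chris Gam r) y =
    \sum_k v 0 k *: mpd k (chris Gam r) y + \sum_k w 0 k *: mpd k (chris Gam r) y.
  by rewrite -big_split; apply: eq_bigr => k _; rewrite mxE scalerDl.
have -> : \sum_k (P + Q) k r *: chris Gam k y =
    \sum_k P k r *: chris Gam k y + \sum_k Q k r *: chris Gam k y.
  by rewrite -big_split; apply: eq_bigr => k _; rewrite mxE scalerDl.
by apply/matrixP => i j; rewrite !(addmxE, oppmxE); lra.
Qed.

Lemma afflinZ r y (a : R) v P : afflin r y (a *: v) (a *: P) = a *: afflin r y v P.
Proof.
rewrite /afflin !scalerBr scalemxAl scalemxAr !scaler_sumr.
by congr (_ - _ - _); apply: eq_bigr => k _; rewrite scalerA mxE.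
Qed.

Lemma afflinB r y v w P Q :
  afflin r y (v - w) (P - Q) = afflin r y v P - afflin r y w Q.
Proof.
rewrite afflinD; congr (_ + _).
by rewrite -[- w]scaleN1r -[- Q]scaleN1r afflinZ scaleN1r.
Qed.

Variable B : set 'rV[R]_n.
Hypothesis oB : open B.
Hypothesis sGam : forall i r s, smooth B (Gam i r s).
Hypothesis symGam : forall y, B y -> forall i r s, Gam i r s y = Gam i s r y.

Lemma dominated_afflin (J : finType) (Q : J -> 'rV[R]_n -> R) p
    (v : 'rV[R]_n -> 'rV[R]_n) (P : 'rV[R]_n -> 'M[R]_n) : B p ->
    (forall j, dominated p Q (fun y => v y 0 j)) ->
    (forall i s, dominated p Q (fun y => P y i s)) ->
  forall r i s, dominated p Q (fun y => afflin r y (v y) (P y) i s).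
Proof.
move=> Bp dv dP r i s.
have cont g : smooth B g -> {for p, continuous g}.
  by move=> sg; exact: smooth_continuous sg Bp.
have sG k : msmooth B (chris Gam k) by exact: msmooth_chris.
apply: (@dominated_near _ _ _ _ _ (fun y => \sum_k chris Gam r y k s * P y i k
   - \sum_k chris Gam r y i k * P y k s
   - \sum_k mpd k (chris Gam r) y i s * v y 0 k
   - \sum_k chris Gam k y i s * P y k r)).
  apply: (filterE (F := nbhs p)) => y; rewrite /afflin !addmxE !oppmxE !summxE.
  congr (_ - _ - _ - _).
  - by rewrite [RHS]mxE; apply: eq_bigr => k _; rewrite mulrC.
  - by rewrite [RHS]mxE.
  - by apply: eq_bigr => k _; rewrite [RHS]mxE mulrC.
  - by apply: eq_bigr => k _; rewrite [RHS]mxE mulrC.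
apply: dominatedB; first apply: dominatedB; first apply: dominatedB.
- by apply: dominated_sum => k; apply: dominatedM => //; apply: cont; exact: sG.
- by apply: dominated_sum => k; apply: dominatedM => //; apply: cont; exact: sG.
- apply: dominated_sum => k; apply: dominatedM => //; apply: cont.
  by apply: (msmooth_pd k (sG r)).
- by apply: dominated_sum => k; apply: dominatedM => //; apply: cont; exact: sG.
Qed.

(** The affine equation bounds the derivatives of the pair (eta, [Dmx eta]) by the pair itself. *)
Lemma affine_jet_unique p eta : B p -> affine_field B Gam eta ->
  exists2 r : R, 0 < r & ball p r `<=` B /\ forall q z, ball p r q -> ball p r z ->
    eta q = 0 -> Dmx eta q = 0 -> eta z = 0.
Proof.
move=> Bp [se eqe].
pose Q (a : 'I_n + 'I_n * 'I_n) y := match a with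
  | inl j => eta y 0 j | inr (i, s) => Dmx eta y i s end.
have sD : msmooth B (Dmx eta) by exact: msmooth_Dmx.
have sQ a : smooth B (Q a) by case: a => [j|[i s]] /=; [exact: se|exact: sD].
have dQ a : dominated p Q (Q a) by exact: dominated_self.
have dpd r a : dominated p Q (pd r (Q a)).
  case: a => [j|[i s]].
    apply: (@dominated_near _ _ _ _ _ (Q (inr (j, r)))) => //.
    by apply: (filterE (F := nbhs p)) => y; rewrite /= mxE.
  apply: (@dominated_near _ _ _ _ _ (fun y => afflin r y (eta y) (Dmx eta y) i s)).
    have nearB : \forall y \near p, B y by apply: open_nbhs_nbhs.
    apply: filterS nearB => y By; rewrite /afflin -eqe //.
    by rewrite mxE.
  apply: dominated_afflin => //; first by move=> j; exact: (dQ (inl j)).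
  by move=> i1 s1; exact: (dQ (inr (i1, s1))).
have [r r0 [rB H]] := gronwall_near oB Bp sQ dpd.
exists r => //; split => // q z pq pz e0 D0; apply/rowP => j; rewrite [RHS]mxE.
by apply: (H q z pq pz _ (inl j)) => -[i|[i s]] /=; rewrite ?e0 ?D0 mxE.
Qed.

(** With f the ratio of the components [i0], the defect D = zeta - f eta satisfies the affine
    equation up to eta (x) H, where H = 0 is the equation wanted for f. Row [i0] of D is identically
    zero and so bounds H by the jet of D; hence D, and then H, vanish. *)
Lemma affine_ratio p eta zeta (al : 'rV[R]_n -> 'rV[R]_n) i0 (xi : 'rV[R]_n) : B p ->
    affine_field B Gam eta -> affine_field B Gam zeta -> smooth_map B al ->
    (forall y, B y -> eta y 0 i0 != 0 /\ nabla Gam eta y = (eta y)^T *m al y) ->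
    zeta p = 0 -> Dmx zeta p = (eta p)^T *m xi ->
  exists f (r : R), [/\ 0 < r, ball p r `<=` B, smooth (ball p r) f,
    forall s, pd s f p = xi 0 s &
    forall y, ball p r y -> forall a b, pd a (pd b f) y =
      \sum_k pd k f y * Gam k a b y - (al y 0 a * pd b f y + al y 0 b * pd a f y)].
Proof.
move=> Bp affe affz sal HE z0 Dz; have [se eqe] := affe; have [sz eqz] := affz.
have e0 y : B y -> eta y 0 i0 != 0 by move=> /HE[].
have sV : smooth B (fun y => (eta y 0 i0)^-1) by exact: smoothV.
pose f y := zeta y 0 i0 / eta y 0 i0.
have sf : smooth B f by exact: (smoothM oB (sz i0) sV).
have fp : f p = 0 by rewrite /f z0 mxE mul0r.
have fE y : B y -> zeta y 0 i0 = f y * eta y 0 i0 by move=> By; rewrite divfK ?e0.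
clearbody f.
pose df y : 'rV[R]_n := \row_s pd s f y.
have sdf : msmooth B df.
  move=> i j; rewrite (_ : (fun z => _) = pd j f); first exact: smooth_pd.
  by apply/funext => y; rewrite mxE.
have dfE y s : df y 0 s = pd s f y by rewrite mxE.
clearbody df.
have smz : msmooth B zeta by move=> i j; rewrite ord1; exact: sz.
have sme : msmooth B eta by move=> i j; rewrite ord1; exact: se.
have smeT : msmooth B (fun y => (eta y)^T) by exact: msmooth_tr.
have sDe := msmooth_Dmx se; have sDz := msmooth_Dmx sz.
pose D y := zeta y - f y *: eta y.
have DE y i : D y 0 i = zeta y 0 i - f y * eta y 0 i by rewrite !mxE.
clearbody D.
have sD : smooth_map B D.
  move=> i; apply: (smooth_eq (f := fun y => zeta y 0 i - f y * eta y 0 i)) => //.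
  exact: smoothB (sz i) (smoothM oB sf (se i)).
have DmxD y : B y -> Dmx D y = Dmx zeta y - (f y *: Dmx eta y + (eta y)^T *m df y).
  move=> By; apply/matrixP => i s; rewrite addmxE oppmxE addmxE outer_mxE.
  rewrite [Dmx D y i s]mxE (pd_eq (g := fun y => zeta y 0 i - f y * eta y 0 i) s oB By) //.
  rewrite (pdB oB s (sz i) (smoothM oB sf (se i)) By) (pdM s sf (se i) By).
  by rewrite dfE scalmxE ![Dmx _ _ _ _]mxE [(eta y)^T i 0]mxE; ring.
pose H r y := mpd r df y - df y *m chris Gam r y + al y 0 r *: df y + df y 0 r *: al y.
have HE1 r y : B y -> mpd r (Dmx D) y = afflin r y (D y) (Dmx D y) - (eta y)^T *m H r y.
  move=> By; have [_ NE] := HE y By.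
  rewrite (mpd_eq oB r By DmxD).
  have s1 : msmooth B (fun y => f y *: Dmx eta y) by exact: msmoothZ.
  have s2 : msmooth B (fun y => (eta y)^T *m df y) by exact: msmoothM.
  rewrite (mpdB oB r sDz (msmoothD oB s1 s2) By) (mpdD r s1 s2 By).
  rewrite (mpdZ r sf sDe By) (mpdM oB r smeT sdf By).
  (* The jet of D splits into the jet of zeta, f times the jet of eta, and the formal jet (0, eta
     (x) df), to which linearity of [afflin] applies. *)
  have -> : D y = zeta y - (f y *: eta y + 0) by apply/rowP => i; rewrite DE addr0 !mxE.
  rewrite DmxD // afflinB afflinD afflinZ.
  have -> : mpd r (Dmx zeta) y = afflin r y (zeta y) (Dmx zeta y) by exact: eqz.
  have -> : mpd r (Dmx eta) y = afflin r y (eta y) (Dmx eta y) by exact: eqe.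
  have Ce : Dmx eta y = (eta y)^T *m al y - \sum_k eta y 0 k *: chris Gam k y.
    by rewrite -NE /nabla addrK.
  have Cr : mpd r (fun y => (eta y)^T) y = al y 0 r *: (eta y)^T - chris Gam r y *m (eta y)^T.
    apply/colP => i; rewrite addmxE oppmxE.
    have -> : mpd r (fun y => (eta y)^T) y i 0 = Dmx eta y i r by rewrite mpd_tr !mxE.
    rewrite Ce addmxE oppmxE outer_mxE scalmxE mulrC; congr (_ - _).
    rewrite summxE [RHS]mxE; apply: eq_bigr => k _; rewrite [LHS]mxE mulrC.
    by rewrite [(eta y)^T k 0]mxE; congr (_ * _); rewrite !mxE symGam.
  have L0 : afflin r y 0 ((eta y)^T *m df y) = (eta y)^T *m (df y *m chris Gam r y)
      - chris Gam r y *m (eta y)^T *m df y - df y 0 r *: \sum_k eta y 0 k *: chris Gam k y.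
    rewrite /afflin [X in _ - X - _]big1 ?subr0; last first.
      by move=> k _; rewrite mxE scale0r.
    rewrite !mulmxA; congr (_ - _); rewrite scaler_sumr; apply: eq_bigr => k _.
    by rewrite outer_mxE [(eta y)^T k 0]mxE scalerA mulrC.
  have Cd : df y 0 r *: Dmx eta y = df y 0 r *: ((eta y)^T *m al y)
      - df y 0 r *: \sum_k eta y 0 k *: chris Gam k y by rewrite Ce scalerBr.
  rewrite L0 Cr /H -dfE Cd !(mulmxDr, mulmxDl, mulmxN, mulNmx) -!scalemxAr -!scalemxAl.
  rewrite !mulmxA; move: (afflin r y (eta y) _) (afflin r y (zeta y) _) => A1 A2.
  apply/matrixP => i j; rewrite !(addmxE, oppmxE); lra.
have HEs r s y : B y -> H r y 0 s = pd r (pd s f) y - \sum_k pd k f y * Gam k r s y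
    + (al y 0 r * pd s f y + al y 0 s * pd r f y).
  move=> By; rewrite /H !addmxE oppmxE !scalmxE !dfE [_ * al y 0 s]mulrC addrA.
  congr (_ - _ + _ + _).
    rewrite mxE; congr (pd r _ y); apply/funext => z; exact: dfE.
  by rewrite mxE; apply: eq_bigr => k _; rewrite dfE mxE.
have D0 y : B y -> D y 0 i0 = 0 by move=> By; rewrite DE fE // subrr.
have DD0 y s : B y -> Dmx D y i0 s = 0.
  by move=> By; rewrite mxE (pd_eq (g := fun=> 0) s oB By) ?pd_cst.
pose Q (a : 'I_n + 'I_n * 'I_n) y := match a with
  | inl j => D y 0 j | inr (i, s) => Dmx D y i s end.
have sDD : msmooth B (Dmx D) by exact: msmooth_Dmx.
have sQ a : smooth B (Q a).
  by case: a => [j|[i s]] /=; [exact: sD|exact: sDD].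
have cont g : smooth B g -> {for p, continuous g}.
  by move=> sg; exact: smooth_continuous sg Bp.
have dQ a : dominated p Q (Q a) by exact: dominated_self.
have nearB : \forall y \near p, B y by apply: open_nbhs_nbhs.
have dL r i s : dominated p Q (fun y => afflin r y (D y) (Dmx D y) i s).
  apply: dominated_afflin => //; first by move=> j; exact: (dQ (inl j)).
  by move=> i1 s1; exact: (dQ (inr (i1, s1))).
(* All derivatives of the component [i0] of D vanish, so row [i0] of [HE1] solves for H. *)
have Hi0 r s y : B y -> eta y 0 i0 * H r y 0 s = afflin r y (D y) (Dmx D y) i0 s.
  move=> By; have : mpd r (Dmx D) y i0 s = 0.
    by rewrite mxE (pd_eq (g := fun=> 0) r oB By) ?pd_cst // => z Bz; exact: DD0.
  rewrite HE1 // addmxE oppmxE outer_mxE [(eta y)^T i0 0]mxE => /eqP.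
  by rewrite subr_eq0 => /eqP ->.
have dH r s : dominated p Q (fun y => H r y 0 s).
  apply: (@dominated_near _ _ _ _ _
      (fun y => (eta y 0 i0)^-1 * afflin r y (D y) (Dmx D y) i0 s)).
    by apply: filterS nearB => y By; rewrite -Hi0 // mulKf ?e0.
  by apply: dominatedM => //; exact: cont.
have dpd r a : dominated p Q (pd r (Q a)).
  case: a => [j|[i s]].
    apply: (@dominated_near _ _ _ _ _ (Q (inr (j, r)))) => //.
    by apply: (filterE (F := nbhs p)) => y; rewrite /= mxE.
  apply: (@dominated_near _ _ _ _ _ (fun y => afflin r y (D y) (Dmx D y) i s
      - eta y 0 i * H r y 0 s)).
    apply: filterS nearB => y By; have -> : pd r (Q (inr (i, s))) y = mpd r (Dmx D) y i s.
      by rewrite mxE.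
    rewrite HE1 //; move: (afflin _ _ _ _) (H r y) => A h.
    by rewrite addmxE oppmxE outer_mxE [(eta y)^T i 0]mxE.
  by apply: dominatedB => //; apply: dominatedM => //; apply: cont; exact: se.
have dfp s : pd s f p = xi 0 s.
  have := DD0 p s Bp; rewrite DmxD // Dz fp scale0r add0r -mulmxBr outer_mxE.
  rewrite [(eta p)^T i0 0]mxE addmxE oppmxE dfE => /eqP.
  by rewrite mulf_eq0 (negbTE (e0 p Bp)) /= subr_eq0 => /eqP.
have [r r0 [rB HQ]] := gronwall_near oB Bp sQ dpd.
exists f, r; split => //; first exact: smooth_sub sf.
move=> y ry a b.
have pr : ball p r p by exact: ballxx.
have Q0 c : Q c y = 0.
  apply: (HQ p y pr ry) => -[j|[i s]] /=; first by rewrite DE z0 fp mul0r mxE subrr.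
  rewrite DmxD // Dz fp scale0r add0r -mulmxBr (_ : xi - df p = 0) ?mulmx0 ?mxE //.
  by apply/rowP => j; rewrite addmxE oppmxE dfE dfp subrr mxE.
have By := rB y ry.
have Dy : D y = 0 by apply/rowP => j; rewrite [RHS]mxE; exact: (Q0 (inl j)).
have DDy : Dmx D y = 0 by apply/matrixP => i s; rewrite [RHS]mxE; exact: (Q0 (inr (i, s))).
have := Hi0 a b y By; rewrite Dy DDy -(scale0r 0) -(scale0r (0 : 'M[R]_n)) afflinZ scale0r.
rewrite [RHS]mxE HEs // => /eqP; rewrite mulf_eq0 (negbTE (e0 y By)) /=.
by rewrite addr_eq0 subr_eq => /eqP ->; rewrite addrC.
Qed.

End AffineRatio.

(** * The space of allowed 1-jets and its dimension *)

Section JetDimension.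
Context {R : realType} {n : nat}.
Variables (m : nat) (S : 'M[R]_n).
Hypothesis hmn : (m <= n)%N.
Hypothesis rankS : \rank S = m.

(** The three blocks have n, (n - m) n and m (m - 1)/2 elements, and n + (n - m) n = n (n + 1 -
    m). *)
Definition jet_index : finType :=
  ('I_n + ({i : 'I_n | (m <= i)%N} * 'I_n + {ij : 'I_n * 'I_n | (ij.1 < ij.2 < m)%N}))%type.

Lemma card_jet_index : #|{: jet_index}| = (n * (n + 1 - m) + (m * (m - 1))./2)%N.
Proof.
rewrite /jet_index !card_sum card_prod !card_ord !card_sig.
have cardlt k : (k <= n)%N -> (\sum_(i < n | (i < k)%N) 1)%N = k.
  by move=> kn; rewrite -(big_ord_widen n (fun=> 1%N) kn) sum_nat_const card_ord muln1.
have -> : #|[pred i : 'I_n | (m <= i)%N]| = (n - m)%N.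
  rewrite -[in RHS](card_ord n) -(cardC (fun i : 'I_n => (i < m)%N)).
  rewrite -[X in (X + _)%N]sum1_card cardlt // addKn.
  by apply: eq_card => i; rewrite !inE [in RHS]unfold_in leqNgt.
have -> : #|[pred ij : 'I_n * 'I_n | (ij.1 < ij.2 < m)%N]| = 'C(m, 2).
  rewrite -sum1_card -(pair_big_dep xpredT (fun i j : 'I_n => (i < j < m)%N)
    (fun _ _ => 1%N)) (exchange_big_dep xpredT) //=.
  rewrite -triangular_sum big_mkord (big_ord_widen n (fun j => j) hmn) [RHS]big_mkcond.
  apply: eq_bigr => j _; case: ifP => jm; last first.
    by rewrite big1 // => i; rewrite andbF.
  rewrite (eq_bigl (fun i : 'I_n => (i < j)%N)) => [|i]; last by rewrite andbT.
  by rewrite cardlt // ltnW.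
rewrite bin2 subn1 addnA; congr (_ + _)%N.
by rewrite -[in RHS]addnBAC // mulnDr muln1 addnC mulnC.
Qed.

(* Coordinates on the space of the pairs (v, P) such that [S *m P] is
   antisymmetric: v itself, the components of P along ker S, and the entries above
   the diagonal of the antisymmetric form on the complement of ker S. *)
Definition jet_coord (v : 'rV[R]_n) (P : 'M[R]_n) (d : jet_index) : R :=
  match d with
  | inl k => v 0 k
  | inr (inl (i, j)) => (row_ebase S *m P) (val i) j
  | inr (inr ij) => (pid_mx m *m row_ebase S *m P *m (invmx (col_ebase S))^T)
                       (val ij).1 (val ij).2
  end.

(** In the bases of the rank decomposition the antisymmetric form S P becomes X, whose rows from m
    on vanish. Antisymmetry kills the columns from m on and reduces the remaining block to its
    entries above the diagonal; X = 0 then annihilates the first m rows of V P, and the other rows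
    are themselves coordinates. *)
Lemma jet_coord_eq0 v P : P^T *m S^T + S *m P = 0 ->
  (forall d, jet_coord v P d = 0) -> v = 0 /\ P = 0.
Proof.
move=> skew H; split.
  by apply/rowP => k; rewrite mxE; exact: (H (inl k)).
set V := row_ebase S; set L := col_ebase S.
have uL : L \in unitmx by exact: col_ebase_unit.
have uV : V \in unitmx by exact: row_ebase_unit.
have SE : S = L *m pid_mx m *m V by rewrite -{1}(mulmx_ebase S) rankS.
pose X : 'M[R]_n := pid_mx m *m V *m P *m (invmx L)^T.
have XE : X = invmx L *m (S *m P) *m (invmx L)^T.
  by rewrite /X {1}SE !mulmxA mulVmx // mul1mx.
have Kskew : (S *m P)^T = - (S *m P).
  by rewrite trmx_mul; apply/eqP; rewrite -addr_eq0 skew.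
have Xskew : X^T = - X.
  by rewrite XE trmx_mul trmxK trmx_mul Kskew mulNmx mulmxN mulmxA.
have Xs i j : X i j = - X j i.
  by move/matrixP: Xskew => /(_ j i); rewrite mxE => ->; rewrite mxE.
have Xlow (i j : 'I_n) : (m <= i)%N -> X i j = 0.
  move=> mi; rewrite /X -!mulmxA mxE big1 // => k _.
  by rewrite mxE [(i < m)%N]ltnNge mi andbF mul0r.
have Xup (i j : 'I_n) (ijm : (i < j < m)%N) : X i j = 0.
  exact: (H (inr (inr (exist _ (i, j) ijm)))).
have X0 : X = 0.
  apply/matrixP => i j; rewrite [RHS]mxE.
  have [mi|im] := leqP m i; first exact: Xlow.
  have [mj|jm] := leqP m j; first by rewrite Xs Xlow // oppr0.
  have [ij|ji|/val_inj ij] := ltngtP i j.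
  - by apply: Xup; rewrite ij.
  - by rewrite Xs Xup ?oppr0 // ji.
  - by have := Xs i j; rewrite ij; lra.
have uLT : (invmx L)^T \in unitmx by rewrite unitmx_tr unitmx_inv.
have VP : pid_mx m *m (V *m P) = 0 :> 'M[R]_n.
  apply: (can_inj (mulmxK uLT)); rewrite mul0mx !mulmxA; exact: X0.
suff : V *m P = 0 by move/(congr1 (mulmx (invmx V))); rewrite mulKmx // mulmx0.
apply/matrixP => i j; rewrite [RHS]mxE.
have [mi|im] := leqP m i; first exact: (H (inr (inl (exist _ i mi, j)))).
move/matrixP: VP => /(_ i j); rewrite [X in _ = X -> _]mxE => <-.
have -> : (V *m P) i j = (pid_mx m *m (V *m P)) i j; last by [].
rewrite [RHS]mxE (bigD1 i) //= big1 ?addr0 => [|k ki].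
  by rewrite [pid_mx m i i]mxE eqxx im mul1r.
by rewrite [pid_mx m i k]mxE eq_sym [_ == _](negbTE ki) mul0r.
Qed.

Lemma jet_coord_linear (N : nat) (v : 'I_N -> 'rV[R]_n) (P : 'I_N -> 'M[R]_n)
    (a : 'rV[R]_N) d :
  jet_coord (\sum_k a 0 k *: v k) (\sum_k a 0 k *: P k) d =
  \sum_k a 0 k * jet_coord (v k) (P k) d.
Proof.
case: d => [k|[[i j]|ij]] /=; first by rewrite summxE; apply: eq_bigr => l _; rewrite mxE.
  rewrite mulmx_sumr summxE; apply: eq_bigr => l _.
  by rewrite -scalemxAr [LHS]mxE.
rewrite mulmx_sumr mulmx_suml summxE; apply: eq_bigr => l _.
by rewrite -scalemxAr -scalemxAl [LHS]mxE.
Qed.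

Lemma jet_coordB v w P Q d :
  jet_coord (v - w) (P - Q) d = jet_coord v P d - jet_coord w Q d.
Proof.
case: d => [k|[[i j]|ij]] /=; first by rewrite !mxE.
  by rewrite mulmxBr [LHS]mxE [X in _ + X]mxE.
by rewrite mulmxBr mulmxBl [LHS]mxE [X in _ + X]mxE.
Qed.

(** Independence of the N jets makes their coordinate matrix row free; it is square because N equals
    the number of coordinates, hence it is invertible and every coordinate row is attained. *)
Lemma jets_fill (N : nat) (v : 'I_N -> 'rV[R]_n) (P : 'I_N -> 'M[R]_n)
    (T : 'I_n -> 'M[R]_n) :
    S^T = S -> N = (n * (n + 1 - m) + (m * (m - 1))./2)%N ->
    (forall a : 'rV[R]_N, \sum_k a 0 k *: v k = 0 -> \sum_k a 0 k *: P k = 0 -> a = 0) ->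
    (forall k, \sum_l v k 0 l *: T l + (P k)^T *m S + S *m P k = 0) ->
  (forall v0 : 'rV[R]_n, exists a : 'rV[R]_N, \sum_k a 0 k *: v k = v0) /\
  forall (v0 : 'rV[R]_n) (P0 : 'M[R]_n), \sum_l v0 0 l *: T l + P0^T *m S + S *m P0 = 0 ->
  exists a : 'rV[R]_N, \sum_k a 0 k *: v k = v0 /\ \sum_k a 0 k *: P k = P0.
Proof.
move=> symS NE inj con.
have conS (a : 'rV[R]_N) : \sum_l (\sum_k a 0 k *: v k) 0 l *: T l
    + (\sum_k a 0 k *: P k)^T *m S + S *m (\sum_k a 0 k *: P k) = 0.
  have -> : \sum_l (\sum_k a 0 k *: v k) 0 l *: T l = \sum_k a 0 k *: \sum_l v k 0 l *: T l.
    under [RHS]eq_bigr do rewrite scaler_sumr.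
    rewrite exchange_big; apply: eq_bigr => l _; rewrite summxE scaler_suml.
    by apply: eq_bigr => k _; rewrite mxE scalerA.
  rewrite raddf_sum /= mulmx_suml mulmx_sumr -!big_split big1 //= => k _.
  have E := congr1 (fun A => a 0 k *: A) (con k).
  rewrite /= scaler0 !scalerDr in E; rewrite -scalemxAr -[RHS]E; congr (_ + _ + _).
  have -> : (a 0 k *: P k)^T = a 0 k *: (P k)^T by apply/matrixP => i j; rewrite !mxE.
  by rewrite scalemxAl.
pose A : 'M[R]_(N, #|{: jet_index}|) := \matrix_(k, d) jet_coord (v k) (P k) (enum_val d).
have aA (a : 'rV[R]_N) d : (a *m A) 0 (enum_rank d) =
    jet_coord (\sum_k a 0 k *: v k) (\sum_k a 0 k *: P k) d.
  rewrite jet_coord_linear mxE; apply: eq_bigr => k _.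
  by rewrite mxE enum_rankK.
have fA : row_free A.
  rewrite -kermx_eq0; apply/eqP/row_matrixP => i; rewrite row0.
  set a := row i _; have aA0 : a *m A = 0 by rewrite -row_mul mulmx_ker row0.
  have [v00 P00] : \sum_k a 0 k *: v k = 0 /\ \sum_k a 0 k *: P k = 0.
    apply: jet_coord_eq0 => [|d]; last by rewrite -aA aA0 mxE.
    have [v00 _] : \sum_k a 0 k *: v k = 0 /\ True.
      split=> //; apply/rowP => k; rewrite [RHS]mxE.
      by have := aA a (inl k); rewrite aA0 mxE.
    have := conS a; rewrite v00 big1 ?add0r; last by move=> l _; rewrite mxE scale0r.
    by rewrite symS.
  exact: inj.
have full : row_full A.
  by rewrite /row_full (eqP fA) card_jet_index NE.
have fill (v0 : 'rV[R]_n) (P0 : 'M[R]_n) : exists a : 'rV[R]_N,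
    a *m A = \row_d jet_coord v0 P0 (enum_val d).
  have /submxP[a ->] : ((\row_d jet_coord v0 P0 (enum_val d) : 'rV[R]_#|{: jet_index}|) <= A)%MS.
    exact: submx_full.
  by exists a.
have fillv v0 P0 (a : 'rV[R]_N) : a *m A = \row_d jet_coord v0 P0 (enum_val d) ->
    \sum_k a 0 k *: v k = v0.
  move=> aE; apply/rowP => k; have := aA a (inl k).
  by rewrite aE mxE enum_rankK /= => ->.
split=> [v0|v0 P0 con0].
  (* The pair (v0, 0) need not satisfy the constraint: only its coordinate row is matched, and the
     first block of coordinates is v0. *)
  by have [a aE] := fill v0 0; exists a; exact: fillv aE.
have [a aE] := fill v0 P0.
exists a; pose va := \sum_k a 0 k *: v k; pose Pa := \sum_k a 0 k *: P k.
have c0 d : jet_coord (v0 - va) (P0 - Pa) d = 0.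
  by rewrite jet_coordB -aA aE mxE enum_rankK subrr.
have vE : v0 - va = 0 by apply/rowP => k; rewrite [RHS]mxE; exact: (c0 (inl k)).
have vE' : v0 = va by apply/eqP; rewrite -subr_eq0 vE.
(* The values agree, so the inhomogeneous term with [T] cancels and the difference satisfies the
   homogeneous constraint of [jet_coord_eq0]. *)
have [_ PE] : v0 - va = 0 /\ P0 - Pa = 0.
  apply: jet_coord_eq0 => //; rewrite linearB /= mulmxBl mulmxBr symS.
  have := conS a; rewrite -/va -/Pa -vE' -[X in _ = X -> _]con0 -!addrA => /addrI E.
  apply/matrixP => i j; move/matrixP/(_ i j): E.
  by rewrite !(addmxE, oppmxE) [(0 : 'M[R]_n) i j]mxE; lra.
by split; [rewrite vE'|apply/eqP; rewrite eq_sym -subr_eq0; apply/eqP].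
Qed.

End JetDimension.

(** * Point symmetries *)

Section PointSymmetries.
Context {R : realType} {n : nat} {M : smoothManifold R n}.
Variables (A : operatorField M) (G : symmetricConnection M).
Implicit Types (c d : chart R n M) (X Y : vfield M).

Definition opmx c y : 'M[R]_n := \matrix_(i, j) A c i j y.

Definition lie_op c y (v : 'rV[R]_n) (P : 'M[R]_n) : 'M[R]_n :=
  \sum_k v 0 k *: mpd k (opmx c) y - P *m opmx c y + opmx c y *m P.

Lemma smooth_conn c i r s : atlas c -> smooth (ccod c) (G c i r s).
Proof. by move=> ac; apply/smoothE; exact: conn_smooth. Qed.

Lemma smooth_op c i j : atlas c -> smooth (ccod c) (A c i j).
Proof. by move=> ac; apply/smoothE; exact: op_smooth. Qed.

Lemma lie_derivative_opE X c i j y :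
  lie_derivative_op A X c i j y = lie_op c y (X c y) (Dmx (X c) y) i j.
Proof.
rewrite /lie_derivative_op /lie_op pdE !addmxE oppmxE !mxE summxE big_split sumrB /=.
by congr (_ - _ + _); apply: eq_bigr => k _; rewrite !mxE //; congr (_ * pd _ _ y);
  apply/funext => z; rewrite mxE.
Qed.

Lemma affine_equationE X c i r s y : affine_equation G X c i r s y <->
  mpd r (Dmx (X c)) y i s = afflin (G c) r y (X c y) (Dmx (X c) y) i s.
Proof.
rewrite /affine_equation pdE.
have -> : mpd r (Dmx (X c)) y i s = pd r (pd s (vcoord X c i)) y.
  by rewrite mxE; congr (pd r _ y); apply/funext => z; rewrite mxE.
have -> : afflin (G c) r y (X c y) (Dmx (X c) y) i s =
  \sum_k pd k (vcoord X c i) y * G c k r s y - \sum_k G c i r k y * pd s (vcoord X c k) y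
  - \sum_k pd k (G c i r s) y * vcoord X c k y - \sum_k G c i k s y * pd r (vcoord X c k) y.
  rewrite /afflin !addmxE !oppmxE !summxE; congr (_ - _ - _ - _).
  - by rewrite mxE; apply: eq_bigr => k _; rewrite !mxE.
  - by rewrite mxE; apply: eq_bigr => k _; rewrite !mxE.
  - apply: eq_bigr => k _; rewrite !mxE mulrC; congr (pd k _ y * _).
    by apply/funext => z; rewrite mxE.
  - by apply: eq_bigr => k _; rewrite !mxE mulrC.
by rewrite !big_split /=; split => [|->]; [move=> ->|]; ring.
Qed.

Definition vfield_law X : Prop :=
  (forall c d, atlas c -> atlas d -> forall y, overlap c d y -> forall i,
     vcoord X d i (transition c d y) = \sum_k jac c d i k y * vcoord X c k y) /\
  (forall c y, ~ (atlas c /\ ccod c y) -> X c y = 0).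

Lemma point_symmetryP X : point_symmetry A G X <->
  vfield_law X /\ forall c, atlas c -> affine_field (ccod c) (G c) (X c) /\
     forall y, ccod c y -> lie_op c y (X c y) (Dmx (X c) y) = 0.
Proof.
split=> [[[sX tX zX] H]|[[tX zX] H]].
  split=> // c ac; split; last first.
    move=> y cy; apply/matrixP => i j; rewrite -lie_derivative_opE mxE.
    by have [-> ] := H c ac y cy.
  split; first by move=> i; apply/smoothE; exact: sX.
  move=> y cy r; apply/matrixP => i s; apply/affine_equationE.
  by have [_] := H c ac y cy; apply.
split; first by split=> // c i ac; apply/smoothE; have [[sX _] _] := H c ac; exact: sX.
move=> c ac y cy; have [[_ aX] lX] := H c ac; split=> [i j|i r s].
  by rewrite lie_derivative_opE lX // mxE.
by apply/affine_equationE; rewrite aX.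
Qed.

Lemma Dmx_lin (U : set 'rV[R]_n) (a : R) (e f : 'rV[R]_n -> 'rV[R]_n) y : open U -> U y ->
  smooth_map U e -> smooth_map U f ->
  Dmx (fun y => a *: e y + f y) y = a *: Dmx e y + Dmx f y.
Proof.
move=> oU Uy se sf; apply/matrixP => i s; rewrite !mxE.
have sae := smoothM oU (smooth_cst U a) (se i).
rewrite -(pdZ a s (se i) Uy) -(pdD s sae (sf i) Uy).
by congr (pd s _ y); apply/funext => z; rewrite !mxE.
Qed.

Lemma lie_op_lin c y (a : R) v w P Q :
  lie_op c y (a *: v + w) (a *: P + Q) = a *: lie_op c y v P + lie_op c y w Q.
Proof.
rewrite /lie_op mulmxDl mulmxDr -scalemxAl -scalemxAr !scalerDr scalerN.
have -> : \sum_k (a *: v + w) 0 k *: mpd k (opmx c) y =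
    a *: (\sum_k v 0 k *: mpd k (opmx c) y) + \sum_k w 0 k *: mpd k (opmx c) y.
  rewrite scaler_sumr -big_split; apply: eq_bigr => k _.
  by rewrite !mxE scalerDl scalerA.
by apply/matrixP => i j; rewrite !(addmxE, oppmxE); lra.
Qed.

Lemma point_symmetry_lin (a : R) X Y : point_symmetry A G X -> point_symmetry A G Y ->
  point_symmetry A G (a *: X + Y).
Proof.
move=> /point_symmetryP[[tX zX] HX] /point_symmetryP[[tY zY] HY].
have E c : (a *: X + Y) c = (fun y => a *: X c y + Y c y) by [].
apply/point_symmetryP; split; first split.
- move=> c d ac ad y cdy i; rewrite /vcoord !E !mxE.
  rewrite [X d _ 0 i](tX c d) // [Y d _ 0 i](tY c d) // mulr_sumr -big_split /=.
  by apply: eq_bigr => k _; rewrite /vcoord !mxE; ring.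
- by move=> c y ncy; rewrite E zX // zY // scaler0 addr0.
move=> c ac; have [[sX aX] lX] := HX c ac; have [[sY aY] lY] := HY c ac.
have oc := @ccod_open _ _ _ c.
rewrite E; split; last first.
  by move=> y cy; rewrite (Dmx_lin _ oc) // lie_op_lin lX // lY // scaler0 addr0.
split.
  move=> i; apply: (smooth_eq (f := fun y => a * X c y 0 i + Y c y 0 i)) => //.
    by move=> y _; rewrite !mxE.
  by apply: smoothD => //; apply: smoothM => //; exact: smooth_cst.
move=> y cy r; rewrite -[RHS]/(afflin (G c) r y _ _) (Dmx_lin _ oc) // afflinD afflinZ.
have -> : mpd r (Dmx (fun y => a *: X c y + Y c y)) y =
    a *: mpd r (Dmx (X c)) y + mpd r (Dmx (Y c)) y.
  rewrite (mpd_eq oc r cy (fun z cz => Dmx_lin a oc cz sX sY)).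
  have sDX := msmooth_Dmx sX; have sDY := msmooth_Dmx sY.
  rewrite (mpdD r (msmoothZ oc (smooth_cst _ a) sDX) sDY cy).
  by rewrite (mpdZ r (smooth_cst _ a) sDX cy) pd_cst scale0r add0r.
by rewrite aX // aY.
Qed.

Lemma point_symmetry0 : point_symmetry A G 0.
Proof.
have D0 y : Dmx (fun=> 0 : 'rV[R]_n) y = 0 :> 'M[R]_n.
  by apply/matrixP => i s; rewrite !mxE pd_cst.
have E c : (0 : vfield M) c = (fun=> 0) by [].
apply/point_symmetryP; split; first split.
- move=> c d ac ad y cdy i; rewrite /vcoord !E mxE big1 // => k _.
  by rewrite mxE mulr0.
- by move=> c y _; rewrite E.
move=> c ac; rewrite E; split; last first.
  move=> y cy; rewrite D0 -(scale0r 0) -[X in lie_op _ _ _ X](scale0r (0 : 'M[R]_n)).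
  rewrite /lie_op !scale0r mul0mx mulmx0 subr0 addr0 big1 // => k _.
  by rewrite mxE scale0r.
split.
  move=> i; rewrite (_ : (fun z => _) = fun=> 0); first exact: smooth_cst.
  by apply/funext => z; rewrite mxE.
move=> y cy r; have -> : Dmx (fun=> 0 : 'rV[R]_n) = fun=> 0 by apply/funext.
rewrite mpd_cst mul0mx mulmx0 subr0 !big1 ?subr0 // => k _; rewrite mxE scale0r //.
Qed.

Lemma point_symmetry_sum N (e : 'I_N -> vfield M) (a : 'rV[R]_N) :
  (forall k, point_symmetry A G (e k)) ->
  point_symmetry A G (\sum_k a 0 k *: e k).
Proof.
move=> He; elim: (index_enum _) => [|k s IH].
  by rewrite big_nil; exact: point_symmetry0.
by rewrite big_cons; exact: point_symmetry_lin.
Qed.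

Lemma vfield_overlap X c d y : vfield_law X -> atlas c -> atlas d -> overlap c d y ->
  X d (transition c d y) = 0 -> X c y = 0.
Proof.
move=> [tX _] ac ad [cy dy] X0; apply/rowP => i; rewrite mxE.
have o : overlap d c (transition c d y).
  split; first exact: cfwd_sub.
  by rewrite /transition /= cfwdK //; exact: cbwd_sub.
have := tX d c ad ac _ o i.
rewrite /transition /= cfwdK // cbwdK // => E; rewrite -[LHS]/(vcoord X c i y) E big1 // => k _.
by rewrite /vcoord X0 mxE mulr0.
Qed.

Lemma transition_continuous c d y : overlap c d y -> {for y, continuous (transition c d)}.
Proof.
move=> [cy dy]; apply: continuous_comp; first exact: cbwd_cont.
exact: cfwd_cont.
Qed.

(** The set of points near which X vanishes is open by definition, closed by uniform local
    uniqueness, and nonempty; connectedness makes it all of M. *)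
Lemma point_symmetry_jet0 X c0 y0 : connected [set: M] -> point_symmetry A G X ->
  atlas c0 -> ccod c0 y0 -> X c0 y0 = 0 -> Dmx (X c0) y0 = 0 -> X = 0.
Proof.
move=> hM /point_symmetryP[lX HX] ac0 cy0 X0 D0.
pose Z : set M := [set x | exists c, [/\ atlas c, cdom c x &
  \forall y \near cfwd c x, X c y = 0]].
have uniq c p : atlas c -> ccod c p -> exists2 r : R, 0 < r & ball p r `<=` ccod c /\
    forall q z, ball p r q -> ball p r z -> X c q = 0 -> Dmx (X c) q = 0 -> X c z = 0.
  move=> ac cp; have [affX _] := HX c ac.
  have sG i r s := smooth_conn i r s ac.
  exact: (affine_jet_unique (@ccod_open _ _ _ c) sG cp affX).
have oZ : open Z.
  rewrite openE => x [c1 [ac cx nx]]; rewrite /interior.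
  have : \forall x' \near x, cdom c1 x' /\ \forall y \near cfwd c1 x', X c1 y = 0.
    apply: filterI; first by apply: open_nbhs_nbhs; split => //; exact: cdom_open.
    exact: (cfwd_cont cx (near_join nx)).
  by apply: filterS => x' [cx' nx']; exists c1.
(* The uniqueness ball around a limit point x contains a point of [Z] near which X vanishes. Its jet
   there is zero, and uniqueness may start from any point of the ball, so X vanishes around x. *)
have cZ : closed Z.
  move=> x clx; have [c ac cx] := atlas_cover x.
  have [r r0 [rc H]] := uniq c (cfwd c x) ac (cfwd_sub cx).
  have nO : nbhs x (cdom c `&` cfwd c @^-1` ball (cfwd c x) r).
    apply: filterI; first by apply: open_nbhs_nbhs; split => //; exact: cdom_open.
    by apply: (cfwd_cont cx); exact: nbhsx_ballx.
  have [x' [[d [ad dx' nx']] [cx' bx']]] := clx _ nO.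
  have Xc : \forall y \near cfwd c x', X c y = 0.
    have o : overlap c d (cfwd c x').
      by split; [exact: cfwd_sub|rewrite /= cfwdK].
    have no : \forall y \near cfwd c x', overlap c d y.
      by apply: open_nbhs_nbhs; split => //; exact: overlap_open.
    have tE : transition c d (cfwd c x') = cfwd d x' by rewrite /transition /= cfwdK.
    have nt : \forall y \near cfwd c x', X d (transition c d y) = 0.
      have ct : transition c d @ (cfwd c x') --> cfwd d x'.
        by rewrite -tE; exact: transition_continuous.
      exact: (ct _ nx').
    by apply: filterS2 no nt => y oy ty; exact: vfield_overlap ty.
  exists c; split => //.
  apply: filterS (nbhsx_ballx _ _ r0) => y by_.
  apply: (H (cfwd c x')) => //; first exact: (nbhs_singleton Xc).
  apply/matrixP => i s; rewrite !mxE -partialE.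
  rewrite (near_eq_derive (g := fun=> 0)) ?derive_cst //.
  by apply: filterS Xc => z ->; rewrite mxE.
have Z0 : Z (cbwd c0 y0).
  exists c0; split => //; first exact: cbwd_sub.
  rewrite cbwdK //; have [r r0 [rc H]] := uniq c0 y0 ac0 cy0.
  apply: filterS (nbhsx_ballx _ _ r0) => y by_.
  by apply: (H y0) => //; exact: ballxx.
have ZT : Z = setT.
  apply: hM; first by exists (cbwd c0 y0).
    by exists Z; rewrite ?setTI.
  by exists Z; rewrite ?setTI.
apply/funext => c; apply/funext => y.
have [[ac cy]|ncy] := pselect (atlas c /\ ccod c y); last by have [_ ->] := lX.
have [d [ad dx nx]] : Z (cbwd c y) by rewrite ZT.
apply: (vfield_overlap lX ac ad); first by split.
exact: (nbhs_singleton nx).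
Qed.

Definition symric c y : 'M[R]_n := 2^-1 *: (ric (G c) y + (ric (G c) y)^T).

Lemma ricciE c i j y : ricci G c i j y = ric (G c) y i j.
Proof.
rewrite mxE; apply: eq_bigr => k _; rewrite /curvature pdE /crv !addmxE !oppmxE.
rewrite ![mpd _ _ _ _ _]mxE big_split sumrN /=; congr (_ - _ + (_ - _)).
- by congr (pd _ _ y); apply/funext => z; rewrite mxE.
- by congr (pd _ _ y); apply/funext => z; rewrite mxE.
- by rewrite mxE; apply: eq_bigr => q _; rewrite !mxE mulrC.
- by rewrite mxE; apply: eq_bigr => q _; rewrite !mxE mulrC.
Qed.

Lemma sym_ricciE c y : sym_ricci G c y = symric c y.
Proof. by apply/matrixP => i j; rewrite mxE !ricciE !mxE mulrC. Qed.

Lemma symric_sym c y : (symric c y)^T = symric c y.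
Proof. by apply/matrixP => i j; rewrite !mxE addrC. Qed.

Lemma msmooth_symric c : atlas c -> msmooth (ccod c) (symric c).
Proof.
move=> ac; have oc := @ccod_open _ _ _ c.
have sr : msmooth (ccod c) (ric (G c)).
  by apply: msmooth_ric => // i r s; exact: smooth_conn.
apply: (msmoothZ oc); first exact: smooth_cst.
by apply: msmoothD => //; exact: msmooth_tr.
Qed.

Lemma lie_symric c eta : atlas c -> affine_field (ccod c) (G c) eta ->
  forall y, ccod c y -> \sum_k eta y 0 k *: mpd k (symric c) y
   + (Dmx eta y)^T *m symric c y + symric c y *m Dmx eta y = 0.
Proof.
move=> ac aff y cy; have oc := @ccod_open _ _ _ c.
have sG i r s := smooth_conn i r s ac.
have sr : msmooth (ccod c) (ric (G c)) by exact: msmooth_ric.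
have H := lie_ricci oc sG aff cy.
have HT := congr1 trmx H.
rewrite trmx0 !linearD /= !trmx_mul trmxK raddf_sum /= in HT.
rewrite /symric.
have -> : \sum_k eta y 0 k *: mpd k (fun y => 2^-1 *: (ric (G c) y + (ric (G c) y)^T)) y =
   2^-1 *: (\sum_k eta y 0 k *: mpd k (ric (G c)) y + \sum_k (eta y 0 k *: mpd k (ric (G c)) y)^T).
  rewrite -big_split scaler_sumr /=; apply: eq_bigr => k _.
  rewrite (mpdZ k (smooth_cst _ _) (msmoothD oc sr (msmooth_tr sr)) cy) pd_cst scale0r add0r.
  rewrite (mpdD k sr (msmooth_tr sr) cy) mpd_tr !scalerDr !scalerA mulrC; congr (_ + _).
  by apply/matrixP => i j; rewrite !mxE; ring.
rewrite -scalemxAr -scalemxAl -!scalerDr mulmxDr mulmxDl.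
apply/matrixP => i j; rewrite [RHS]mxE scalmxE.
move/matrixP/(_ i j): H; move/matrixP/(_ i j): HT.
rewrite ![(0 : 'M[R]_n) i j]mxE => HT H.
suff -> : forall a : R, a = 0 -> 2^-1 * a = 0 => //.
  by rewrite !addmxE in H HT *; lra.
by move=> a ->; rewrite mulr0.
Qed.

Hypothesis hM : connected [set: M].
Hypothesis hn : (2 <= n)%N.
Variable m : nat.
Hypothesis hmn : (m <= n)%N.
Hypothesis hdeg : intermediate_degeneration G m.
Hypothesis hdim : has_dim (point_symmetry A G) (n * (n + 1 - m) + (m * (m - 1))./2)%N.

(** The jets at [q] of a basis of symmetries are independent by unique continuation and satisfy the
    constraint L S = 0; their number is the dimension of the space of allowed jets. The first claim
    is infinitesimal transitivity. *)
Lemma symmetry_jets c q : atlas c -> ccod c q ->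
  (forall v : 'rV[R]_n, exists X, point_symmetry A G X /\ X c q = v) /\
  forall (v : 'rV[R]_n) (P : 'M[R]_n),
  \sum_k v 0 k *: mpd k (symric c) q + P^T *m symric c q + symric c q *m P = 0 ->
  exists X, [/\ point_symmetry A G X, X c q = v & Dmx (X c) q = P].
Proof.
move=> ac cq; have oc := @ccod_open _ _ _ c.
have [e [He Hu]] := hdim.
have rk : \rank (symric c q) = m by rewrite -sym_ricciE; have [_ ->] := hdeg.
have affe k : affine_field (ccod c) (G c) (e k c).
  by have /point_symmetryP[_ H] := He k; have [] := H c ac.
pose comb (a : 'rV[R]_(n * (n + 1 - m) + (m * (m - 1))./2)) := \sum_k a 0 k *: e k.
have combE a : comb a c q = \sum_k a 0 k *: e k c q.
  rewrite /comb; elim: (index_enum _) => [|k s IH]; first by rewrite !big_nil.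
  by rewrite !big_cons -IH.
have DcombE a : Dmx (comb a c) q = \sum_k a 0 k *: Dmx (e k c) q.
  apply/matrixP => i s; rewrite mxE summxE.
  have -> : (fun z => comb a c z 0 i) = fun z => \sum_k a 0 k * e k c z 0 i.
    apply/funext => z; rewrite /comb; elim: (index_enum _) => [|k t IH].
      by rewrite !big_nil mxE.
    by rewrite !big_cons -IH [LHS]mxE [X in X + _]mxE.
  rewrite (pd_sum oc) //; last first.
    by move=> k; apply: (smoothM oc); [exact: smooth_cst|have [H _] := affe k; exact: H].
  apply: eq_bigr => k _; rewrite [RHS]mxE [Dmx _ _ _ _]mxE (pdZ (U := ccod c)) //.
  by have [H _] := affe k; exact: H.
have [|k|T1 T2] := @jets_fill R n m (symric c q) hmn rk _ (fun k => e k c q)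
  (fun k => Dmx (e k c) q) (fun k => mpd k (symric c) q) (symric_sym c q) erefl _ _.
- move=> a; rewrite -combE -DcombE => v0 P0.
  have c0 : comb a = 0.
    exact: (point_symmetry_jet0 hM (point_symmetry_sum a He) ac cq).
  (* Linear independence of [e] is the uniqueness of the coordinates of the zero field. *)
  have [b [_ Hb]] := Hu 0 point_symmetry0.
  rewrite -(Hb a) -?[RHS](Hb 0) //.
  by rewrite big1 // => k _; rewrite mxE scale0r.
- exact: lie_symric.
split=> [v|v P con].
  by have [a Ea] := T1 v; exists (comb a); rewrite combE; split; [exact: point_symmetry_sum|].
have [a [Ea1 Ea2]] := T2 v P con.
by exists (comb a); split; [exact: point_symmetry_sum|rewrite combE|rewrite DcombE].
Qed.

End PointSymmetries.

(** * Projectively flat coordinates *)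

Section FlatField.
Context {R : realType} {n : nat}.
Hypothesis hn : (2 <= n)%N.
Variables (p : 'rV[R]_n) (rho : R).
Hypothesis rho0 : 0 < rho.
Let B := ball p rho.
Let oB : open B := @ball_open R _ p rho.
Let Bp : B p := ballxx p rho0.
Variable Gam : 'I_n -> 'I_n -> 'I_n -> 'rV[R]_n -> R.
Variable al : 'rV[R]_n -> 'rV[R]_n.
Hypothesis sal : smooth_map B al.
Hypothesis GamE : forall y, B y -> forall i r s,
  Gam i r s y = al y 0 r * (i == s)%:R + al y 0 s * (i == r)%:R.

Lemma sum_delta (f : 'I_n -> R) s : \sum_k f k * (k == s)%:R = f s.
Proof.
rewrite (bigD1 s) //= eqxx mulr1 big1 ?addr0 // => k ks.
by rewrite (negbTE ks) mulr0.
Qed.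

Lemma sum_delta' (f : 'I_n -> R) s : \sum_k f k * (s == k)%:R = f s.
Proof. by rewrite -[RHS]sum_delta; apply: eq_bigr => k _; rewrite eq_sym. Qed.

Lemma flat_pd y i r s k : B y -> pd k (Gam i r s) y =
  pd k (fun z => al z 0 r) y * (i == s)%:R + pd k (fun z => al z 0 s) y * (i == r)%:R.
Proof.
move=> By; rewrite (pd_eq k oB By (fun z Bz => GamE Bz i r s)).
have sc (b : bool) j : smooth B (fun y => al y 0 j * b%:R).
  by apply: (smoothM oB) => //; exact: smooth_cst.
rewrite (pdD k (sc _ r) (sc _ s) By).
by rewrite !(pdM k (sal _) (smooth_cst _ _) By) !pd_cst !mulr0 !add0r.
Qed.

(** The component [r] of the Lie derivative of alpha along zeta. *)
Definition drift (zeta : 'rV[R]_n -> 'rV[R]_n) r y : R :=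
  \sum_k zeta y 0 k * pd k (fun z => al z 0 r) y + \sum_k al y 0 k * Dmx zeta y k r.

(** The identity tensor is invariant under every field, so the Lie derivative of the connection
    consists of the second derivatives of zeta and of the Lie derivative of alpha. *)
Lemma flat_afflin zeta y r i s : affine_field B Gam zeta -> B y ->
  pd r (fun z => Dmx zeta z i s) y =
  - (drift zeta r y * (i == s)%:R + drift zeta s y * (i == r)%:R).
Proof.
move=> [_ aff] By; have -> : pd r (fun z => Dmx zeta z i s) y = mpd r (Dmx zeta) y i s.
  by rewrite mxE.
rewrite aff // !addmxE !oppmxE !summxE /drift; move: (Dmx zeta y) => P.
have -> : (P *m chris Gam r y) i s = P i s * al y 0 r + P i r * al y 0 s.
  rewrite mxE (eq_bigr (fun k => (P i k * al y 0 r) * (k == s)%:R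
     + (P i k * al y 0 s) * (k == r)%:R)); last first.
    by move=> k _; rewrite mxE GamE //; ring.
  by rewrite big_split /= !sum_delta.
have -> : (chris Gam r y *m P) i s = al y 0 r * P i s + (\sum_k al y 0 k * P k s) * (i == r)%:R.
  rewrite mxE (eq_bigr (fun k => (al y 0 r * P k s) * (i == k)%:R
     + (al y 0 k * P k s) * (i == r)%:R)); last first.
    by move=> k _; rewrite mxE GamE //; ring.
  by rewrite big_split /= sum_delta' mulr_suml.
have -> : \sum_k (zeta y 0 k *: mpd k (chris Gam r) y) i s =
  (\sum_k zeta y 0 k * pd k (fun z => al z 0 r) y) * (i == s)%:R +
  (\sum_k zeta y 0 k * pd k (fun z => al z 0 s) y) * (i == r)%:R.
  rewrite !mulr_suml -big_split; apply: eq_bigr => k _ /=.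
  rewrite scalmxE mxE (_ : (fun z => _) = Gam i r s); last first.
    by apply/funext => z; rewrite mxE.
  by rewrite flat_pd //; ring.
have -> : \sum_k (P k r *: chris Gam k y) i s =
  (\sum_k al y 0 k * P k r) * (i == s)%:R + al y 0 s * P i r.
  rewrite (eq_bigr (fun k => (al y 0 k * P k r) * (i == s)%:R
     + (al y 0 s * P k r) * (i == k)%:R)); last first.
    by move=> k _; rewrite scalmxE mxE GamE //; ring.
  by rewrite big_split /= sum_delta' mulr_suml.
ring.
Qed.

Lemma pd_const_ball f q : (forall y, B y -> forall k, pd k f y = 0) -> smooth B f ->
  B q -> f q = f p.
Proof.
move=> f0 sf Bq; have [c Bc E] := mean_value_ball sf Bp Bq.
apply/eqP; rewrite -subr_eq0 E big1 // => k _; by rewrite f0 ?mulr0.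
Qed.

(** Put b = L_zeta alpha. Since the second derivatives of zeta are expressed by b and Kronecker
    symbols, symmetry of the third derivatives forces db = 0. Thus b is constant, and zero because
    the second derivatives vanish at [p]. *)
Lemma flat_field zeta : affine_field B Gam zeta ->
    (forall r i s, pd r (fun z => Dmx zeta z i s) p = 0) ->
  forall y, B y -> forall r, drift zeta r y = 0 /\
    forall i s, pd r (fun z => Dmx zeta z i s) y = 0.
Proof.
move=> aff H0.
have [sz _] := aff; have sP := msmooth_Dmx sz.
pose b := drift zeta.
have sb r : smooth B (b r).
  apply: smoothD => //; apply: smooth_sum => // k _; apply: (smoothM oB) => //.
  by apply: smooth_pd; exact: sal.
have E y r i s : B y -> pd r (fun z => Dmx zeta z i s) y =
    - (b r y * (i == s)%:R + b s y * (i == r)%:R) by exact: flat_afflin.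
have comm3 y t r i s : B y -> pd t (pd r (fun z => Dmx zeta z i s)) y =
    pd r (pd t (fun z => Dmx zeta z i s)) y.
  by move=> By; exact: (pd_comm oB t r (sP i s) By).
have pE y t r i s : B y -> pd t (pd r (fun z => Dmx zeta z i s)) y =
    - (pd t (b r) y * (i == s)%:R + pd t (b s) y * (i == r)%:R).
  move=> By; rewrite (pd_eq t oB By (fun z Bz => E z r i s Bz)).
  have sc (c : bool) j : smooth B (fun y => b j y * c%:R).
    by apply: (smoothM oB) => //; exact: smooth_cst.
  rewrite (pdN t (smoothD oB (sc _ r) (sc _ s)) By) (pdD t (sc _ r) (sc _ s) By).
  by rewrite !(pdM t (sb _) (smooth_cst _ _) By) !pd_cst !mulr0 !add0r.
(* For t = i an auxiliary index u != i isolates the derivative; for t != i two choices of indices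
   say that each of the derivatives of b_i along t and of b_t along i is twice the other. *)
have db y t i : B y -> pd t (b i) y = 0.
  move=> By; have [->|ti] := eqVneq t i.
    have [u ui] := exists_neq hn i.
    have := comm3 y u i u i By; rewrite !pE // !eqxx (negbTE ui) !mulr1 !mulr0.
    by rewrite !addr0 !add0r oppr0 => /esym/eqP; rewrite oppr_eq0 => /eqP.
  have it : i != t by rewrite eq_sym.
  have := comm3 y t i i i By; have := comm3 y i t t t By.
  rewrite !pE // !eqxx (negbTE ti) (negbTE it) !mulr1 !mulr0 !addr0; lra.
have b0 y i : B y -> b i y = 0.
  move=> By; rewrite (pd_const_ball (fun z Bz t => db z t i Bz) (sb i) By).
  have [u ui] := exists_neq hn i.
  have := E p i u u Bp; rewrite H0 eqxx (negbTE ui) mulr1 mulr0 addr0.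
  by move/esym/eqP; rewrite oppr_eq0 => /eqP.
move=> y By r; split; first exact: b0.
by move=> i s; rewrite E // !b0 // !mul0r addr0 oppr0.
Qed.

Hypothesis alp : al p = 0.

Lemma flat_chris_center r : chris Gam r p = 0.
Proof. by apply/matrixP => i s; rewrite !mxE GamE // alp !mxE !mul0r addr0. Qed.

Lemma flat_ric_center i j : ric Gam p i j =
  pd i (fun z => al z 0 j) p - n%:R * pd j (fun z => al z 0 i) p.
Proof.
rewrite mxE (eq_bigr (fun k => (pd k (fun z => al z 0 j) p * (k == i)%:R
   + pd k (fun z => al z 0 i) p * (k == j)%:R)
   - (pd j (fun z => al z 0 k) p * (k == i)%:R + pd j (fun z => al z 0 i) p))); last first.
  move=> k _; rewrite /crv !flat_chris_center !mul0mx subrr addr0 addmxE oppmxE !mxE.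
  have cE a b c : (fun z => chris Gam a z b c) = Gam b a c.
    by apply/funext => z; rewrite mxE.
  by rewrite !cE !flat_pd // eqxx mulr1.
rewrite sumrB !big_split /= !sum_delta sumr_const card_ord -[_ *+ _]mulr_natl; ring.
Qed.

Variable w : 'rV[R]_n.
Hypothesis wric : w *m ric Gam p = 0.
Hypothesis wricT : w *m (ric Gam p)^T = 0.

(** Contracting [w] with either slot of the Ricci tensor at the centre gives X = n Y and Y = n X for
    the two contractions of d alpha, hence (n^2 - 1) X = 0. *)
Lemma flat_kernel_derivative r : \sum_k w 0 k * pd k (fun z => al z 0 r) p = 0.
Proof.
set X := fun j => \sum_k w 0 k * pd k (fun z => al z 0 j) p.
pose Y j := \sum_k w 0 k * pd j (fun z => al z 0 k) p.
have XY j : X j = n%:R * Y j.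
  have /rowP /(_ j) := wric; rewrite !mxE => H.
  apply/eqP; rewrite -subr_eq0 -[X in _ == X]H /X /Y mulr_sumr -sumrB; apply/eqP.
  by apply: eq_bigr => k _; rewrite flat_ric_center; ring.
have YX j : Y j = n%:R * X j.
  have /rowP /(_ j) := wricT; rewrite !mxE => H.
  apply/eqP; rewrite -subr_eq0 -[X in _ == X]H /X /Y mulr_sumr -sumrB; apply/eqP.
  by apply: eq_bigr => k _; rewrite [_^T _ _]mxE flat_ric_center; ring.
have : X r * (n%:R * n%:R - 1) = 0 by have := XY r; rewrite YX; lra.
move/eqP; rewrite mulf_eq0 => /orP[/eqP //|].
rewrite -natrM -[1]/(1%:R) subr_eq0 eqr_nat => /eqP nn.
by have := leq_mul hn hn; rewrite nn.
Qed.

Lemma flat_derivative_center zeta r i s : affine_field B Gam zeta ->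
    zeta p = w /\ Dmx zeta p = 0 \/ zeta p = 0 ->
  pd r (fun z => Dmx zeta z i s) p = 0.
Proof.
move=> aff H; rewrite flat_afflin // /drift alp.
have Z j : \sum_k (0 : 'rV[R]_n) 0 k * Dmx zeta p k j = 0.
  by rewrite big1 // => k _; rewrite mxE mul0r.
rewrite !Z !addr0; case: H => [[zw _]|z0].
  by rewrite zw !flat_kernel_derivative !mul0r addr0 oppr0.
by rewrite z0 !big1 ?mul0r ?addr0 ?oppr0 // => k _; rewrite mxE mul0r.
Qed.

Hypothesis translation : exists zeta, [/\ affine_field B Gam zeta, zeta p = w & Dmx zeta p = 0].

(** The field with jet (w, 0) has vanishing second derivatives, so it is the constant field [w], and
    its Lie derivative of alpha is the derivative of alpha along [w]. *)
Lemma flat_kernel_invariant y r : B y -> \sum_k w 0 k * pd k (fun z => al z 0 r) y = 0.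
Proof.
move=> By; have [zeta [aff zw D0]] := translation.
have [sz _] := aff; have sP := msmooth_Dmx sz.
have H := flat_field aff (fun r i s => flat_derivative_center r i s aff (or_introl (conj zw D0))).
have P0 z : B z -> Dmx zeta z = 0.
  move=> Bz; apply/matrixP => i s; rewrite [RHS]mxE.
  rewrite (@pd_const_ball (fun z => Dmx zeta z i s) z) // ?D0 ?mxE //.
  by move=> x Bx k; have [_] := H x Bx k; apply.
have zE z : B z -> zeta z = w.
  move=> Bz; apply/rowP => i; rewrite -zw (@pd_const_ball (fun z => zeta z 0 i) z) //.
  by move=> x Bx k; have /matrixP /(_ i k) := P0 x Bx; rewrite !mxE.
have [] := H y By r; rewrite /drift P0 // zE // => + _.
rewrite [X in _ + X]big1 ?addr0 // => k _; by rewrite mxE mulr0.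
Qed.

Hypothesis shears : forall xi : 'rV[R]_n,
  exists zeta, [/\ affine_field B Gam zeta, zeta p = 0 & Dmx zeta p = w^T *m xi].

(** The field with jet (0, w (x) e_r) is (y_r - p_r) w, so the component r of L alpha is alpha(w)
    plus a multiple of the derivative along [w], already known to vanish. One index r suffices. *)
Lemma flat_kernel_form y : B y -> \sum_k al y 0 k * w 0 k = 0.
Proof.
move=> By; pose r : 'I_n := Ordinal hn.
have [zeta [aff z0 D0]] := shears (delta_mx 0 r).
have [sz _] := aff; have sP := msmooth_Dmx sz.
have H := flat_field aff (fun r i s => flat_derivative_center r i s aff (or_intror z0)).
have PE z : B z -> Dmx zeta z = w^T *m (delta_mx 0 r : 'rV[R]_n).
  move=> Bz; apply/matrixP => i s.
  rewrite (@pd_const_ball (fun z => Dmx zeta z i s) z) // ?D0 //.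
  by move=> x Bx k; have [_] := H x Bx k; apply.
have zE z i : B z -> zeta z 0 i = w 0 i * (z 0 r - p 0 r).
  move=> Bz; apply/eqP; rewrite -subr_eq0; apply/eqP.
  have sl : smooth B (fun z => w 0 i * (z 0 r - p 0 r)).
    apply: (smoothM oB); first exact: smooth_cst.
    apply: smoothB => //; [exact: smooth_coord|exact: smooth_cst].
  rewrite (@pd_const_ball (fun z => zeta z 0 i - w 0 i * (z 0 r - p 0 r)) z) //.
  - by rewrite z0 mxE subrr mulr0 subr0.
  - move=> x Bx k; rewrite (pdB oB k (sz i) sl Bx).
    have -> : pd k (fun z => zeta z 0 i) x = Dmx zeta x i k by rewrite mxE.
    rewrite PE // outer_mxE [w^T i 0]mxE [delta_mx _ _ _ _]mxE eqxx /=.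
    rewrite (pdZ (U := B)) //; last first.
      by apply: smoothB => //; [exact: smooth_coord|exact: smooth_cst].
    rewrite (pdB oB k (smooth_coord B r) (smooth_cst B (p 0 r)) Bx) pd_coord pd_cst.
    by rewrite subr0 [k == r]eq_sym subrr.
  - by apply: smoothB.
have [] := H y By r; rewrite /drift PE // => + _.
rewrite (eq_bigr (fun k => (y 0 r - p 0 r) * (w 0 k * pd k (fun z => al z 0 r) y))); last first.
  by move=> k _; rewrite zE //; ring.
rewrite -mulr_sumr flat_kernel_invariant // mulr0 add0r => E; rewrite -[RHS]E.
apply: eq_bigr => k _; rewrite outer_mxE [w^T k 0]mxE [delta_mx _ _ _ _]mxE !eqxx /=.
by rewrite mulr1.
Qed.

End FlatField.

(** * Projectively flat charts; the operator field is a constant scalar *)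

Section AdaptedCharts.
Context {R : realType} {n : nat} {M : smoothManifold R n}.
Hypothesis hn : (2 <= n)%N.
Variables (A : operatorField M) (G : symmetricConnection M).
Implicit Types (c d : chart R n M).

Definition projectively_flat c (al : 'rV[R]_n -> 'rV[R]_n) : Prop :=
  smooth_map (ccod c) al /\ forall z, ccod c z -> forall i r s,
    G c i r s z = al z 0 r * (i == s)%:R + al z 0 s * (i == r)%:R.

(** Alpha is itself a connection coefficient, Gamma^i_ri with i != r, and inherits its
    smoothness. *)
Lemma projectively_flat_smooth c (al : 'rV[R]_n -> 'rV[R]_n) : atlas c ->
    (forall z, ccod c z -> forall i r s,
      G c i r s z = al z 0 r * (i == s)%:R + al z 0 s * (i == r)%:R) ->
  projectively_flat c al.
Proof.
move=> ac H; split => // r; have oc := @ccod_open _ _ _ c.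
have [i ir] := exists_neq hn r.
apply: (smooth_eq oc (f := G c i r i)); last exact: smooth_conn.
by move=> z cz; rewrite H // eqxx (negbTE ir) mulr1 mulr0 addr0.
Qed.

Lemma projectively_flat_chart c (V W : set 'rV[R]_n) (F H : 'rV[R]_n -> 'rV[R]_n)
    (al : 'rV[R]_n -> 'rV[R]_n) :
    atlas c -> open V -> V `<=` ccod c -> open W ->
    smooth_map V F -> smooth_map W H ->
    (forall y, V y -> W (F y) /\ H (F y) = y) ->
    (forall z, W z -> V (H z) /\ F (H z) = z) ->
    (forall y, V y -> jacobian_mx F y \in unitmx) ->
    (forall y, V y -> forall i r s, pd r (pd s (fun z => F z 0 i)) y =
       \sum_k pd k (fun z => F z 0 i) y * G c k r s y
       - (al y 0 r * pd s (fun z => F z 0 i) y + al y 0 s * pd r (fun z => F z 0 i) y)) ->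
  exists c', [/\ atlas c', ccod c' = W,
    (forall x, cdom c x -> V (cfwd c x) -> cdom c' x), cfwd c' = F \o cfwd c &
    projectively_flat c' (fun z => al (H z) *m (invmx (jacobian_mx F (H z)))^T)].
Proof.
move=> ac oV Vc oW sF sH HF FH uJ HE.
have [c' [ac' cc' dc' fc' bc']] := diffeo_chart ac oV Vc oW sF sH HF FH.
have Vo : V `<=` overlap c c'.
  move=> y Vy; split; first exact: Vc.
  apply/dc'; split; first exact/cbwd_sub/Vc.
  by rewrite cbwdK //; exact: Vc.
have tF y : V y -> transition c c' y = F y.
  by move=> Vy; rewrite /transition fc' /= cbwdK //; exact: Vc.
exists c'; split => //; first by move=> x cx Vx; apply/dc'.
apply: projectively_flat_smooth => // z; rewrite cc' => Wz i r s.
have [VH FHz] := FH z Wz; rewrite -{1}FHz.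
exact: (projective_connection_transform ac ac' oV VH Vo tF sF (uJ _ VH) (HE _ VH)).
Qed.

Lemma kernel_vector (S : 'M[R]_n) : (\rank S < n)%N ->
  exists w : 'rV[R]_n, w != 0 /\ w *m S = 0.
Proof.
move=> rS; have : kermx S != 0 by rewrite -mxrank_eq0 mxrank_ker subn_eq0 -ltnNge.
by move/rowV0Pn => [w /sub_kermxP wS w0]; exists w.
Qed.

Hypothesis hM : connected [set: M].
Variable m : nat.
Hypothesis hmn : (m <= n)%N.
Hypothesis hdeg : intermediate_degeneration G m.
Hypothesis hdim : has_dim (point_symmetry A G) (n * (n + 1 - m) + (m * (m - 1))./2)%N.

Lemma rank_symric c q : atlas c -> ccod c q -> \rank (symric G c q) = m.
Proof. by move=> ac cq; rewrite -sym_ricciE; have [_ ->] := hdeg. Qed.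

Lemma ricci_kernel_vector c q : atlas c -> ccod c q ->
  exists w : 'rV[R]_n, w != 0 /\ w *m symric G c q = 0.
Proof.
move=> ac cq; apply: kernel_vector; rewrite rank_symric //.
have [/andP[_ mn] _] := hdeg; apply: leq_ltn_trans mn _.
by rewrite prednK // (leq_trans _ hn).
Qed.

Lemma affine_jets c q : atlas c -> ccod c q -> forall (v : 'rV[R]_n) (P : 'M[R]_n),
    \sum_k v 0 k *: mpd k (symric G c) q + P^T *m symric G c q + symric G c q *m P = 0 ->
  exists zeta, [/\ affine_field (ccod c) (G c) zeta, zeta q = v & Dmx zeta q = P].
Proof.
move=> ac cq v P con.
have [_ /(_ v P con)[X [/point_symmetryP[_ HX] Xv XP]]] := symmetry_jets hM hmn hdeg hdim ac cq.
by exists (X c); split => //; have [] := HX c ac.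
Qed.

(** At a zero of a symmetry, L A = 0 says that the derivative of the symmetry commutes with A. *)
Lemma op_scalar c q : atlas c -> ccod c q -> exists a, opmx A c q = a%:M.
Proof.
move=> ac cq; have [w [w0 wS]] := ricci_kernel_vector ac cq.
apply: (rank_one_commute w0) => xi.
have [_ jets] := symmetry_jets hM hmn hdeg hdim ac cq.
have Sw : symric G c q *m w^T = 0 by rewrite -[symric _ _ _]symric_sym -trmx_mul wS trmx0.
have [|X [/point_symmetryP[_ HX] Xv XP]] := jets 0 (w^T *m xi).
  rewrite big1 => [|k _]; last by rewrite mxE scale0r.
  by rewrite add0r trmx_mul trmxK -mulmxA wS mulmx0 mulmxA Sw mul0mx addr0.
have [_ /(_ q cq)] := HX c ac; rewrite /lie_op Xv XP big1 => [|k _]; last first.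
  by rewrite mxE scale0r.
by rewrite add0r addrC => /eqP; rewrite subr_eq0 => /eqP.
Qed.

(** For scalar A the commutator in L A = 0 disappears; what remains is the derivative along the
    symmetry, whose value at [q] can be any basis vector. *)
Lemma op_constant c q k : atlas c -> ccod c q -> mpd k (opmx A c) q = 0.
Proof.
move=> ac cq; have [a Ea] := op_scalar ac cq.
have [trans _] := symmetry_jets hM hmn hdeg hdim ac cq.
have [X [/point_symmetryP[_ HX] Xv]] := trans (delta_mx 0 k).
have [_ /(_ q cq)] := HX c ac; rewrite /lie_op Xv Ea scalar_mxC subrK.
rewrite (bigD1 k) //= big1 ?addr0 => [|j jk]; rewrite mxE eqxx /=.
  by rewrite eqxx scale1r.
by rewrite (negbTE jk) scale0r.
Qed.

Lemma op_ball c p rho : atlas c -> 0 < rho -> ccod c = ball p rho ->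
  exists a, forall y, ccod c y -> forall i j, A c i j y = a *+ (i == j).
Proof.
move=> ac rho0 cE; have cp : ccod c p by rewrite cE; exact: ballxx.
have [a Ea] := op_scalar ac cp; exists a => y cy i j.
have -> : A c i j y = A c i j p.
  apply/eqP; rewrite -subr_eq0; have sA := smooth_op A i j ac.
  rewrite cE in sA; have [|z] := mean_value_ball sA (ballxx p rho0) (z := y).
    by rewrite -cE.
  rewrite -cE => cz ->; apply/eqP; apply: big1 => k _.
  have E : (fun z => opmx A c z i j) = A c i j by apply/funext => u; rewrite mxE.
  by have /matrixP/(_ i j) := op_constant k ac cz; rewrite !mxE E => ->; rewrite mulr0.
by move/matrixP/(_ i j): Ea; rewrite !mxE.
Qed.

End AdaptedCharts.

(** * Construction of the coordinates *)

Section MaximalSymmetry.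
Context {R : realType} {n : nat} {M : smoothManifold R n}.
Hypothesis hn : (2 <= n)%N.
Variables (A : operatorField M) (G : symmetricConnection M).
Implicit Types (c d : chart R n M).
Hypothesis hM : connected [set: M].
Variable m : nat.
Hypothesis hmn : (m <= n)%N.
Hypothesis hdeg : intermediate_degeneration G m.
Hypothesis hdim : has_dim (point_symmetry A G) (n * (n + 1 - m) + (m * (m - 1))./2)%N.

(** The ratios f_l satisfy the equation required by [projective_connection_transform], so they serve
    as coordinates. That alpha vanishes at x makes the connection coefficients vanish there, on
    which the computations at the centre rely. *)
Lemma flat_chart (x : M) : exists c (al : 'rV[R]_n -> 'rV[R]_n),
  [/\ atlas c, cdom c x, projectively_flat G c al & al (cfwd c x) = 0].
Proof.
have [c ac cx] := atlas_cover x; have cp := cfwd_sub cx.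
set p := cfwd c x in cp *; have oc := @ccod_open _ _ _ c.
have [w [w0 wS]] := ricci_kernel_vector hn hdeg ac cp.
have sG i r s := smooth_conn G i r s ac.
have symG := conn_symmetric G ac.
have symS y (cy : ccod c y) := symric_sym G c y.
have jets q (cq : ccod c q) := affine_jets hM hmn hdeg hdim ac cq.
have [eta [al [i0 [r [r0 rc [affe etap] [sal alp] HE]]]]] :=
  parallel_direction hn oc sG symG (msmooth_symric G ac) symS
    (fun y => rank_symric hdeg ac) (fun zeta aff => lie_symric ac aff) jets cp w0 wS.
pose B := ball p r; have oB : open B by exact: ball_open.
have Bp : B p by exact: ballxx.
have sGB i j k : smooth B (G c i j k) by exact: smooth_sub (sG i j k).
have symGB y (By : B y) := symG y (rc y By).
pose good l (fr : ('rV[R]_n -> R) * R) := [/\ 0 < fr.2, ball p fr.2 `<=` B,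
  smooth (ball p fr.2) fr.1, forall s, pd s fr.1 p = (s == l)%:R &
  forall y, ball p fr.2 y -> forall a b, pd a (pd b fr.1) y =
      \sum_k pd k fr.1 y * G c k a b y - (al y 0 a * pd b fr.1 y + al y 0 b * pd a fr.1 y)].
have /choice[fr Hfr] : forall l, exists fr, good l fr.
  move=> l; have [zeta [affz z0 Dz]] := isotropy_jets symS jets cp wS (delta_mx 0 l).
  rewrite -etap in Dz.
  have [f [rl [rl0 rlB sf dfp ddf]]] := affine_ratio oB sGB symGB Bp
    (affine_field_sub rc affe) (affine_field_sub rc affz) sal HE z0 Dz.
  by exists (f, rl); split => // s; rewrite dfp mxE.
pose rho := \big[Order.min/1]_l (fr l).2.
have rho0 : 0 < rho by apply: lt_bigmin => // l _; have [] := Hfr l.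
have Hrho y : ball p rho y -> forall l, ball p (fr l).2 y.
  by move=> py l; apply: le_ball py; exact: bigmin_le.
pose F y : 'rV[R]_n := \row_l (fr l).1 y.
have FE l : (fun z => F z 0 l) = (fr l).1 by apply/funext => z; rewrite mxE.
have sF : smooth_map (ball p rho) F.
  move=> l; rewrite FE; have [_ _ sf _ _] := Hfr l; apply: smooth_sub sf => y py.
  exact: Hrho.
have Jp : jacobian_mx F p = 1%:M.
  by apply/matrixP => k l; rewrite mxE FE; have [_ _ _ -> _] := Hfr l; rewrite mxE.
have orho : open (ball p rho) by exact: ball_open.
have [V [W [H [[oV Vp Vrho uJ] oW sH HF FH]]]] :=
  inverse_function orho (ballxx p rho0) sF Jp.
have Vl y l : V y -> ball p (fr l).2 y by move=> Vy; exact: Hrho (Vrho y Vy) l.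
have i1 : 'I_n := Ordinal hn.
have Vc : V `<=` ccod c.
  by move=> y Vy; have [_ lB _ _ _] := Hfr i1; apply/rc/lB/Vl.
have HFE y : V y -> forall i a b, pd a (pd b (fun z => F z 0 i)) y =
   \sum_k pd k (fun z => F z 0 i) y * G c k a b y
   - (al y 0 a * pd b (fun z => F z 0 i) y + al y 0 b * pd a (fun z => F z 0 i) y).
  by move=> Vy i a b; rewrite FE; have [_ _ _ _ Hi] := Hfr i; exact: Hi (Vl y i Vy) a b.
have [c' [ac' _ dc' fc' fl]] :=
  projectively_flat_chart hn ac oV Vc oW (fun l => smooth_sub Vrho (sF l)) sH HF FH uJ HFE.
exists c', (fun z => al (H z) *m (invmx (jacobian_mx F (H z)))^T).
split; [exact: ac'|exact: dc'|exact: fl|].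
by rewrite fc' /= -/p (HF _ Vp).2 alp mul0mx.
Qed.

(** The two families of fields required by the study of projectively flat balls are supplied here by
    the allowed jets at the centre. *)
Lemma flat_chart_kernel c (al : 'rV[R]_n -> 'rV[R]_n) p rho (w : 'rV[R]_n) :
    atlas c -> 0 < rho -> ball p rho `<=` ccod c -> projectively_flat G c al ->
    al p = 0 -> w *m symric G c p = 0 ->
  forall y, ball p rho y -> \sum_k al y 0 k * w 0 k = 0 /\
    forall r, \sum_k w 0 k * pd k (fun z => al z 0 r) y = 0.
Proof.
move=> ac rho0 Bc [sal GE] alp wS; have oc := @ccod_open _ _ _ c.
have cp : ccod c p by apply: Bc; exact: ballxx.
have sG i r s := smooth_conn G i r s ac.
have symS y (cy : ccod c y) := symric_sym G c y.
have jets q (cq : ccod c q) := affine_jets hM hmn hdeg hdim ac cq.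
have sub eta : affine_field (ccod c) (G c) eta -> affine_field (ball p rho) (G c) eta.
  exact: affine_field_sub.
have iso := isotropy_jets symS jets cp wS.
have salB : smooth_map (ball p rho) al by move=> r; exact: smooth_sub (sal r).
have GB y (By : ball p rho y) := GE y (Bc y By).
have [wr wrT] := ric_kernel hn oc sG cp iso.
have [wd _] := covd_kernel hn oc sG cp iso (msmooth_symric G ac)
  (fun zeta aff => lie_symric ac aff) symS.
have ch0 := flat_chris_center rho0 GB alp.
have tr : exists zeta,
    [/\ affine_field (ball p rho) (G c) zeta, zeta p = w & Dmx zeta p = 0].
  (* The connection coefficients vanish at [p], so the covariant identity for [S] along [w] becomes
     the constraint for the jet (w, 0). *)
  have [|zeta [aff zp Dz]] := jets p cp w 0.
    rewrite trmx0 mul0mx mulmx0 !addr0 -[RHS]wd; apply: eq_bigr => k _.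
    by rewrite /covd ch0 trmx0 mul0mx mulmx0 !subr0.
  by exists zeta; split => //; exact: sub.
have sh xi : exists zeta, [/\ affine_field (ball p rho) (G c) zeta, zeta p = 0 &
    Dmx zeta p = w^T *m xi].
  by have [zeta [aff zp Dz]] := iso xi; exists zeta; split => //; exact: sub.
move=> y By; split; first exact: (flat_kernel_form hn rho0 salB GB alp wr wrT tr sh By).
by move=> r; exact: (flat_kernel_invariant hn rho0 salB GB alp wr wrT tr r By).
Qed.

Lemma jacobian_mulmx (K : 'M[R]_n) y : jacobian_mx (fun z => z *m K) y = K.
Proof.
apply/matrixP => k i; rewrite mxE.
rewrite (_ : (fun z => _) = fun z : 'rV[R]_n => \sum_j K j i * z 0 j); last first.
  by apply/funext => z; rewrite mxE; apply: eq_bigr => j _; rewrite mulrC.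
have sZ j : smooth setT (fun z : 'rV[R]_n => K j i * z 0 j).
  by apply: (smoothM openT); [exact: smooth_cst|exact: smooth_coord].
rewrite (pd_sum openT) // (bigD1 k) //= big1 ?addr0 => [|j jk].
  by rewrite (pdZ (U := setT)) ?pd_coord ?eqxx ?mulr1 //; exact: smooth_coord.
by rewrite (pdZ (U := setT)) ?pd_coord ?(negbTE jk) ?mulr0 //; exact: smooth_coord.
Qed.

(* In the coordinates [z = y *m V^T], with V the right factor of the rank
   decomposition of the symmetric Ricci tensor at the centre, the kernel of that
   tensor is spanned by the last n - m coordinate vectors. *)
Lemma rank_coordinates (S : 'M[R]_n) : S^T = S -> exists2 K : 'M[R]_n, K \in unitmx &
  forall d : 'rV[R]_n, (forall j : 'I_n, (j < \rank S)%N -> d 0 j = 0) ->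
    d *m invmx K *m S = 0.
Proof.
move=> symS; exists (row_ebase S)^T; first by rewrite unitmx_tr row_ebase_unit.
move=> d d0; rewrite -[LHS]trmxK -[RHS]trmxK; congr trmx.
rewrite trmx0 !trmx_mul symS trmx_inv trmxK -[X in X *m _]mulmx_ebase -!mulmxA.
rewrite (mulmxA (row_ebase S)) mulmxV ?row_ebase_unit // mul1mx.
rewrite (_ : pid_mx _ *m d^T = 0) ?mulmx0 //; apply/colP => i; rewrite !mxE.
rewrite big1 // => j _; rewrite !mxE; have [->|_] /= := eqVneq (i : nat) j; last by rewrite mul0r.
by case: ltnP => [jm|_]; [rewrite d0 ?mulr0|rewrite mul0r].
Qed.

(** A linear change of coordinates keeps the projectively flat form and makes ker S at the centre
    the span of the last coordinate vectors. The image of the chart is cut down to a ball, whose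
    convexity turns vanishing derivatives along the kernel into independence of the last
    coordinates. *)
Lemma adapted_chart (x : M) : exists c p (rho : R) (al : 'rV[R]_n -> 'rV[R]_n),
  [/\ atlas c, cdom c x, 0 < rho /\ ccod c = ball p rho, projectively_flat G c al &
    forall y, ccod c y -> (forall j : 'I_n, (m <= j)%N -> al y 0 j = 0) /\
      forall z, ccod c z -> (forall j : 'I_n, (j < m)%N -> y 0 j = z 0 j) -> al y = al z].
Proof.
have [c [al [ac cx fl alp]]] := flat_chart x; set p := cfwd c x in alp.
have oc := @ccod_open _ _ _ c; have cp : ccod c p by exact: cfwd_sub.
have [rho rho0 Bc] : exists2 rho : R, 0 < rho & ball p rho `<=` ccod c.
  have /nbhs_ballP[rho rho0 H] : nbhs p (ccod c) by apply: open_nbhs_nbhs.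
  by exists rho.
have [K uK HK] := rank_coordinates (symric_sym G c p).
rewrite (rank_symric hdeg ac cp) in HK.
pose F := fun y : 'rV[R]_n => y *m K; pose H := fun z : 'rV[R]_n => z *m invmx K.
have FK y : H (F y) = y by rewrite /F /H mulmxK.
have HF z : F (H z) = z by rewrite /F /H mulmxKV.
have cont (L : 'M[R]_n) (y : 'rV[R]_n) : {for y, continuous (fun z : 'rV[R]_n => z *m L)}.
  apply: differentiable_continuous; apply: (row_differentiable openT) => //.
  exact: smooth_map_mulmx openT.
have [rho1 rho10 B1] : exists2 rho1 : R, 0 < rho1 & ball (F p) rho1 `<=` H @^-1` ball p rho.
  have /nbhs_ballP[rho1 rho10 B1] : nbhs (F p) (H @^-1` ball p rho).
    by apply: (cont (invmx K)); rewrite -/(H (F p)) FK; exact: nbhsx_ballx.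
  by exists rho1.
pose W := ball (F p) rho1; pose V := F @^-1` W.
have oW : open W by exact: ball_open.
have oV : open V by apply: open_comp => // y _; exact: cont.
have VB y : V y -> ball p rho y by move=> /B1; rewrite /= FK.
have sF : smooth_map V F by exact: smooth_map_mulmx.
have sH : smooth_map W H by exact: smooth_map_mulmx.
have jE y : jacobian_mx F y = K by exact: jacobian_mulmx.
have [salc GE] := fl.
have d2 y : V y -> forall i r s, pd r (pd s (fun z => F z 0 i)) y =
   \sum_k pd k (fun z => F z 0 i) y * G c k r s y
   - (al y 0 r * pd s (fun z => F z 0 i) y + al y 0 s * pd r (fun z => F z 0 i) y).
  move=> Vy i r s; have pF k z : pd k (fun z => F z 0 i) z = K k i.
    by have /matrixP/(_ k i) := jE z; rewrite mxE.
  rewrite (pd_eq (g := fun=> K s i) r oV Vy) ?pd_cst //.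
  rewrite (eq_bigr (fun k => (K k i * al y 0 r) * (k == s)%:R
     + (K k i * al y 0 s) * (k == r)%:R)); last first.
    by move=> k _; rewrite pF GE ?mulrDr ?mulrA //; exact/Bc/VB.
  by rewrite big_split /= !sum_delta !pF; ring.
have VF y : V y -> W (F y) /\ H (F y) = y by [].
have WH z : W z -> V (H z) /\ F (H z) = z by rewrite /V /= HF.
have uJ y : V y -> jacobian_mx F y \in unitmx by rewrite jE.
have Vc : V `<=` ccod c by move=> y /VB /Bc.
have [c' [ac' cc' dc' fc' fl']] := projectively_flat_chart hn ac oV Vc oW sF sH VF WH uJ d2.
exists c', (F p), rho1, (fun z => al (H z) *m (invmx (jacobian_mx F (H z)))^T).
split=> //.
  by apply: dc' => //; rewrite /V /=; exact: ballxx.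
(* A vector without its first m coordinates, carried back to the old coordinates, lies in ker S at
   the centre. *)
have ker (d : 'rV[R]_n) : (forall j : 'I_n, (j < m)%N -> d 0 j = 0) ->
    forall y, ball p rho y -> \sum_k al y 0 k * (H d) 0 k = 0 /\
    forall r, \sum_k (H d) 0 k * pd k (fun z => al z 0 r) y = 0.
  by move=> d0; apply: (flat_chart_kernel ac rho0 Bc fl alp); exact: HK.
move=> y; rewrite cc' => Wy; split=> [j mj|z].
  have [|E _] := ker (delta_mx 0 j) _ _ (VB _ (WH y Wy).1).
    by move=> i im; rewrite mxE andbC; case: eqP => // ij; rewrite ij ltnNge mj in im.
  rewrite jE -[RHS]E mxE; apply: eq_bigr => k _; congr (_ * _).
  by rewrite [LHS]mxE /H -rowE mxE.
rewrite !jE => Wz yz; congr (_ *m _); apply/rowP => r; apply/eqP.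
have salB : smooth (ball p rho) (fun z => al z 0 r) by exact: smooth_sub (salc r).
rewrite -subr_eq0.
have [u Bu ->] := mean_value_ball salB (VB _ (WH z Wz).1) (VB _ (WH y Wy).1).
have [|_ E] := ker (y - z) _ u Bu; first by move=> j jm; rewrite !mxE yz // subrr.
by rewrite -[X in _ == X](E r) /H mulmxBl.
Qed.

End MaximalSymmetry.

Theorem theorem17p2 (R : realType) (n : nat) (hn : (2 <= n)%N)
    (M : smoothManifold R n) (hM : connected [set: M])
    (G : symmetricConnection M) (A : operatorField M) (hA : nondegenerate_op A)
    (m : nat) (hmn : (m <= n)%N)
    (hdeg : intermediate_degeneration G m)
    (hdim : has_dim (point_symmetry A G)
              (n * (n + 1 - m) + (m * (m - 1))./2)%N) :
  forall x : M,
  exists c : chart R n M, [/\ atlas c, cdom c x &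
    exists (a : R) (u : 'I_m -> 'rV[R]_m -> R),
      (forall r, smooth_on (ccod c) (fun y => u r (first_coords hmn y))) /\
      forall y, ccod c y -> forall (p q : 'rV[R]_n) (i : 'I_n),
        system_rhs A G c y p q 0 i =
        a * q 0 i
        - 2 * a * (\sum_(r < m) u r (first_coords hmn y)
                                * p 0 (widen_ord hmn r)) * p 0 i].
Proof.
move=> x.
have [c [p0 [rho [al [ac cx [rho0 cE] [sal GE] Hal]]]]] :=
  adapted_chart hn hM hmn hdeg hdim x.
have [a Ea] := op_ball hn hM hmn hdeg hdim ac rho0 cE.
have oc := @ccod_open _ _ _ c.
(* The missing coordinates are filled with those of the centre; in the maximum norm this cannot
   increase the distance to the centre, so the point stays in the ball. *)
pose ext (v : 'rV[R]_m) : 'rV[R]_n :=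
  \row_i (if insub (i : nat) is Some r then v 0 r else p0 0 i).
have extE y (i : 'I_n) : (i < m)%N -> ext (first_coords hmn y) 0 i = y 0 i.
  move=> im; rewrite mxE insubT mxE; congr (y 0 _); exact: val_inj.
have cext y : ccod c y -> ccod c (ext (first_coords hmn y)).
  rewrite cE -ball_normE /= => py; apply: le_lt_trans py.
  apply: norm_le_coord => // i; rewrite [(_ - ext _) 0 i]mxE [(- ext _) 0 i]mxE.
  have [im|im] := ltnP i m.
    by rewrite extE //; have := coord_le_norm (p0 - y) i; rewrite !mxE.
  by rewrite mxE insubF ?subrr ?normr0 //; rewrite ltnNge im.
have alE y : ccod c y -> al (ext (first_coords hmn y)) = al y.
  move=> cy; apply/esym; have [_ H] := Hal y cy; apply: H => [|j jm]; first exact: cext.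
  by rewrite extE.
(* Alpha depends on the first m coordinates only, so it may be evaluated at the extended point. The
   sign matches -2a in the normal form, the quadratic term of the connection being 2 alpha(p)
   p^i. *)
exists c; split => //; exists a, (fun r v => - al (ext v) 0 (widen_ord hmn r)); split.
  move=> r; apply/smoothE.
  apply: (smooth_eq oc (f := fun y => - al y 0 (widen_ord hmn r))).
    by move=> y cy; rewrite alE.
  by apply: smoothN => //; exact: sal.
move=> y cy p q i; rewrite /system_rhs [LHS]mxE (bigD1 i) //= [X in _ + X]big1 => [|j ji]; last first.
  by rewrite Ea // eq_sym (negbTE ji) mulr0n mul0r.
rewrite addr0 Ea // eqxx mulr1n.
have -> : \sum_r \sum_s G c i r s y * p 0 r * p 0 s = 2 * (\sum_r al y 0 r * p 0 r) * p 0 i.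
  have E : \sum_r \sum_s (al y 0 r * p 0 r) * p 0 s * (i == s)%:R = (\sum_r al y 0 r * p 0 r) * p 0 i.
    by rewrite mulr_suml; apply: eq_bigr => r _; rewrite sum_delta'.
  rewrite (eq_bigr (fun r => \sum_s (al y 0 r * p 0 r) * p 0 s * (i == s)%:R
     + (\sum_s al y 0 s * p 0 s) * p 0 r * (i == r)%:R)); last first.
    move=> r _; rewrite -mulrA mulr_suml -big_split; apply: eq_bigr => s _ /=.
    by rewrite GE //; ring.
  by rewrite big_split E /= sum_delta'; ring.
(* The components of alpha from m on vanish because alpha annihilates the kernel directions. *)
have -> : \sum_r al y 0 r * p 0 r = \sum_(r < m) al y 0 (widen_ord hmn r) * p 0 (widen_ord hmn r).
  rewrite (bigID (fun r : 'I_n => r < m)%N) /= [X in _ + X]big1 ?addr0; last first.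
    by move=> r; rewrite -leqNgt => mr; have [-> //] := Hal y cy; rewrite mul0r.
  by rewrite (big_ord_narrow hmn).
rewrite alE //; under [X in _ = _ - _ * X * _]eq_bigr do rewrite mulNr.
by rewrite sumrN; ring.
Qed.
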